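(* There exist absolute constants $c, C>0$ such that the following holds. Fix any $\delta \le 1/4$. Under the data model below, take any covariance splitting $\Sigma = \Sigma_1\oplus\Sigma_2$ with $\Sigma_2\neq 0$. There exists $$\epsilon \le C\left(\sqrt{\frac{\log(1/\delta)}{r(\Sigma_2)}} + \sqrt{\frac{\log(1/\delta)}{n}} + \frac{n\log(1/\delta)}{R(\Sigma_2)}\right)$$ such that, if $\epsilon\le 1$ and $R(\Sigma_2) \ge c\log(1/\delta)^2$, then with probability at least $1-\delta$ the minimal Euclidean norm interpolator $\hat w$ satisfies $$\|\hat w\|_2 \le \|w^*\|_2 + (1+\epsilon)^{1/2}\,\sigma\sqrt{\frac{n}{\operatorname{Tr}(\Sigma_2)}}.$$
   Context: Data model: $d \ge n$; $\Sigma \in \mathbb{R}^{d\times d}$ is positive semidefinite; $w^* \in \mathbb{R}^d$ arbitrary; $\sigma\ge0$. $X \in \mathbb{R}^{n\times d}$ has i.i.d. rows $X_i \sim N(0,\Sigma)$, $\xi \sim N(0,\sigma^2 I_n)$ independent of $X$, $Y = Xw^*+\xi$. The minimal Euclidean norm interpolator is $\hat w \in \arg\min\{\|w\|_2 : Xw = Y\}$. Covariance splitting: $\Sigma = \Sigma_1\oplus\Sigma_2$ means $\Sigma=\Sigma_1+\Sigma_2$, both positive semidefinite, with orthogonal column spaces. Effective ranks for nonzero positive semidefinite $A$: $r(A) = \operatorname{Tr}(A)/\|A\|_{op}$ and $R(A) = \operatorname{Tr}(A)^2/\operatorname{Tr}(A^2)$. *)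

(* Defs.v *)
From HB Require Import structures.
From mathcomp Require Import all_boot all_order all_algebra.
From mathcomp Require Import all_classical all_reals all_analysis.
Set Implicit Arguments. Unset Strict Implicit. Unset Printing Implicit Defensive.
Import Order.TTheory GRing.Theory Num.Theory.
Local Open Scope classical_set_scope.
Local Open Scope ring_scope.

Section Defs.
Context {R : realType}.

Definition norm2 {k : nat} (v : 'cV[R]_k) : R :=
  Num.sqrt (\sum_(i < k) (v i 0) ^+ 2).

Definition psd {k : nat} (A : 'M[R]_k) : Prop :=
  A^T = A /\ forall v : 'cV[R]_k, 0 <= (v^T *m A *m v) 0 0.

Definition opnorm {k : nat} (A : 'M[R]_k) : R :=
  sup [set norm2 (A *m v) | v in [set v : 'cV[R]_k | norm2 v <= 1]].

Definition eff_r {k : nat} (A : 'M[R]_k) : R := \tr A / opnorm A.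
Definition eff_R {k : nat} (A : 'M[R]_k) : R := (\tr A) ^+ 2 / \tr (A *m A).

(* covariance splitting Sigma = Sigma1 (+) Sigma2: sum of two PSD matrices
   with orthogonal column spaces (every column of Sigma1 is orthogonal to
   every column of Sigma2, i.e. Sigma1^T Sigma2 = 0). *)
Definition cov_split {k : nat} (S S1 S2 : 'M[R]_k) : Prop :=
  S = S1 + S2 /\ psd S1 /\ psd S2 /\ S1^T *m S2 = 0.

Definition gauss_law (v : R) (B : set R) : \bar R :=
  if v == 0 then (\1_B (0 : R))%:E else normal_prob 0 (Num.sqrt v) B.

(* Data model: the vector (X, xi) is jointly Gaussian, centered, with
   covariance blockdiag(Sigma, ..., Sigma, sigma^2 I_n); i.e. every linear
   combination of its entries is a centered real Gaussian with the
   corresponding variance (Cramer-Wold definition).  This says exactly that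
   the rows of X are i.i.d. N(0, Sigma) and xi ~ N(0, sigma^2 I_n) is
   independent of X. *)
Definition data_model {d0 : measure_display} {T : measurableType d0}
  (P : probability T R) (n d : nat) (Sigma : 'M[R]_d) (sigma : R)
  (X : T -> 'M[R]_(n, d)) (xi : T -> 'cV[R]_n) : Prop :=
  forall (a : 'M[R]_(n, d)) (b : 'cV[R]_n),
    let f := fun w : T => \sum_(i < n) \sum_(j < d) a i j * X w i j
                          + \sum_(i < n) b i 0 * xi w i 0 in
    let v := \sum_(i < n) ((row i a) *m Sigma *m (row i a)^T) 0 0
             + sigma ^+ 2 * \sum_(i < n) (b i 0) ^+ 2 in
    measurable_fun setT f /\
    forall B : set R, measurable B -> P (f @^-1` B) = gauss_law v B.

Definition min_norm_interp {n d : nat} (X : 'M[R]_(n, d)) (Y : 'cV[R]_n)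
  (w : 'cV[R]_d) : Prop :=
  X *m w = Y /\ forall v : 'cV[R]_d, X *m v = Y -> norm2 w <= norm2 v.

End Defs.

(* Main.v *)
Require Import Defs.
From HB Require Import structures.
From mathcomp Require Import all_boot all_order all_algebra.
From mathcomp Require Import all_classical all_reals all_analysis.
From mathcomp Require Import measurable_realfun zify ring lra.
Set Implicit Arguments. Unset Strict Implicit. Unset Printing Implicit Defensive.
Import Order.TTheory GRing.Theory Num.Theory.
Import numFieldNormedType.Exports.
Local Open Scope classical_set_scope.
Local Open Scope ring_scope.

(* If [X u = xi] then the interpolator has norm at most [|wstar| + |u|].  With
   [Sigma2 = V Lam V^T], the matrix [B = X V] equals [Z Lam^(1/2)] for a standard
   Gaussian [Z] independent of [xi]; put [M = B B^T] and [u = V B^T M^-1 xi], so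
   that [|u|^2 = xi^T M^-1 xi].  Let [tau = tr Sigma2], [x = xi / sigma] and
   [r = x - M x / tau].  If [M >= tau / 4] then
   [tau x^T M^-1 x <= |x|^2 + r.x + 4 |r|^2], so a crude lower bound on [M] is
   enough as soon as [r] is small.  Since [x] is independent of [Z], the residual
   is controlled by chi-square tails for a fixed [x], after a rotation taking [x]
   to the first axis.  The lower bound on [M] is a union bound over integer points
   of norm at most [2 sqrt n]: rounding a vector of norm [sqrt n] coordinate by
   coordinate increases the quadratic form by at most a quarter of [tr M].
   Independence is extracted from the Cramer-Wold form of the model by
   characteristic functions and Gaussian smoothing. *)

(** * Integration against the standard Gaussian law *)

(** Each term of [epsilon] comes from one fluctuation. The number [r.x] is the deviation of a
    weighted chi-square sum whose largest weight is at most the operator norm of [Sigma2]; relative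
    to [|x|^2] it has order sqrt(log(1/delta) / r(Sigma2)). The noise norm [|x|^2] deviates from [n]
    by a relative sqrt(log(1/delta) / n). The part of [r] orthogonal to [x] enters only through
    [|r|^2], and its squared length relative to [|x|^2] has order n log(1/delta) tr(Sigma2^2) /
    tau^2, which is the last term; being already squared, it carries no root. The crude lower bound
    must survive about e^(6n) integer points, each failing with probability at most
    e^(-R(Sigma2)/128). This is affordable because [epsilon] is chosen equal to the bound with
    [C = 2000]: then [epsilon <= 1] forces n log(1/delta) / R(Sigma2) <= 1/2000. Dividing the noise
    by [sigma] excludes [sigma = 0]. In that case [xi] vanishes almost surely and [wstar] itself
    interpolates. *)

Section density.
Context d (T : measurableType d) (R : realType).
Variables (mu : {measure set T -> \bar R}) (nu : {measure set T -> \bar R}) (g : T -> R).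
Hypotheses (g0 : forall x, 0 <= g x) (mg : measurable_fun setT g).
Hypothesis nuE : forall A, measurable A -> nu A = (\int[mu]_(x in A) (g x)%:E)%E.

Import HBNNSimple.

Let density_nnsfun (h : {nnsfun T >-> R}) :
  (\int[nu]_x (h x)%:E = \int[mu]_x ((h x)%:E * (g x)%:E))%E.
Proof.
under [LHS]eq_integral do rewrite fimfunE -fsumEFin//.
rewrite ge0_integral_fsum//; last 2 first.
- by move=> r; exact/measurable_EFinP/measurableT_comp.
- by move=> r x _; rewrite EFinM nnfun_muleindic_ge0.
under [RHS]eq_integral.
  move=> x _; rewrite fimfunE -fsumEFin// ge0_mule_fsuml; last first.
    by move=> r; rewrite lee_fin; apply: nnfun_muleindic_ge0.
  over.
rewrite [RHS]ge0_integral_fsum//; last 2 first.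
- move=> r; apply: emeasurable_funM; last exact/measurable_EFinP.
  exact/measurable_EFinP/measurableT_comp.
- by move=> r x _; rewrite mule_ge0 ?(EFinM, nnfun_muleindic_ge0)// lee_fin.
apply: eq_fsbigr => r /set_mem[x _ <-].
under eq_integral do rewrite EFinM.
under [RHS]eq_integral do rewrite EFinM -muleA.
rewrite !ge0_integralZl//.
- rewrite integral_indic// setIT nuE// integral_mkcond; congr (_ * _)%E.
  apply: eq_integral => y _; rewrite patchE indicE.
  by case: ifP => _; rewrite ?mul1e ?mul0e.
all: try by [apply: emeasurable_funM; exact/measurable_EFinP|exact/measurable_EFinP].
all: try by move=> y _; rewrite ?mule_ge0// lee_fin.
all: by rewrite lee_fin fun_ge0.
Qed.

(** Simple functions reduce to [nuE] on their level sets; monotone convergence does the rest. *)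
Lemma ge0_integral_density (f : T -> \bar R) :
  measurable_fun setT f -> (forall x, (0 <= f x)%E) ->
  (\int[nu]_x f x = \int[mu]_x (f x * (g x)%:E))%E.
Proof.
move=> mf f0; pose h := nnsfun_approx measurableT mf.
have hf x : (h n x)%:E @[n --> \oo] --> f x by exact: cvg_nnsfun_approx.
have ndh x n m : (n <= m)%N -> ((h n x)%:E <= (h m x)%:E)%E.
  by move=> nm; rewrite lee_fin; exact/lefP/nd_nnsfun_approx.
have -> : (\int[nu]_x f x = limn (fun n => \int[nu]_x (h n x)%:E))%E.
  rewrite -monotone_convergence//=.
  - by apply: eq_integral => x _; apply/esym/cvg_lim => //; exact: hf.
  - by move=> n; exact/measurable_EFinP/measurable_funTS.
  - by move=> n x _; rewrite lee_fin.
  - by move=> x _ n m; exact: ndh.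
have -> : (\int[mu]_x (f x * (g x)%:E) =
    limn (fun n => \int[mu]_x ((h n x)%:E * (g x)%:E)))%E.
  rewrite -monotone_convergence//=.
  - apply: eq_integral => x _; apply/esym/cvg_lim => //.
    by apply: cvgeZr; [|exact: hf].
  - by move=> n; apply: emeasurable_funM; exact/measurable_EFinP/measurable_funTS.
  - by move=> n x _; rewrite mule_ge0// lee_fin.
  - by move=> x _ n m nm; rewrite lee_wpmul2r ?lee_fin//; exact/lefP/nd_nnsfun_approx.
by apply: congr_lim; apply/funext => n; exact: density_nnsfun.
Qed.

End density.

Section std_normal.
Context {R : realType}.
Local Notation N01 := (normal_prob (0 : R) 1).
Local Notation mu := (@lebesgue_measure R).

Lemma ge0_integral_std_normal (f : R -> \bar R) :
  measurable_fun setT f -> (forall x, (0 <= f x)%E) ->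
  (\int[N01]_x f x = \int[mu]_x (f x * (normal_pdf 0 1 x)%:E))%E.
Proof.
move=> mf f0; apply: ge0_integral_density => //.
- exact: normal_pdf_ge0.
- exact: measurable_normal_pdf.
Qed.

(** Tilting the standard density by [expR (s * x ^+ 2)] gives [t] times the centered Gaussian
    density of standard deviation [t = (1 - 2 s)^(-1/2)]. *)
Lemma integral_std_normal_expR_sqr (s : R) : s < 2^-1 ->
  (\int[N01]_x (expR (s * x ^+ 2))%:E = ((Num.sqrt (1 - 2 * s))^-1)%:E)%E.
Proof.
move=> s2; have s0 : 0 < 1 - 2 * s by lra.
have ss0 : 0 < Num.sqrt (1 - 2 * s) by rewrite sqrtr_gt0.
rewrite ge0_integral_std_normal; last 2 first.
- apply/measurable_EFinP/measurableT_comp => //.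
  by apply: measurable_funM => //; exact: measurable_funX.
- by move=> x; rewrite lee_fin expR_ge0.
set t := (Num.sqrt (1 - 2 * s))^-1.
have t0 : 0 < t by rewrite invr_gt0.
have tn0 : t != 0 by rewrite gt_eqF.
have peakt : normal_peak t = t^-1 * normal_peak 1.
  rewrite /normal_peak -!mulrnAr (sqrtrM _ (sqr_ge0 t)) sqrtr_sqr gtr0_norm//.
  by rewrite expr1n mul1r invfM.
under eq_integral => x _.
  rewrite (_ : (_ * _)%E = (t%:E * (normal_pdf 0 t x)%:E)%E); last first.
    rewrite -!EFinM; congr EFin.
    rewrite !normal_pdfE//= peakt !mulrA mulfV// mul1r mulrAC mulrC -!mulrA.
    rewrite /normal_fun -expRD; congr (_ * expR _).
    rewrite subr0 expr1n /t exprVn sqr_sqrtr ?ltW//.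
    by field; rewrite gt_eqF.
  over.
rewrite ge0_integralZl//.
- by rewrite integral_normal_pdf mule1.
- by apply/measurable_EFinP; exact: measurable_normal_pdf.
- by move=> x _; rewrite lee_fin normal_pdf_ge0.
- by rewrite lee_fin ltW.
Qed.

(** With [y = 2 s] the claim is 1 <= (1 - y) exp(y + y^2). Since (1 - y)(1 + y + y^2) = 1 - y^3, the
    bound [1 + u <= expR u] suffices for [y < 0]. For [y >= 0] it just fails, and (1 + u/2)^2 <=
    expR u is used instead. *)
Lemma inv_sqrt_le_expR (s : R) : s <= 8^-1 ->
  (Num.sqrt (1 - 2 * s))^-1 <= expR (s + 2 * s ^+ 2).
Proof.
move=> s8; have s0 : 0 < 1 - 2 * s by lra.
rewrite -[leRHS]invrK lef_pV2 ?posrE ?invr_gt0 ?expR_gt0 ?sqrtr_gt0//.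
rewrite -expRN -[leLHS]ger0_norm ?expR_ge0// -sqrtr_sqr (ler_sqrt _ (ltW s0)).
rewrite -expRM_natl mulrN expRN -[leRHS]invrK lef_pV2 ?posrE ?invr_gt0 ?expR_gt0//.
set y := 2 * s; have -> : 2%:R * (s + 2 * s ^+ 2) = y + y ^+ 2.
  by rewrite /y; ring.
have y4 : y <= 4^-1 by rewrite /y; lra.
have [y0|y0] := leP 0 y.
  have -> : y + y ^+ 2 = 2%:R * ((y + y ^+ 2) / 2) by field.
  rewrite expRM_natl; apply: (@le_trans _ _ ((1 + (y + y ^+ 2) / 2) ^+ 2)).
    rewrite -[leLHS]mul1r ler_pdivrMr; last by rewrite /y.
    nra.
  by apply: lerXn2r; rewrite ?nnegrE ?expR_ge0 ?expR_ge1Dx//; nra.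
rewrite -[leLHS]mul1r ler_pdivrMr; last by rewrite /y.
have h : 1 <= (1 - y) * (1 + (y + y ^+ 2)) by nra.
apply: (le_trans h); rewrite mulrC ler_pM2r ?expR_ge1Dx//; lra.
Qed.

(** The restriction on [s] is one-sided: every negative [s] is allowed, so lower tails will come
    without a constraint on the deviation. *)
Lemma integral_std_normal_expR_sqrB1 (s : R) : s <= 8^-1 ->
  (\int[N01]_x (expR (s * (x ^+ 2 - 1)))%:E <= (expR (2 * s ^+ 2))%:E)%E.
Proof.
move=> s8.
under eq_integral => x _.
  rewrite mulrBr mulr1 expRD mulrC EFinM; over.
rewrite ge0_integralZl//.
- rewrite integral_std_normal_expR_sqr; last lra.
  rewrite -EFinM lee_fin expRN mulrC ler_pdivrMr ?expR_gt0// -expRD [_ + s]addrC.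
  exact: inv_sqrt_le_expR.
- apply/measurable_EFinP/measurableT_comp => //.
  by apply: measurable_funM => //; exact: measurable_funX.
Qed.

End std_normal.

Lemma dominated_cvg_integral d (T : measurableType d) (R : realType)
    (mu : {measure set T -> \bar R}) (f_ : (T -> \bar R)^nat) (f g : T -> \bar R) :
  (forall n, measurable_fun setT (f_ n)) -> measurable_fun setT f ->
  (forall x, f_ ^~ x @ \oo --> f x) -> mu.-integrable setT g ->
  (forall x n, (`|f_ n x| <= g x)%E) ->
  (\int[mu]_x f_ n x)%E @[n --> \oo] --> (\int[mu]_x f x)%E.
Proof.
move=> mf_ mf f_f ig fg.
by have [] := @dominated_convergence _ _ _ mu setT measurableT f_ f g mf_ mf
  (aeW _ (fun x _ => f_f x)) ig (aeW _ (fun x n _ => fg x n)).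
Qed.

Lemma bounded_measurable_integrable d (T : measurableType d) (R : realType)
    (mu : {finite_measure set T -> \bar R}) (f : T -> R) (K : R) :
  measurable_fun setT f -> (forall x, `|f x| <= K) ->
  mu.-integrable setT (EFin \o f).
Proof.
move=> mf fK; apply: measurable_bounded_integrable => //.
  exact: fin_num_fun_lty.
exists K; split; first exact: num_real.
by move=> x Kx y _ /=; rewrite (le_trans (fK y))// ltW.
Qed.

Lemma measurable_cosD d (T : measurableType d) (R : realType) (f : T -> R) :
  measurable_fun setT f -> measurable_fun setT (fun x => cos (f x)).
Proof.
by move=> mf; apply: (measurableT_comp _ mf);
  apply: continuous_measurable_fun; exact: continuous_cos.
Qed.

Lemma measurable_sinD d (T : measurableType d) (R : realType) (f : T -> R) :
  measurable_fun setT f -> measurable_fun setT (fun x => sin (f x)).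
Proof.
by move=> mf; apply: (measurableT_comp _ mf);
  apply: continuous_measurable_fun; exact: continuous_sin.
Qed.

Lemma measurable_affine (R : realType) (a b : R) :
  measurable_fun setT (fun x : R => a * x + b).
Proof. by apply: measurable_funD => //; exact: measurable_funM. Qed.

(** * Characteristic function of the standard Gaussian law *)

Section characteristic.
Context {R : realType}.
Local Notation N01 := (normal_prob (0 : R) 1).
Local Notation mu := (@lebesgue_measure R).
Local Notation pdf := (normal_pdf (0 : R) 1).

Lemma integral_std_normal (f : R -> R) : measurable_fun setT f ->
  (\int[N01]_x (f x)%:E = \int[mu]_x (f x * pdf x)%:E)%E.
Proof.
move=> mf; have mfE : measurable_fun setT (EFin \o f) by exact/measurable_EFinP.
rewrite integralE [RHS]integralE.
rewrite !ge0_integral_std_normal//; last 2 first.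
- exact: measurable_funeneg.
- exact: measurable_funepos.
congr (_ - _)%E; apply: eq_integral => x _.
- rewrite !funeposE -!EFin_max -EFinM; congr EFin.
  by rewrite maxr_pMl ?normal_pdf_ge0// mul0r.
- rewrite !funenegE -!EFinN -!EFin_max -EFinM; congr EFin.
  by rewrite maxr_pMl ?normal_pdf_ge0// mul0r mulNr.
Qed.

Lemma integrable_std_normal_id : N01.-integrable setT (fun x : R => (Num.norm x)%:E).
Proof.
apply: (@le_integrable _ _ _ N01 setT measurableT _
  (fun x => (expR (4^-1 * x ^+ 2))%:E)).
- exact/measurable_EFinP.
- move=> x _; rewrite /= lee_fin normr_id [leRHS]ger0_norm ?expR_ge0//.
  apply: le_trans (expR_ge1Dx _); rewrite -(real_normK (num_real x)).
  have := sqr_ge0 (`|x| - 2); nra.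
- apply/integrableP; split.
    apply/measurable_EFinP/measurableT_comp => //.
    by apply: measurable_funM => //; exact: measurable_funX.
  under eq_integral do rewrite gee0_abs ?lee_fin ?expR_ge0//.
  by rewrite integral_std_normal_expR_sqr ?ltry//; lra.
Qed.

Let integrable_lebesgue (f : R -> R) : measurable_fun setT f ->
  (\int[N01]_x (Num.norm (f x))%:E < +oo)%E ->
  mu.-integrable setT (fun x => (f x * pdf x)%:E).
Proof.
move=> mf fi; apply/integrableP; split.
  by apply/measurable_EFinP/measurable_funM => //; exact: measurable_normal_pdf.
move: fi; rewrite integral_std_normal; last exact: measurableT_comp.
under [in X in _ -> X]eq_integral do
  rewrite abse_EFin normrM [X in _ * X]ger0_norm ?normal_pdf_ge0//.
by [].
Qed.

(** An antiderivative of [f t c * pdf] that vanishes at infinity. Integrating over growing intervals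
    gives [stein], which is the identity E[x g(x)] = E[g'(x)] for g(x) = sin(t x + c). *)
Let F t c (x : R) : R := - (sin (t * x + c) * pdf x).

Let dF t c (x : R) : is_derive x 1 (F t c)
  ((x * sin (t * x + c) - t * cos (t * x + c)) * pdf x).
Proof.
rewrite /F normal_pdfE; last exact: oner_neq0.
rewrite /normal_fun; apply: is_derive_eq.
rewrite /GRing.scale/= subr0 expr1n; by field.
Qed.

Let f t c (x : R) : R := x * sin (t * x + c) - t * cos (t * x + c).

Let mf t c : measurable_fun setT (f t c).
Proof.
apply: measurable_funB; apply: measurable_funM => //.
- by apply: measurable_sinD; exact: measurable_affine.
- by apply: measurable_cosD; exact: measurable_affine.
Qed.

Let f_ub t c x : `|f t c x| <= `|x| + `|t|.
Proof.
apply: le_trans (ler_normB _ _) _; rewrite !normrM lerD//.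
- by rewrite ler_piMr// sin_max.
- by rewrite ler_piMr// cos_max.
Qed.

Let if_ t c : N01.-integrable setT (EFin \o f t c).
Proof.
apply: (@le_integrable _ _ _ N01 setT measurableT _
  (fun x => ((Num.norm x)%:E + (Num.norm t)%:E)%E)).
- by apply/measurable_EFinP; exact: mf.
- move=> x _; rewrite /= lee_fin [leRHS]ger0_norm ?addr_ge0//; exact: f_ub.
- apply: integrableD => //; first exact: integrable_std_normal_id.
  exact: finite_measure_integrable_cst.
Qed.

Let ifp t c : mu.-integrable setT (fun x => (f t c x * pdf x)%:E).
Proof.
by apply: integrable_lebesgue => //; have /integrableP[] := if_ t c.
Qed.

Let F_ub t c x : `|F t c x| <= pdf x.
Proof.
rewrite /F normrN normrM [X in _ * X]ger0_norm ?normal_pdf_ge0//.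
by rewrite ler_piMl ?normal_pdf_ge0// sin_max.
Qed.

Let pdf_ub (x : R) : x != 0 -> pdf x <= normal_peak 1 * `|x|^-1.
Proof.
move=> x0; rewrite normal_pdfE; last exact: oner_neq0.
rewrite ler_wpM2l ?normal_peak_ge0// /normal_fun subr0 expr1n mulNr expRN.
rewrite lef_pV2 ?posrE ?expR_gt0 ?normr_gt0//.
apply: le_trans (expR_ge1Dx _); rewrite -(real_normK (num_real x)).
have := sqr_ge0 (`|x| - 1); lra.
Qed.

Let I (n : nat) : set R := `[- n.+1%:R, n.+1%:R].

Let FTC t c (n : nat) :
  (\int[mu]_(x in I n) (f t c x * pdf x)%:E =
   (F t c n.+1%:R - F t c (- n.+1%:R))%R%:E)%E.
Proof.
have dFx x : derivable (F t c) x 1 by have [] := dF t c x.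
have cF x : {for x, continuous (F t c)}.
  by apply: differentiable_continuous; apply/derivable1_diffP.
have np : (0 : R) < n.+1%:R by rewrite ltr0n.
rewrite EFinB; apply: continuous_FTC2.
- lra.
- apply: continuous_subspaceT => x; apply: cvgM.
    apply: cvgB; apply: cvgM; try exact: cvg_cst; try exact: cvg_id.
    + apply: (cvg_comp (fun x => t * x + c) sin); last exact: continuous_sin.
      by apply: cvgD; [apply: cvgM; [exact: cvg_cst|exact: cvg_id]|exact: cvg_cst].
    + apply: (cvg_comp (fun x => t * x + c) cos); last exact: continuous_cos.
      by apply: cvgD; [apply: cvgM; [exact: cvg_cst|exact: cvg_id]|exact: cvg_cst].
  by apply: continuous_normal_pdf; exact: oner_neq0.
- split => [x _||]; first exact: dFx.
  + by apply: cvg_at_right_filter; exact: cF.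
  + by apply: cvg_at_left_filter; exact: cF.
- by move=> x _; rewrite derive1E; have [_ ->] := dF t c x.
Qed.

Let stein t c : (\int[N01]_x (f t c x)%:E = 0)%E.
Proof.
rewrite integral_std_normal//.
pose g n := (fun x => (f t c x * pdf x)%:E) \_ (I n).
have mfp : measurable_fun setT (fun x => (f t c x * pdf x)%:E).
  by have /integrableP[] := ifp t c.
have mI n : measurable (I n) by exact: measurable_itv.
have mg n : measurable_fun setT (g n).
  by apply/(measurable_restrictT _ (mI n)); exact: measurable_funTS mfp.
have gcvg x : (g n x) @[n --> \oo] --> (f t c x * pdf x)%:E.
  apply: cvg_near_cst; near=> n; rewrite /g patchE ifT//.
  rewrite inE /I/= in_itv/= -ler_norml.
  rewrite (@le_trans _ _ n%:R) ?ler_nat//.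
  by near: n; exact: nbhs_infty_ger.
have gub x n : (`|g n x| <= `|(f t c x * pdf x)%:E|)%E.
  by rewrite /g patchE; case: ifPn => // _; rewrite abse0.
have h := @dominated_cvg_integral _ _ R mu g _ _ mg mfp gcvg (integrable_abse (ifp t c)) gub.
have h' : [sequence (\int[mu]_x g n x)%E]_n @ \oo --> 0%:E.
  apply/fine_cvgP.
  have E n : (\int[mu]_x g n x = (F t c n.+1%:R - F t c (- n.+1%:R))%R%:E)%E.
    by rewrite -integral_mkcond FTC.
  split; first by apply: nearW => n /=; rewrite E.
  apply: norm_cvg0.
  apply: (@squeeze_cvgr _ _ _ _ (cst 0) (fun n => 2 * normal_peak 1 * harmonic n)).
  - apply: nearW => n /=; rewrite E/= normr_ge0/=.
    apply: le_trans (ler_normB _ _) _.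
    rewrite (_ : 2 * _ * _ = normal_peak 1 / n.+1%:R + normal_peak 1 / n.+1%:R);
      last by rewrite /harmonic/=; ring.
    have n0 : (n.+1%:R : R) != 0 by rewrite pnatr_eq0.
    by apply: lerD; apply: le_trans (F_ub _ _ _) _;
      apply: le_trans (pdf_ub _) _; rewrite ?oppr_eq0// ?normrN ger0_norm.
  - exact: cvg_cst.
  - rewrite -[X in _ --> X](mulr0 (2 * normal_peak 1)).
    by apply: cvgM; [exact: cvg_cst|exact: cvg_harmonic].
by rewrite -(cvg_lim _ h)// (cvg_lim _ h').
Unshelve. all: by end_near. Qed.

Let phi c (t : R) : R := \int[N01]_x cos (t * x + c).

Let icos t c : N01.-integrable setT (EFin \o (fun x => cos (t * x + c))).
Proof.
apply: (@bounded_measurable_integrable _ _ _ _ _ 1).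
- by apply: measurable_cosD; exact: measurable_affine.
- by move=> x; exact: cos_max.
Qed.

Let isin t c : N01.-integrable setT (EFin \o (fun x => x * sin (t * x + c))).
Proof.
apply: (@le_integrable _ _ _ N01 setT measurableT _ (fun x => (Num.norm x)%:E)).
- apply/measurable_EFinP; apply: measurable_funM => //.
  by apply: measurable_sinD; exact: measurable_affine.
- move=> x _; rewrite /= lee_fin normr_id normrM ler_piMr//; exact: sin_max.
- exact: integrable_std_normal_id.
Qed.

Let stein' t c : \int[N01]_x (x * sin (t * x + c)) = t * phi c t.
Proof.
have ic' : N01.-integrable setT (EFin \o (fun x => t * cos (t * x + c))).
  rewrite (_ : _ \o _ = (fun x => t%:E * (EFin \o (fun x => cos (t * x + c))) x)%E);
    last by apply/funext => x.
  exact: integrableZl.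
apply/eqP; rewrite -subr_eq0 /phi -(RintegralZl t measurableT (icos t c)).
by rewrite -RintegralB// /Rintegral stein.
Qed.

Let dcos (c x t : R) : is_derive t 1 (fun t => cos (t * x + c)) (- (x * sin (t * x + c))).
Proof.
apply: is_derive_eq; rewrite /GRing.scale/=; ring.
Qed.

Let dphi c (t : R) : is_derive t 1 (phi c) (- (t * phi c t)).
Proof.
pose f2 (t x : R) : R := cos (t * x + c).
have ti : `]t - 1, t + 1[%classic t by rewrite /= in_itv/=; lra.
have derf (x y : R) : derivable (f2 ^~ y) x 1.
  by have [] := dcos c y x.
have d1 (x y : R) : partial1of2 f2 x y =
    - (y * sin (x * y + c)).
  by rewrite partial1of2E; have [_ <-] := dcos c y x.
have ub (x y : R) : `|partial1of2 f2 x y| <= `|y|.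
  by rewrite d1 normrN normrM ler_piMr// sin_max.
apply: DeriveDef.
- apply: (@derivable_under_integral R _ _ N01 f2
    setT measurableT t _ _ ti _ _ Num.norm) => //.
  + by move=> ? _; exact: icos.
  + exact: integrable_std_normal_id.
- rewrite -derive1E.
  rewrite (@differentiation_under_integral R _ _ N01 f2
    setT measurableT t _ _ ti _ _ Num.norm) => //.
  + rewrite -stein'.
    under eq_Rintegral do rewrite d1 -mulN1r.
    by rewrite RintegralZl// mulN1r.
  + by move=> ? _; exact: icos.
  + exact: integrable_std_normal_id.
Qed.

(** The phase [c] lets one real integral carry both parts of the characteristic function.
    Differentiation under the integral and Stein's identity give phi' = - t phi, so phi(t)
    exp(t^2/2) is constant. *)
Lemma Rintegral_std_normal_cos (t c : R) :
  \int[N01]_x cos (t * x + c) = cos c * expR (- (t ^+ 2 / 2)).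
Proof.
pose h (t : R) := phi c t * expR (t ^+ 2 / 2).
have dh (s : R) : is_derive s 1 h 0.
  have := dphi c s => dphis.
  apply: is_derive_eq; rewrite /GRing.scale/=; by field.
have h0 : h 0 = cos c.
  rewrite /h expr0n/= mul0r expR0 mulr1 /phi.
  under eq_Rintegral do rewrite mul0r add0r.
  rewrite Rintegral_cst//= -[RHS]mulr1; congr (_ * _).
  rewrite -[RHS]/(fine 1%E); congr fine.
  exact: (@probability_setT _ _ _ N01).
have ht : h t = cos c by exact: (etrans (@is_derive_0_is_cst _ h t 0 dh) h0).
transitivity (h t * expR (- (t ^+ 2 / 2))); last by rewrite ht.
by rewrite /h -mulrA -expRD subrr expR0 mulr1.
Qed.

End characteristic.

Lemma integral_EFin d (T : measurableType d) (R : realType)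
    (mu : {measure set T -> \bar R}) (f : T -> R) :
  mu.-integrable setT (EFin \o f) ->
  (\int[mu]_x (f x)%:E)%E = (\int[mu]_x f x)%:E.
Proof. by move=> fi; rewrite /Rintegral fineK//; exact: integrable_fin_num. Qed.

Lemma bounded_measurable_integrable2 d1 d2 (T1 : measurableType d1)
    (T2 : measurableType d2) (R : realType) (P1 : probability T1 R)
    (P2 : probability T2 R) (f : T1 * T2 -> R) (K : R) :
  measurable_fun setT f -> (forall x, `|f x| <= K) ->
  (P1 \x P2)%E.-integrable setT (EFin \o f).
Proof.
move=> mf fK; apply: measurable_bounded_integrable => //.
  rewrite [X in (X < _)%E](_ : _ = (P1 setT * P2 setT)%E).
    by rewrite !probability_setT mule1 ltry.
  by rewrite -(product_measure1E P1 P2 measurableT measurableT) setXTT.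
exists K; split; first exact: num_real.
by move=> x Kx y _ /=; rewrite (le_trans (fK y))// ltW.
Qed.

(** * Gaussian smoothing and uniqueness of weighted laws *)

Section tail.
Context {R : realType}.

(** The density of width [s] is compared with that of width [r = sqrt 2 * s]: their quotient is sqrt
    2 * exp(-q) with q = (y - x)^2 / (4 s^2). On [B] one has exp(-q) <= 1/q <= [k], and the wider
    density has total mass one. *)
Lemma normal_prob_far (x e : R) (n : nat) (B : set R) : measurable B -> 0 < e ->
  (forall y, B y -> e <= `|y - x|) ->
  (normal_prob x n.+1%:R^-1 B <= (8 / e ^+ 2 * harmonic n)%:E)%E.
Proof.
move=> mB e0 Be; set s : R := n.+1%:R^-1.
have s0 : 0 < s by rewrite invr_gt0 ltr0n.
pose r : R := Num.sqrt 2 * s.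
have r0 : 0 < r by rewrite mulr_gt0// sqrtr_gt0.
have r2 : r ^+ 2 = 2 * s ^+ 2 by rewrite exprMn sqr_sqrtr.
have peak : normal_peak s = Num.sqrt 2 * normal_peak r.
  rewrite /normal_peak r2 (_ : 2 * _ * _ *+ 2 = 2 * (s ^+ 2 * pi *+ 2)); last by ring.
  by rewrite sqrtrM// invfM mulrA mulfV ?mul1r// gt_eqF// sqrtr_gt0.
have sqrt2 : Num.sqrt 2 <= 2 :> R.
  by rewrite -[leRHS]ger0_norm// -sqrtr_sqr ler_sqrt; lra.
pose k : R := 4 / e ^+ 2 * harmonic n.
have k0 : 0 <= k by rewrite mulr_ge0 ?invr_ge0// divr_ge0// sqr_ge0.
apply: (@le_trans _ _ (\int[lebesgue_measure]_(y in B) ((2 * k) * normal_pdf x r y)%:E)%E).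
  apply: ge0_le_integral => //.
  - by move=> y _; rewrite lee_fin normal_pdf_ge0.
  - by apply/measurable_EFinP/measurable_funTS; exact: measurable_normal_pdf.
  - apply/measurable_EFinP/measurable_funTS/measurable_funM => //.
    exact: measurable_normal_pdf.
  - move=> y By; rewrite lee_fin !normal_pdfE ?gt_eqF// peak.
    have E : normal_fun x s y <= k * normal_fun x r y.
      have z2 : e ^+ 2 <= (y - x) ^+ 2.
        rewrite -[leRHS]real_normK ?num_real//.
        by rewrite lerXn2r ?nnegrE ?normr_ge0 ?(ltW e0)// Be.
      have np : (0 : R) < n.+1%:R by rewrite ltr0n.
      have n1 : (1 : R) <= n.+1%:R by rewrite ler1n.
      have sE : s ^+ 2 = (n.+1%:R ^+ 2)^-1 by rewrite /s exprVn.
      rewrite /normal_fun r2 sE.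
      set q := (y - x) ^+ 2 * n.+1%:R ^+ 2 / 4.
      rewrite (_ : - (y - x) ^+ 2 / (_ *+ 2) = - q - q); last first.
        by rewrite /q; field; rewrite gt_eqF.
      rewrite (_ : - (y - x) ^+ 2 / (_ *+ 2) = - q); last first.
        by rewrite /q; field; rewrite gt_eqF.
      rewrite expRD ler_pM2r ?expR_gt0// expRN -[leRHS]invrK.
      have kp : 0 < k by rewrite mulr_gt0 ?divr_gt0 ?exprn_gt0 ?invr_gt0.
      rewrite lef_pV2 ?posrE ?expR_gt0 ?invr_gt0//.
      apply: le_trans (expR_ge1Dx _).
      rewrite /k /harmonic /= !invfM !invrK.
      apply: (@le_trans _ _ (e ^+ 2 * n.+1%:R ^+ 2 / 4)).
        by have := sqr_ge0 e; nra.
      by rewrite /q; have := sqr_ge0 (n.+1%:R : R); nra.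
    have p0 := normal_peak_ge0 r; have f0 := normal_fun_ge0 x s y.
    apply: (@le_trans _ _ (2 * normal_peak r * normal_fun x s y)).
      by rewrite ler_wpM2r// ler_wpM2r.
    by rewrite (_ : 2 * k * _ = 2 * normal_peak r * (k * normal_fun x r y));
      [rewrite ler_wpM2l// mulr_ge0|ring].
under eq_integral do rewrite EFinM.
rewrite ge0_integralZl//=; last 3 first.
- by apply/measurable_EFinP/measurable_funTS; exact: measurable_normal_pdf.
- by move=> y _; rewrite lee_fin normal_pdf_ge0.
- by rewrite lee_fin mulr_ge0.
rewrite (_ : 8 / e ^+ 2 * harmonic n = (2 * k) * 1); last by rewrite /k; ring.
rewrite [leRHS]EFinM lee_wpmul2l//; first by rewrite lee_fin mulr_ge0.
exact: (@probability_le1 _ _ _ (normal_prob x r) B mB).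
Qed.

End tail.

Section smoothing.
Context {R : realType}.
Local Notation N01 := (normal_prob (0 : R) 1).
Local Notation leb := (@lebesgue_measure R).

(* Inversion after convolution with a Gaussian of width [s]: the density
   [normal_fun y s (H t)] is itself an average of cosines of [H t], so its
   integral against [W] depends only on [char].  Then [s] tends to [0]. *)
Let kappa (s y : R) : R :=
  \int[N01]_u (cos (- (u / s * y)) * expR (- ((u / s) ^+ 2 / 2))).

Section weight.
Context d (T : measurableType d) (P : probability T R).
Variables (H W : T -> R) (w K : R).
Hypotheses (mH : measurable_fun setT H) (mW : measurable_fun setT W).
Hypothesis WK : forall t, `|W t| <= K.
Hypothesis char : forall t c : R,
  \int[P]_x (W x * cos (t * H x + c)) = w * (cos c * expR (- (t ^+ 2 / 2))).

Lemma integral_normal_fun_weight (s y : R) : 0 < s ->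
  (\int[P]_t (W t * normal_fun y s (H t))%:E = (w * kappa s y)%:E)%E.
Proof.
move=> s0.
pose f (z : T * R) : R := W z.1 * cos (z.2 / s * H z.1 + - (z.2 / s * y)).
have mf : measurable_fun setT f.
  apply: measurable_funM; first exact: measurableT_comp mW measurable_fst.
  apply: measurable_cosD; apply: measurable_funD.
    apply: measurable_funM; last exact: measurableT_comp mH measurable_fst.
    by apply: measurable_funM => //; exact: measurable_snd.
  apply: measurableT_comp => //; apply: measurable_funM => //.
  by apply: measurable_funM => //; exact: measurable_snd.
have fK z : `|f z| <= K.
  by rewrite normrM (le_trans _ (WK z.1))// ler_piMr// cos_max.
have fi : (P \x N01)%E.-integrable setT (EFin \o f).
  exact: (@bounded_measurable_integrable2 _ _ _ _ _ P N01 f K mf fK).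
have FE := Fubini fi.
transitivity (\int[P]_t \int[N01]_u (EFin \o f) (t, u))%E.
  apply: eq_integral => t _.
  have E u : f (t, u) = W t * cos ((H t - y) / s * u + 0).
    by rewrite /f/=; congr (_ * cos _); field; rewrite gt_eqF.
  rewrite /=; under eq_integral do rewrite E.
  rewrite integral_EFin.
    rewrite RintegralZl//; last first.
      apply: (@bounded_measurable_integrable _ _ _ _ _ 1).
        by apply: measurable_cosD; exact: measurable_affine.
      by move=> x; exact: cos_max.
    rewrite Rintegral_std_normal_cos cos0 mul1r; congr (_ * expR _)%:E.
    by field; rewrite gt_eqF.
  apply: (@bounded_measurable_integrable _ _ _ _ _ K).
    apply: measurable_funM => //.
    by apply: measurable_cosD; exact: measurable_affine.
  by move=> x; rewrite normrM (le_trans _ (WK t))// ler_piMr// cos_max.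
rewrite FE; pose g (u : R) := cos (- (u / s * y)) * expR (- ((u / s) ^+ 2 / 2)).
have mg : measurable_fun setT g.
  apply: measurable_funM.
    apply: measurable_cosD; apply: measurableT_comp => //.
    by do 2 apply: measurable_funM => //.
  apply: measurableT_comp => //; apply: measurableT_comp => //.
  by apply: measurable_funM => //; apply: measurable_funX; exact: measurable_funM.
have g1 u : `|g u| <= 1.
  rewrite normrM mulr_ile1//; first exact: cos_max.
  by rewrite ger0_norm ?expR_ge0// -[leRHS]expR0 ler_expR oppr_le0 divr_ge0// sqr_ge0.
have ig : N01.-integrable setT (EFin \o g).
  exact: (@bounded_measurable_integrable _ _ _ N01 g 1 mg g1).
rewrite /kappa -(RintegralZl w measurableT ig) -integral_EFin; last first.
  apply: (@bounded_measurable_integrable _ _ _ _ _ `|w|).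
    exact: measurable_funM.
  by move=> x; rewrite normrM ler_piMr.
apply: eq_integral => u _; rewrite -char integral_EFin//.
apply: (@bounded_measurable_integrable _ _ _ _ _ K).
  apply: measurable_funM => //.
  by apply: measurable_cosD; apply: measurable_funD => //=; exact: measurable_funM.
by move=> x; rewrite normrM (le_trans _ (WK x))// ler_piMr// cos_max.
Qed.

(** The Gaussian kernel is symmetric in its center and its argument, so Fubini turns the integral
    over [t] into the one just computed. The right-hand side depends on [P], [H] and [W] only
    through [w]. *)
Lemma integral_normal_prob_weight (s : R) (B : set R) : 0 < s -> measurable B ->
  (\int[P]_t ((W t)%:E * normal_prob (H t) s B) =
   \int[leb]_y (w * (normal_peak s * kappa s y * \1_B y))%:E)%E.
Proof.
move=> s0 mB.
pose f (z : T * R) : R := W z.1 * (normal_pdf (H z.1) s z.2 * \1_B z.2).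
have mpdf : measurable_fun setT (fun z : T * R => normal_pdf (H z.1) s z.2).
  rewrite (_ : (fun _ => _) = fun z : T * R => normal_pdf 0 s (z.2 - H z.1)).
    apply: (measurableT_comp (measurable_normal_pdf 0 s)).
    apply: measurable_funB; first exact: measurable_snd.
    exact: measurableT_comp mH measurable_fst.
  by apply/funext => z; rewrite !normal_pdfE ?gt_eqF// /normal_fun subr0.
have mf : measurable_fun setT f.
  apply: measurable_funM; first exact: measurableT_comp mW measurable_fst.
  apply: measurable_funM => //.
  by apply: measurableT_comp measurable_snd; exact: measurable_indic.
have nP x : (\int[leb]_y (normal_pdf x s y * \1_B y)%:E = normal_prob x s B)%E.
  rewrite /normal_prob [RHS]integral_mkcond; apply: eq_integral => y _.
  by rewrite patchE indicE; case: ifP => _; rewrite ?mulr1 ?mulr0.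
have mfE : measurable_fun setT (EFin \o f) by exact/measurable_EFinP.
have mabs := measurableT_comp (@abse_measurable R setT) mfE.
have K0 : 0 <= K by exact: le_trans (normr_ge0 _) (WK point).
have fi : (P \x leb)%E.-integrable setT (EFin \o f).
  apply/integrable12ltyP => //.
  apply: (@le_lt_trans _ _ (\int[P]_t K%:E)%E); last first.
    by rewrite integral_cst//= probability_setT mule1 ltry.
  apply: ge0_le_integral => //.
  - by move=> t _; exact: integral_ge0.
  - exact: (@measurable_fun_fubini_tonelli_F _ _ _ _ _ leb _ mabs (fun z => abse_ge0 _)).
  - move=> t _.
    apply: (@le_trans _ _ (\int[leb]_y (K%:E * (normal_pdf (H t) s y)%:E))%E).
      apply: ge0_le_integral => //.
      + exact: (measurableT_comp mabs (pair1_measurable t)).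
      + apply/measurable_EFinP/measurable_funM => //; exact: measurable_normal_pdf.
      + move=> y _; rewrite /= lee_fin !normrM ler_pM//.
        rewrite [X in X * _]ger0_norm ?normal_pdf_ge0// ler_piMr ?normal_pdf_ge0//.
        by rewrite indicE; case: (_ \in _); rewrite ?normr1 ?normr0.
    rewrite ge0_integralZl//.
    + by rewrite integral_normal_pdf mule1.
    + by apply/measurable_EFinP; exact: measurable_normal_pdf.
    + by move=> y _; rewrite lee_fin normal_pdf_ge0.
have ipdfB x : leb.-integrable setT (fun y => (normal_pdf x s y * \1_B y)%:E).
  apply: (@le_integrable _ _ _ leb setT measurableT _ (fun y => (normal_pdf x s y)%:E)).
  - apply/measurable_EFinP; apply: measurable_funM => //; exact: measurable_normal_pdf.
  - move=> y _; rewrite /= lee_fin normrM ler_piMr//.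
    by rewrite indicE; case: (_ \in _); rewrite ?normr1 ?normr0.
  - exact: integrable_normal_pdf.
transitivity (\int[P]_t \int[leb]_y (EFin \o f) (t, y))%E.
  by apply: eq_integral => t _; rewrite -nP -integralZl.
rewrite (Fubini fi); apply: eq_integral => y _.
have E t : (EFin \o f) (t, y) =
    ((normal_peak s * \1_B y)%:E * (W t * normal_fun y s (H t))%:E)%E.
  rewrite /f/= -EFinM normal_pdfE ?gt_eqF//; congr EFin.
  rewrite (_ : normal_fun (H t) s y = normal_fun y s (H t)); first by ring.
  by rewrite /normal_fun; congr (expR (- _ / _)); ring.
under eq_integral do rewrite E.
rewrite integralZl//; last first.
  apply: (@bounded_measurable_integrable _ _ _ _ _ K).
    apply: measurable_funM => //; apply: (measurableT_comp (measurable_normal_fun _ _)).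
    exact: mH.
  move=> x; rewrite normrM (le_trans _ (WK x))// ler_piMr//.
  rewrite ger0_norm ?normal_fun_ge0// /normal_fun -[leRHS]expR0 ler_expR.
  by rewrite mulNr oppr_le0 divr_ge0 ?sqr_ge0// mulrn_wge0// sqr_ge0.
by rewrite integral_normal_fun_weight// -EFinM; congr EFin; ring.
Qed.

End weight.

Section uniqueness.
Context d (T : measurableType d) (P : probability T R).
Variables (H W : T -> R) (w K : R).
Hypotheses (mH : measurable_fun setT H) (mW : measurable_fun setT W).
Hypothesis WK : forall t, `|W t| <= K.
Hypothesis char : forall t c : R,
  \int[P]_x (W x * cos (t * H x + c)) = w * (cos c * expR (- (t ^+ 2 / 2))).

Let smooth (s : R) (B : set R) : 0 < s -> measurable B ->
  (\int[P]_t ((W t)%:E * normal_prob (H t) s B) =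
   \int[N01]_x (w%:E * normal_prob x s B))%E.
Proof.
move=> s0 mB; rewrite (integral_normal_prob_weight mH mW WK char s0 mB).
(* The identity under [N01] with constant weight [w] satisfies the same [char] hypothesis, hence has
   the same smoothed integral. *)
rewrite (@integral_normal_prob_weight _ _ N01 id (cst w) w `|w|)// => t c.
rewrite RintegralZl//; last first.
  apply: (@bounded_measurable_integrable _ _ _ _ _ 1).
    by apply: measurable_cosD; exact: measurable_affine.
  by move=> x; exact: cos_max.
by rewrite Rintegral_std_normal_cos.
Qed.

Let mnprob (s : R) (B : set R) : 0 < s -> measurable B ->
  measurable_fun setT (fun x : R => normal_prob x s B).
Proof.
move=> s0 mB.
pose f (z : R * R) : \bar R := (normal_pdf z.1 s z.2 * \1_B z.2)%:E.
rewrite (_ : (fun _ => _) = fubini_F leb f); last first.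
  apply/funext => x; rewrite /normal_prob /fubini_F [LHS]integral_mkcond.
  apply: (@eq_integral _ _ _ leb setT) => y _.
  by rewrite patchE /f indicE; case: ifP => _; rewrite ?mulr1 ?mulr0.
apply: measurable_fun_fubini_tonelli_F => [|z]; last first.
  by rewrite lee_fin mulr_ge0// normal_pdf_ge0.
apply/measurable_EFinP/measurable_funM; last first.
  by apply: measurableT_comp measurable_snd; exact: measurable_indic.
rewrite (_ : (fun _ => _) = fun z : R * R => normal_pdf 0 s (z.2 - z.1)).
  apply: (measurableT_comp (measurable_normal_pdf 0 s)).
  by apply: measurable_funB; [exact: measurable_snd|exact: measurable_fst].
by apply/funext => z; rewrite !normal_pdfE ?gt_eqF// /normal_fun subr0.
Qed.

Let step n : R := n.+1%:R^-1.

Let step_gt0 n : 0 < step n. Proof. by rewrite invr_gt0 ltr0n. Qed.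

(** A smoothed indicator of the ray above [c]; it tends to the indicator at every point except
    [c]. *)
Let p (c : R) n (x : R) : R := fine (normal_prob x (step n) `]c, +oo[%classic).

Let pE c n x : normal_prob x (step n) `]c, +oo[%classic = (p c n x)%:E.
Proof.
rewrite /p fineK// ge0_fin_numE.
  by apply: le_lt_trans (ltry 1); exact: (@probability_le1 _ _ _ (normal_prob x (step n))).
exact: (@measure_ge0 _ _ _ (normal_prob x (step n))).
Qed.

Let p01 c n x : 0 <= p c n x <= 1.
Proof.
rewrite -!lee_fin -pE; apply/andP; split.
  exact: (@measure_ge0 _ _ _ (normal_prob x (step n))).
exact: (@probability_le1 _ _ _ (normal_prob x (step n))).
Qed.

Let mp c n : measurable_fun setT (p c n).
Proof. by apply: measurableT_comp => //; exact: mnprob. Qed.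

Let p_cvg c x : x != c -> p c n x @[n --> \oo] --> (\1_(`]c, +oo[%classic) x : R).
Proof.
move=> xc; have e0 : 0 < `|x - c| by rewrite normr_gt0 subr_eq0.
have h n : `|p c n x - \1_(`]c, +oo[%classic) x| <= 8 / `|x - c| ^+ 2 * harmonic n.
  have [xlt|xgt|/eqP] := ltgtP x c; last by rewrite (negbTE xc).
  - rewrite indicE memNset/=; last by rewrite in_itv/= andbT; apply/negP; rewrite -leNgt ltW.
    rewrite subr0 ger0_norm; last by case/andP: (p01 c n x).
    rewrite -lee_fin -pE; apply: normal_prob_far => //.
    move=> y; rewrite /= in_itv/= andbT => cy.
    rewrite distrC gtr0_norm ?subr_gt0// gtr0_norm; lra.
  - rewrite indicE mem_set/=; last by rewrite in_itv/= xgt.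
    have E : normal_prob x (step n) `]-oo, c]%classic = (1 - p c n x)%:E.
      rewrite EFinB -pE -setCitvr.
      exact: (@probability_setC _ _ _ (normal_prob x (step n))).
    rewrite distrC ger0_norm; last by case/andP: (p01 c n x); rewrite subr_ge0.
    rewrite -lee_fin -E; apply: normal_prob_far => //.
    move=> y; rewrite /= in_itv/= => yc.
    rewrite [leRHS]distrC gtr0_norm ?subr_gt0// gtr0_norm; lra.
apply/cvgrPdist_le => e eps0.
have : (fun n => 8 / `|x - c| ^+ 2 * harmonic n) @ \oo --> (0 : R).
  rewrite -[X in _ --> X](mulr0 (8 / `|x - c| ^+ 2)).
  by apply: cvgM; [exact: cvg_cst|exact: cvg_harmonic].
move=> /cvgrPdist_le /(_ e eps0); apply: filterS => n /=.
rewrite sub0r normrN => hn; rewrite distrC; apply: le_trans (h n) _.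
by apply: le_trans hn; exact: ler_norm.
Qed.

Hypothesis HN : forall B, measurable B -> P (H @^-1` B) = N01 B.

(** Both sides agree after smoothing, and dominated convergence removes the width. The exceptional
    event [H = c] is null because [HN] gives [H] a law without atoms. *)
Lemma weighted_law_ray (c : R) :
  (\int[P]_t (W t * \1_(`]c, +oo[%classic) (H t))%:E = w%:E * N01 `]c, +oo[%classic)%E.
Proof.
have mI : measurable_fun setT (\1_(`]c, +oo[%classic) : R -> R).
  exact: measurable_indic.
have cvg1 : (\int[P]_t (W t * p c n (H t))%:E)%E @[n --> \oo] -->
    (\int[P]_t (W t * \1_(`]c, +oo[%classic) (H t))%:E)%E.
  have [] := @dominated_convergence _ _ _ P setT measurableT
    (fun n t => (W t * p c n (H t))%:E)
    (fun t => (W t * \1_(`]c, +oo[%classic) (H t))%:E) (cst K%:E).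
  - move=> n; apply/measurable_EFinP/measurable_funM => //.
    exact: measurableT_comp (mp c n) mH.
  - apply/measurable_EFinP/measurable_funM => //; exact: measurableT_comp mI mH.
  - exists (H @^-1` [set c]); split.
    + by rewrite -[X in measurable X]setTI; exact: mH.
    + apply: etrans (HN (measurable_set1 c)) _; have := @normal_prob_dominates R 0 1.
      move=> /null_content_dominatesP; apply => //.
      exact: lebesgue_measure_set1.
    + move=> t /=; apply: contra_notP => /eqP Hc _.
      apply/cvg_EFin; first exact: nearW.
      by apply: cvgM; [exact: cvg_cst|exact: p_cvg].
  - exact: finite_measure_integrable_cst.
  - apply: aeW => t n _; rewrite lee_fin normrM (le_trans _ (WK t))// ler_piMr//.
    by have /andP[? ?] := p01 c n (H t); rewrite ger0_norm.
  - by [].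
have cvg2 : (\int[N01]_x (w * p c n x)%:E)%E @[n --> \oo] -->
    (\int[N01]_x (w * \1_(`]c, +oo[%classic) x)%:E)%E.
  have [] := @dominated_convergence _ _ _ N01 setT measurableT
    (fun n x => (w * p c n x)%:E)
    (fun x => (w * \1_(`]c, +oo[%classic) x)%:E) (cst `|w|%:E).
  - by move=> n; apply/measurable_EFinP/measurable_funM => //; exact: mp.
  - by apply/measurable_EFinP/measurable_funM.
  - exists [set c]; split => //.
    + have := @normal_prob_dominates R 0 1.
      move=> /null_content_dominatesP; apply => //.
      exact: lebesgue_measure_set1.
    + move=> t /=; apply: contra_notP => /eqP Hc _.
      apply/cvg_EFin; first exact: nearW.
      by apply: cvgM; [exact: cvg_cst|exact: p_cvg].
  - exact: finite_measure_integrable_cst.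
  - apply: aeW => t n _; rewrite lee_fin normrM ler_piMr//.
    by have /andP[? ?] := p01 c n t; rewrite ger0_norm.
  - by [].
have E n : (\int[P]_t (W t * p c n (H t))%:E = \int[N01]_x (w * p c n x)%:E)%E.
  under eq_integral do rewrite EFinM -pE.
  under [RHS]eq_integral do rewrite EFinM -pE.
  exact: smooth.
rewrite -(cvg_lim _ cvg1)//; under eq_fun do rewrite E.
rewrite (cvg_lim _ cvg2)//; under eq_integral do rewrite EFinM.
rewrite integralZl//; last first.
  apply: (@bounded_measurable_integrable _ _ _ N01 _ 1) => // x.
  by rewrite indicE; case: (_ \in _); rewrite ?normr1 ?normr0.
by rewrite integral_indic// setIT.
Qed.

(** Hypothesis [char] says E[W exp(i t H)] = w exp(-t^2/2), with [w] the mean of [W] (take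
    [t = c = 0]). The conclusion is that [W] is uncorrelated with every event of [H]. The sets [B]
    for which it holds form a Dynkin class, and the open rays are a pi-system generating the Borel
    sets. *)
Lemma weighted_law (B : set R) : measurable B ->
  (\int[P]_(t in H @^-1` B) (W t)%:E = w%:E * N01 B)%E.
Proof.
have iW : P.-integrable setT (EFin \o W).
  exact: bounded_measurable_integrable mW WK.
have iWA A : measurable A -> P.-integrable A (EFin \o W).
  by move=> mA; exact: integrableS iW.
have mHB B' : measurable B' -> measurable (H @^-1` B').
  by move=> mB'; rewrite -[X in measurable X]setTI; exact: mH.
have N1 : N01 setT = 1%E by exact: (@probability_setT _ _ _ N01).
have wT : (\int[P]_t (W t)%:E = w%:E)%E.
  rewrite integral_EFin//; congr EFin.
  have := char 0 0; rewrite cos0 expr0n/= mul0r oppr0 expR0 !mulr1 => <-.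
  by apply: eq_Rintegral => t _; rewrite mul0r addr0 cos0 mulr1.
move=> mB.
have : (@RGenOInfty.G R).-sigma.-measurable B by rewrite -RGenOInfty.measurableE.
move: B mB => B0 _; move: B0.
apply: (@dynkin_induction _ R).
- exact: RGenOInfty.measurableE.
- move=> _ _ [x ->] [y ->]; exists (Num.max x y).
  apply/seteqP; split => z; rewrite /= !in_itv/= !andbT gt_max.
    by move=> [-> ->].
  by move=> /andP.
- by rewrite preimage_setT wT N1 mule1.
- move=> _ [c ->]; rewrite -weighted_law_ray.
  rewrite integral_mkcond; apply: eq_integral => t _.
  rewrite patchE indicE (_ : (t \in _) = (H t \in `]c, +oo[%classic)).
    by case: ifP => _; rewrite ?mulr1 ?mulr0.
  by apply/idP/idP; rewrite !inE.
- move=> S mS IH.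
  have mHS := mHB _ mS.
  have : (\int[P]_(t in H @^-1` S `|` H @^-1` (~` S)) (W t)%:E = w%:E)%E.
    by rewrite -preimage_setU setUv preimage_setT.
  rewrite integral_setU//; last 3 first.
  + exact/mHB/measurableC.
  + exact/measurable_EFinP/measurable_funTS.
  + by apply/disj_setPS => t [/= ? ?].
  have NS : N01 S \is a fin_num by exact: fin_num_measure.
  rewrite IH (_ : N01 (~` S) = 1 - N01 S)%E; last first.
    exact: (@probability_setC _ _ _ N01).
  rewrite -(fineK NS) -EFinM -EFinB -EFinM => e.
  rewrite -[LHS](addeK (x := (w * fine (N01 S))%:E))// [X in (X - _)%E]addeC e -EFinB.
  by congr EFin; ring.
- move=> F mF tF IH.
  rewrite preimage_bigcup integral_bigcup//; last 3 first.
  + by apply/trivIsetP => i j _ _ ij; rewrite -preimage_setI (trivIsetP.1 tF)// preimage_set0.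
  + by move=> k; exact: mHB.
  + by apply: iWA; apply: bigcup_measurable => k _; exact: mHB.
  have h := @measure_semi_sigma_additive _ _ _ N01 F mF tF (bigcup_measurable (fun k _ => mF k)).
  apply/cvg_lim => //.
  have -> : (fun n => \sum_(0 <= i < n) \int[P]_(x in H @^-1` F i) (W x)%:E)%E =
      (fun n => w%:E * \sum_(0 <= i < n) N01 (F i))%E.
    apply/funext => n; rewrite ge0_sume_distrr; last by move=> i _; exact: measure_ge0.
    by apply: eq_bigr => i _; exact: IH.
  by apply: cvgeZl.
Qed.

End uniqueness.
End smoothing.

(** * Standard Gaussian families and independence *)

(** The Cramer-Wold form restricted to unit vectors: no degenerate law and no variance parameter
    occurs, and other combinations follow by scaling. *)
Definition std_gauss d (T : measurableType d) (R : realType) (P : probability T R)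
    (I : finType) (G : I -> T -> R) : Prop :=
  forall c : I -> R, \sum_i c i ^+ 2 = 1 ->
    measurable_fun setT (fun t => \sum_i c i * G i t) /\
    forall B, measurable B ->
      P ((fun t => \sum_i c i * G i t) @^-1` B) = normal_prob 0 1 B.

Section std_gauss.
Context d (T : measurableType d) (R : realType) (P : probability T R).
Local Notation N01 := (normal_prob (0 : R) 1).

Lemma ge0_integral_law (H : T -> R) (f : R -> \bar R) :
  measurable_fun setT H -> (forall B, measurable B -> P (H @^-1` B) = N01 B) ->
  measurable_fun setT f -> (forall x, (0 <= f x)%E) ->
  (\int[P]_t f (H t) = \int[N01]_x f x)%E.
Proof.
move=> mH HN mf f0.
pose H' : {mfun T >-> R} := HB.pack H (isMeasurableFun.Build _ _ _ _ H mH).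
have mid : @measurable_fun _ _ (g_sigma_algebraType R.-ocitv.-measurable) R setT id.
  by move=> _ A mA; rewrite setTI preimage_id.
(* Pushing [N01] forward along the identity places it on the same measurable structure as the law of
   [H], so that the two measures can be compared. *)
pose idR : {mfun g_sigma_algebraType R.-ocitv.-measurable >-> R} :=
  HB.pack (id : g_sigma_algebraType R.-ocitv.-measurable -> R)
    (isMeasurableFun.Build _ _ _ _ _ mid).
transitivity (\int[pushforward P H']_x f x)%E; first by rewrite ge0_integral_pushforward.
transitivity (\int[pushforward N01 idR]_x f x)%E; last by rewrite ge0_integral_pushforward.
by apply: eq_measure_integral => A mA _; exact: HN.
Qed.

Lemma integral_law (H : T -> R) (f : R -> R) :
  measurable_fun setT H -> (forall B, measurable B -> P (H @^-1` B) = N01 B) ->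
  measurable_fun setT f -> \int[P]_t f (H t) = \int[N01]_x f x.
Proof.
move=> mH HN mf; congr fine.
have mfE : measurable_fun setT (EFin \o f) by exact/measurable_EFinP.
rewrite integralE [RHS]integralE; congr (_ - _)%E.
- transitivity (\int[P]_t ((EFin \o f)^\+ (H t)))%E.
    by apply: eq_integral => t _; rewrite !funeposE.
  apply: (ge0_integral_law mH HN) => [|x]; last exact: funepos_ge0.
  exact: measurable_funepos.
- transitivity (\int[P]_t ((EFin \o f)^\- (H t)))%E.
    by apply: eq_integral => t _; rewrite !funenegE.
  apply: (ge0_integral_law mH HN) => [|x]; last exact: funeneg_ge0.
  exact: measurable_funeneg.
Qed.

Section family.
Variables (I : finType) (G : I -> T -> R).
Hypothesis stdG : std_gauss P G.

(** A unit vector pulled back along orthonormal rows is again a unit vector. Since [J] may be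
    smaller than [I], this covers marginals as well as rotations. *)
Lemma std_gauss_rot (J : finType) (a : J -> I -> R) :
  (forall j k, \sum_i a j i * a k i = (j == k)%:R) ->
  std_gauss P (fun j t => \sum_i a j i * G i t).
Proof.
move=> aa c c1; have /stdG : \sum_i (\sum_j c j * a j i) ^+ 2 = 1.
  rewrite -[RHS]c1.
  under eq_bigr do rewrite expr2 big_distrlr/=.
  rewrite exchange_big/=; apply: eq_bigr => j _.
  rewrite exchange_big/= (bigD1 j)//= [X in _ + X]big1 ?addr0.
    under eq_bigr do rewrite mulrACA.
    by rewrite -mulr_sumr aa eqxx mulr1.
  move=> k kj; under eq_bigr do rewrite mulrACA.
  by rewrite -mulr_sumr aa eq_sym (negbTE kj) mulr0.
have -> // : (fun t => \sum_i (\sum_j c j * a j i) * G i t) =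
  (fun t => \sum_j c j * (\sum_i a j i * G i t)).
apply/funext => t; under eq_bigr do rewrite mulr_suml.
rewrite exchange_big/=; apply: eq_bigr => j _.
by rewrite mulr_sumr; apply: eq_bigr => i _; rewrite mulrA.
Qed.

Let delta_sqr (i : I) : \sum_j ((j == i)%:R : R) ^+ 2 = 1.
Proof.
rewrite (bigD1 i)//= eqxx expr1n big1 ?addr0// => j /negbTE ->.
by rewrite expr0n.
Qed.

Let delta_sum (i : I) t : \sum_j (j == i)%:R * G j t = G i t.
Proof.
rewrite (bigD1 i)//= eqxx mul1r big1 ?addr0// => j /negbTE ->.
by rewrite mul0r.
Qed.

Lemma measurable_std_gauss i : measurable_fun setT (G i).
Proof.
by have [+ _] := stdG (delta_sqr i); congr measurable_fun; apply/funext => t.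
Qed.

Lemma law_std_gauss i B : measurable B -> P (G i @^-1` B) = N01 B.
Proof.
have [_ h] := stdG (delta_sqr i); move=> /h <-; congr (P _).
by apply/seteqP; split => t /=; rewrite delta_sum.
Qed.

Lemma measurable_lin_std_gauss (c : I -> R) :
  measurable_fun setT (fun t => \sum_i c i * G i t).
Proof.
apply: measurable_sum => i; apply: measurable_funM => //.
exact: measurable_std_gauss.
Qed.

Lemma Rintegral_cos_std_gauss (c : I -> R) (c0 : R) :
  \int[P]_t cos (\sum_i c i * G i t + c0) =
  cos c0 * expR (- ((\sum_i c i ^+ 2) / 2)).
Proof.
have v0 : 0 <= \sum_i c i ^+ 2 by apply: sumr_ge0 => i _; exact: sqr_ge0.
have [v00|vn0] := eqVneq (\sum_i c i ^+ 2) 0.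
  have c00 i : c i = 0.
    have /eqP : c i ^+ 2 = 0.
      by apply/eqP; move/eqP: v00; rewrite psumr_eq0 => [/allP/(_ i)|j _];
        [rewrite mem_index_enum; apply|exact: sqr_ge0].
    by rewrite sqrf_eq0 => /eqP.
  rewrite v00 mul0r oppr0 expR0 mulr1.
  under eq_Rintegral => t _.
    rewrite big1 ?add0r; last by move=> i _; rewrite c00 mul0r.
    over.
  by rewrite Rintegral_cst// -[RHS]mulr1; congr (_ * _);
    exact: (congr1 fine (probability_setT P)).
set v := \sum_i c i ^+ 2 in v0 vn0 *.
have vgt0 : 0 < v by rewrite lt_neqAle eq_sym vn0.
set s := Num.sqrt v; have s0 : 0 < s by rewrite sqrtr_gt0.
have /stdG[mH HN] : \sum_i (c i / s) ^+ 2 = 1.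
  under eq_bigr do rewrite exprMn exprVn sqr_sqrtr//.
  by rewrite -mulr_suml mulfV.
transitivity (\int[P]_t cos (s * (\sum_i c i / s * G i t) + c0)).
  apply: eq_Rintegral => t _; congr (cos (_ + _)).
  by rewrite mulr_sumr; apply: eq_bigr => i _; field; rewrite gt_eqF.
rewrite (integral_law mH HN (f := fun x => cos (s * x + c0))).
- by rewrite Rintegral_std_normal_cos sqr_sqrtr.
- by apply: measurable_cosD; exact: measurable_affine.
Qed.

Definition box (B : I -> set R) : set T := [set t | forall i, B i (G i t)].

Lemma boxE B : box B = \bigcap_(i in [set: I]) (G i @^-1` B i).
Proof. by apply/seteqP; split => t /= h i; [move=> _; exact: h|exact: h]. Qed.

Lemma measurable_box B : (forall i, measurable (B i)) -> measurable (box B).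
Proof.
move=> mB; rewrite boxE; apply: fin_bigcap_measurable => // i _.
by rewrite -[X in measurable X]setTI; exact: measurable_std_gauss.
Qed.

Let W (B : I -> set R) (s : seq I) (t : T) : R := \prod_(i <- s) \1_(B i) (G i t).

Let W01 B s t : 0 <= W B s t <= 1.
Proof.
rewrite /W; elim: s => [|i s /andP[h0 h1]]; first by rewrite big_nil ler01 lexx.
rewrite big_cons indicE; case: (_ \in _); rewrite ?mul1r ?mul0r ?h0 ?h1//.
by rewrite lexx ler01.
Qed.

Let mW B s : (forall i, measurable (B i)) -> measurable_fun setT (W B s).
Proof.
move=> mB; apply: measurable_prod => i _.
by apply: (measurableT_comp (measurable_indic (mB i))); exact: measurable_std_gauss.
Qed.

(* Indicators are introduced one at a time: the product-to-sum formula absorbs an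
   extra factor [cos (t * G i0 + c1)] into the induction hypothesis, and
   [weighted_law] recovers the indicator from these cosine integrals. *)
Lemma Rintegral_box_cos (B : I -> set R) (s : seq I) (c : I -> R) (c0 : R) :
  (forall i, measurable (B i)) -> uniq s -> (forall i, i \in s -> c i = 0) ->
  \int[P]_t (W B s t * cos (\sum_i c i * G i t + c0)) =
  (\prod_(i <- s) fine (N01 (B i))) * (cos c0 * expR (- ((\sum_i c i ^+ 2) / 2))).
Proof.
move=> mB; elim: s c c0 => [|i0 s IH] c c0 => [_ _|/= /andP[i0s us] c00].
  rewrite big_nil mul1r -Rintegral_cos_std_gauss; apply: eq_Rintegral => t _.
  by rewrite /W big_nil mul1r.
rewrite big_cons.
pose W' t := W B s t * cos (\sum_i c i * G i t + c0).
pose w := (\prod_(i <- s) fine (N01 (B i))) * (cos c0 * expR (- ((\sum_i c i ^+ 2) / 2))).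
have W'1 t : `|W' t| <= 1.
  rewrite normrM mulr_ile1 ?cos_max//.
  by have /andP[? ?] := W01 B s t; rewrite ger0_norm.
have mW' : measurable_fun setT W'.
  apply: measurable_funM; first exact: mW.
  apply: measurable_cosD; apply: measurable_funD => //.
  exact: measurable_lin_std_gauss.
have mG := measurable_std_gauss i0.
have char t c1 : \int[P]_x (W' x * cos (t * G i0 x + c1)) =
    w * (cos c1 * expR (- (t ^+ 2 / 2))).
  have ci0 : c i0 = 0 by apply: c00; rewrite inE eqxx.
  have cs r i : i \in s -> c i + r * (i == i0)%:R = 0.
    move=> si; rewrite c00 ?inE ?si ?orbT// add0r.
    by rewrite (_ : (i == i0) = false) ?mulr0//; apply: contraNF i0s => /eqP <-.
  have sumE r x : \sum_i (c i + r * (i == i0)%:R) * G i x = \sum_i c i * G i x + r * G i0 x.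
    under eq_bigr do rewrite mulrDl.
    by rewrite big_split/=; congr (_ + _); under eq_bigr do rewrite -mulrA;
       rewrite -mulr_sumr delta_sum.
  have sqrE r : \sum_i (c i + r * (i == i0)%:R) ^+ 2 = \sum_i c i ^+ 2 + r ^+ 2.
    rewrite (bigD1 i0)//= [in RHS](bigD1 i0)//= eqxx ci0 expr0n/= !add0r mulr1 addrC.
    congr (_ + _); apply: eq_bigr => i /negbTE ->; by rewrite mulr0 addr0.
  have ib r c2 : P.-integrable setT
      (EFin \o (fun x => W B s x * cos (\sum_i (c i + r * (i == i0)%:R) * G i x + c2))).
    apply: (@bounded_measurable_integrable _ _ _ _ _ 1).
      apply: measurable_funM; first exact: mW.
      apply: measurable_cosD; apply: measurable_funD => //.
      exact: measurable_lin_std_gauss.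
    move=> x; rewrite normrM mulr_ile1 ?cos_max//.
    by have /andP[? ?] := W01 B s x; rewrite ger0_norm.
  transitivity (\int[P]_x (2^-1 *
      (W B s x * cos (\sum_i (c i + t * (i == i0)%:R) * G i x + (c0 + c1)) +
       W B s x * cos (\sum_i (c i + - t * (i == i0)%:R) * G i x + (c0 - c1))))).
    apply: eq_Rintegral => x _; rewrite /W' !sumE.
    set A := _ + c0; set D := _ + c1.
    rewrite (_ : _ + (c0 + c1) = A + D); last by rewrite /A /D; ring.
    rewrite (_ : _ + (c0 - c1) = A - D); last by rewrite /A /D; ring.
    by rewrite cosD cosB; field.
  rewrite RintegralZl//; last exact: (integrableD measurableT (ib t _) (ib (- t) _)).
  rewrite (RintegralD measurableT (ib t _) (ib (- t) _)).
  rewrite !IH; [|by []|exact: cs|by []|exact: cs].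
  rewrite !sqrE sqrrN cosD cosB /w.
  set S := \sum_i c i ^+ 2; set Q := \prod_(i <- s) _.
  rewrite (_ : - ((S + t ^+ 2) / 2) = - (S / 2) + - (t ^+ 2 / 2)); last by field.
  by rewrite expRD; field.
have := weighted_law mG mW' W'1 char (law_std_gauss i0) (mB i0).
rewrite integral_mkcond => E.
have fN := @fin_num_measure _ _ _ N01 (B i0) (mB i0).
rewrite -mulrA -/w mulrC -[RHS]/(fine (w * fine (N01 (B i0)))%:E) EFinM fineK// -E.
congr fine; apply: eq_integral => t _; rewrite patchE /W' /W big_cons indicE.
rewrite (_ : (t \in _) = (G i0 t \in B i0)); last by apply/idP/idP; rewrite !inE.
by case: ifP => _; rewrite ?mul1r ?mul0r.
Qed.

Lemma prob_box (B : I -> set R) : (forall i, measurable (B i)) ->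
  P (box B) = (\prod_i fine (N01 (B i)))%:E.
Proof.
move=> mB; have := @Rintegral_box_cos B (index_enum I) (fun=> 0) 0 mB
  (index_enum_uniq I) (fun _ _ => erefl).
rewrite [X in expR (- (X / 2))]big1 => [|i _]; last by rewrite expr0n.
rewrite mul0r oppr0 expR0 cos0 !mulr1 => <-.
transitivity (\int[P]_t (\1_(box B) t)%:E)%E.
  by rewrite integral_indic ?setIT//; exact: measurable_box.
rewrite integral_EFin; last first.
  apply: (@bounded_measurable_integrable _ _ _ _ _ 1).
    by apply: measurable_indic; exact: measurable_box.
  by move=> t; rewrite indicE; case: (_ \in _); rewrite ?normr1 ?normr0.
congr EFin; apply: eq_Rintegral => t _.
rewrite big1 ?addr0 ?cos0 ?mulr1; last by move=> i _; rewrite mul0r.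
rewrite /W indicE; have [|] := boolP (t \in box B).
  by rewrite inE => h; rewrite big1// => i _; rewrite indicE mem_set//; exact: h.
rewrite notin_setE => /existsNP[i Bi]; rewrite (bigD1 i)//= indicE memNset//.
by rewrite mul0r.
Qed.

(** A pi-system generating the sigma-algebra of the coordinates in [A]. Boxes are full outside [A],
    so that two boxes over disjoint index sets intersect in a box whose probability factors. *)
Definition cylinder (A : pred I) : set (set T) := [set D | exists2 B : I -> set R,
  (forall i, measurable (B i)) & (forall i, ~~ A i -> B i = setT) /\ D = box B].

Lemma setI_closed_cylinder A : setI_closed (cylinder A).
Proof.
move=> _ _ [B mB [BA ->]] [C mC [CA ->]]; exists (fun i => B i `&` C i).
  by move=> i; exact: measurableI.
split; first by move=> i Ai; rewrite BA// CA// setIT.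
by apply/seteqP; split => t /= => [[h1 h2] i|h]; [split|split => i; have [] := h i].
Qed.

Lemma cylinder_setT A : cylinder A setT.
Proof.
exists (fun=> setT); first by move=> i.
by split => //; apply/seteqP; split.
Qed.

Lemma cylinder_measurable A : cylinder A `<=` measurable.
Proof. by move=> _ [B mB [_ ->]]; exact: measurable_box. Qed.

Lemma gen_cylinder_measurable A : <<s cylinder A >> `<=` measurable.
Proof.
apply: smallest_sub; last exact: cylinder_measurable.
by split; [exact: measurable0|move=> ? ?; rewrite setTD; exact: measurableC|
   exact: bigcupT_measurable].
Qed.

Lemma cylinder_indep (A A' : pred I) D D' : (forall i, A i -> ~~ A' i) ->
  cylinder A D -> cylinder A' D' -> P (D `&` D') = (P D * P D')%E.
Proof.
move=> AA' [B mB [BA ->]] [C mC [CA ->]].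
have -> : box B `&` box C = box (fun i => B i `&` C i).
  by apply/seteqP; split => t /= => [[h1 h2] i|h]; [split|split => i; have [] := h i].
rewrite !prob_box//; last by move=> i; exact: measurableI.
have N1 : fine (N01 setT) = 1.
  by rewrite -[RHS]/(fine 1%:E); congr fine; exact: (@probability_setT _ _ _ N01).
rewrite -EFinM -big_split/=; congr EFin; apply: eq_bigr => i _.
have [Ai|Ai] := boolP (A i).
  by rewrite (CA _ (AA' _ Ai)) setIT N1 mulr1.
by rewrite (BA _ Ai) setTI N1 mul1r.
Qed.

(** For fixed [E'], the finite measures E |-> P(E & E') and E |-> P(E') P(E) agree on a generating
    pi-system, hence everywhere. This is applied once in each argument. *)
Lemma gen_cylinder_indep (A A' : pred I) D D' : (forall i, A i -> ~~ A' i) ->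
  <<s cylinder A >> D -> <<s cylinder A' >> D' -> P (D `&` D') = (P D * P D')%E.
Proof.
move=> AA' sD sD'; have mD := gen_cylinder_measurable sD.
have mD' := gen_cylinder_measurable sD'.
have step (B : pred I) (E E' : set T) : measurable E' ->
    (forall F, cylinder B F -> P (F `&` E') = (P F * P E')%E) ->
    <<s cylinder B >> E -> P (E `&` E') = (P E * P E')%E.
  move=> mE' h sE.
  have PE' : P E' \is a fin_num by exact: fin_num_measure.
  have PE0 : (0 <= fine (P E'))%R by rewrite fine_ge0.
  have := @g_sigma_algebra_measure_unique _ R T (cylinder B) (@cylinder_measurable B)
    (fun=> setT) (fun=> cylinder_setT B) _ (mrestr P mE')
    (mscale (NngNum PE0) P) (@setI_closed_cylinder B) _ _ _ sE.
  rewrite /= /mscale/= /mrestr/= fineK// muleC; apply.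
  - by apply/seteqP; split => // t _; exists 0%N.
  - by move=> F /h; rewrite muleC.
  - move=> _; rewrite setTI; apply: le_lt_trans (ltry 1); exact: probability_le1.
apply: (step A) => //  F cF.
rewrite setIC muleC; apply: (step A') => // [|F' cF'].
  exact: (cylinder_measurable cF).
by rewrite setIC muleC; exact: cylinder_indep cF cF'.
Qed.

End family.
End std_gauss.

Section independence.
Context d (T : measurableType d) (R : realType) (P : probability T R).
Local Notation N01 := (normal_prob (0 : R) 1).
Variables (I : finType) (G : I -> T -> R).
Hypothesis stdG : std_gauss P G.

Local Notation gen A := (g_sigma_algebraType (cylinder G A)).

Lemma measurable_cylinder (A : pred I) i : A i ->
  measurable_fun (setT : set (gen A)) (G i : gen A -> R).
Proof.
move=> Ai _ B mB; rewrite setTI; apply: sub_sigma_algebra.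
exists (fun j => if j == i then B else setT); first by move=> j; case: ifP.
split; first by move=> j Aj; case: eqP => // ji; rewrite ji Ai in Aj.
apply/seteqP; split => t /=; first by move=> Bt j; case: eqP => // ->.
by move=> /(_ i); rewrite eqxx.
Qed.

Lemma measurable_gen_id (A : pred I) : measurable_fun setT (id : T -> gen A).
Proof.
by move=> _ D mD; rewrite setTI preimage_id; exact: (gen_cylinder_measurable stdG mD).
Qed.

Section pair.
Variables (A A' : pred I).
Hypothesis AA' : forall i, A i -> ~~ A' i.

Let idA : {mfun T >-> gen A} :=
  HB.pack (id : T -> gen A) (isMeasurableFun.Build _ _ _ _ _ (@measurable_gen_id A)).
Let idA' : {mfun T >-> gen A'} :=
  HB.pack (id : T -> gen A') (isMeasurableFun.Build _ _ _ _ _ (@measurable_gen_id A')).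
Let dia : T -> gen A * gen A' := fun t => (t, t).

Let mdia : measurable_fun setT dia.
Proof. by apply: measurable_fun_pair; exact: measurable_gen_id. Qed.

Let diag : {mfun T >-> (gen A * gen A')%type} :=
  HB.pack dia (isMeasurableFun.Build _ _ _ _ _ mdia).

Let PA := distribution P idA.
Let PA' := distribution P idA'.

(** Independence in the form used below: the sample space is taken twice, with the sigma-algebras of
    the two coordinate groups, and the image of [P] on the diagonal is the product measure. *)
Let diagE (X : set (gen A * gen A')) : measurable X ->
  (PA \x PA')%E X = P [set t | X (t, t)].
Proof.
move=> mX; apply: (@product_measure_unique _ _ _ _ _ PA PA' (pushforward P diag)) => //.
move=> B C mB mC; rewrite /PA /PA' /= /pushforward.
exact: (gen_cylinder_indep stdG AA' mB mC).
Qed.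

(** Conditioning without conditional laws: by Fubini, a bound valid for each frozen value of the
    coordinates in [A] also holds when they are random. *)
Lemma prob_diag_le (X : set (gen A * gen A')) (e : R) : measurable X ->
  (forall x : T, (P [set t | X (x, t)] <= e%:E)%E) ->
  (P [set t | X (t, t)] <= e%:E)%E.
Proof.
move=> mX Xe; rewrite -diagE// /product_measure1.
apply: (@le_trans _ _ (\int[PA]_x e%:E)%E).
  apply: ge0_le_integral => //.
  - exact: measurable_fun_xsection.
  - move=> x _; rewrite (_ : (_ \o _) x = P [set t | X (x, t)])//.
    by rewrite /= /PA' /= /pushforward; congr (P _); apply/seteqP; split => t;
      rewrite /xsection /= inE.
rewrite integral_cst// -[leRHS]mule1 le_eqVlt; apply/orP; left; apply/eqP.
by congr (_ * _)%E; exact: (probability_setT PA).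
Qed.

Lemma ge0_integral_mul_indep (f : gen A -> \bar R) (g : gen A' -> \bar R) :
  measurable_fun setT f -> measurable_fun setT g ->
  (forall t, 0 <= f t)%E -> (forall t, 0 <= g t)%E ->
  (\int[P]_t (f t * g t) = \int[P]_t f t * \int[P]_t g t)%E.
Proof.
move=> mf mg f0 g0.
pose h (z : gen A * gen A') : \bar R := (f z.1 * g z.2)%E.
have h0 z : (0 <= h z)%E by exact: mule_ge0.
have mh : measurable_fun setT h.
  by apply: emeasurable_funM; [exact: measurableT_comp mf measurable_fst|
                               exact: measurableT_comp mg measurable_snd].
transitivity (\int[pushforward P diag]_z h z)%E.
  by rewrite ge0_integral_pushforward.
transitivity (\int[PA \x PA']_z h z)%E.
  by apply: eq_measure_integral => X mX _; rewrite [RHS]diagE.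
rewrite fubini_tonelli1// /fubini_F /h/=.
under eq_integral => x _.
  rewrite ge0_integralZl//.
  over.
rewrite /= ge0_integralZr//; last exact: integral_ge0.
by congr (_ * _)%E; rewrite ge0_integral_pushforward.
Qed.

End pair.

Lemma integral_prod_std_gauss (f : I -> R -> R) (s : seq I) : uniq s ->
  (forall i, measurable_fun setT (f i)) -> (forall i x, 0 <= f i x) ->
  (\int[P]_t (\prod_(i <- s) f i (G i t))%:E =
   \prod_(i <- s) \int[N01]_x (f i x)%:E)%E.
Proof.
move=> us mf f0; elim: s us => [_|i0 s IH /= /andP[i0s us]].
  under eq_integral do rewrite big_nil.
  by rewrite big_nil integral_cst//= probability_setT mule1.
rewrite big_cons -IH// -(ge0_integral_law (measurable_std_gauss stdG i0) (law_std_gauss stdG i0)); last 2 first.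
- exact/measurable_EFinP.
- by move=> x; rewrite lee_fin.
rewrite -(@ge0_integral_mul_indep (pred1 i0) [pred i | i \in s]).
- by apply: eq_integral => t _; rewrite big_cons EFinM.
- by move=> i /eqP ->.
- apply/measurable_EFinP; apply: (measurableT_comp (mf i0)).
  by apply: measurable_cylinder; rewrite /= eqxx.
- apply/measurable_EFinP.
  apply: measurable_prod => i si.
  by apply: (measurableT_comp (mf i)); exact: measurable_cylinder.
- by move=> t; rewrite lee_fin.
- by move=> t; rewrite lee_fin prodr_ge0.
Qed.

End independence.

(** * Chi-square tails *)

Lemma measurable_lt d (T : measurableType d) (R : realType) (f g : T -> R) :
  measurable_fun setT f -> measurable_fun setT g -> measurable [set t | f t < g t].
Proof.
move=> mf mg; rewrite (_ : [set t | _] = (g \- f) @^-1` `]0, +oo[%classic).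
  by rewrite -[X in measurable X]setTI; exact: measurable_funB.
by apply/seteqP; split => t /=; rewrite in_itv/= andbT subr_gt0.
Qed.

Lemma prob_subset_le d (T : measurableType d) (R : realType) (P : probability T R)
    (A B : set T) (e : \bar R) :
  measurable A -> measurable B -> A `<=` B -> (P B <= e)%E -> (P A <= e)%E.
Proof. by move=> mA mB AB; apply: le_trans; apply: le_measure; rewrite ?inE. Qed.

Section tails.
Context d (T : measurableType d) (R : realType) (P : probability T R).

Lemma exp_markov (X : T -> R) (b L : R) : measurable_fun setT X ->
  (\int[P]_t (expR (X t))%:E <= (expR b)%:E)%E ->
  (P [set t | (b + L < X t)%R] <= (expR (- L))%:E)%E.
Proof.
move=> mX Xb.
have mA : measurable [set t | b + L < X t] by exact: measurable_lt.
rewrite -(@lee_pmul2l _ (expR (b + L))%:E) ?lte_fin ?expR_gt0//.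
rewrite -EFinM -expRD addrK; apply: le_trans Xb.
rewrite -[X in (_ * P X)%E]setIT -integral_indic// -ge0_integralZl//; last first.
  by apply/measurable_EFinP; exact: measurable_indic.
apply: ge0_le_integral => //.
- by apply/measurable_EFinP/measurable_funM => //; exact: measurable_indic.
- by apply/measurable_EFinP; exact: measurableT_comp.
- move=> t _; rewrite -EFinM lee_fin indicE; have [|] := boolP (t \in _).
    by rewrite inE/= mulr1 ler_expR => /ltW.
  by rewrite mulr0 expR_ge0.
Qed.

Variables (I : finType) (G : I -> T -> R).
Hypothesis stdG : std_gauss P G.

Lemma measurable_sqr_std_gauss (l : I -> R) :
  measurable_fun setT (fun t => \sum_i l i * (G i t ^+ 2 - 1)).
Proof.
apply: measurable_sum => i; apply: measurable_funM => //.
apply: measurable_funB => //; apply: measurable_funX.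
exact: (measurable_std_gauss stdG).
Qed.

Lemma mgf_sqr_std_gauss (l : I -> R) (s : R) : (forall i, s * l i <= 8^-1) ->
  (\int[P]_t (expR (s * \sum_i l i * (G i t ^+ 2 - 1)))%:E <=
   (expR (2 * s ^+ 2 * \sum_i l i ^+ 2))%:E)%E.
Proof.
move=> sl.
under eq_integral => t _.
  rewrite mulr_sumr; under eq_bigr do rewrite mulrA.
  rewrite expR_sum; over.
rewrite (integral_prod_std_gauss stdG (f := fun i x => expR (s * l i * (x ^+ 2 - 1)))); last 3 first.
- exact: index_enum_uniq.
- move=> i; apply: measurableT_comp => //; apply: measurable_funM => //.
  by apply: measurable_funB => //; exact: measurable_funX.
- by move=> i x; exact: expR_ge0.
rewrite mulr_sumr expR_sum.
suff : (0 <= \prod_(i : I) \int[normal_prob (0 : R) 1]_x (expR (s * l i * (x ^+ 2 - 1)))%:E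
    <= (\prod_(i : I) expR (2 * s ^+ 2 * l i ^+ 2))%:E)%E by case/andP.
elim/big_rec2 : _ => [|i y x _ /andP[x0 xy]]; first by rewrite lee_fin ler01 lexx.
have i0 : (0 <= \int[normal_prob (0 : R) 1]_x (expR (s * l i * (x ^+ 2 - 1)))%:E)%E.
  by apply: integral_ge0 => z _; rewrite lee_fin expR_ge0.
rewrite mule_ge0//= EFinM lee_pmul//.
apply: le_trans (integral_std_normal_expR_sqrB1 (sl i)) _.
by rewrite lee_fin ler_expR exprMn mulrA.
Qed.

Let msX (s : R) (l : I -> R) :
  measurable_fun setT (fun t => s * \sum_i l i * (G i t ^+ 2 - 1)).
Proof. by apply: measurable_funM => //; exact: measurable_sqr_std_gauss. Qed.

Section bounded_weights.
Variables (l : I -> R) (m v L : R).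
Hypotheses (l0 : forall i, 0 <= l i) (lm : forall i, l i <= m) (m0 : 0 < m)
  (sl : \sum_i l i <= v) (v0 : 0 < v) (L0 : 0 < L).

Let sqr_le : \sum_i l i ^+ 2 <= m * v.
Proof.
apply: (@le_trans _ _ (m * \sum_i l i)); last by rewrite ler_pM2l.
by rewrite mulr_sumr; apply: ler_sum => i _; rewrite expr2 ler_wpM2r.
Qed.

Let r := Num.sqrt (L * m * v).
Let r0 : 0 < r. Proof. by rewrite sqrtr_gt0 !mulr_gt0. Qed.
Let r2 : r ^+ 2 = L * m * v. Proof. by rewrite sqr_sqrtr// !mulr_ge0// ltW. Qed.
(* The optimal Chernoff parameter: [2 s^2 m v = L / 2] and [3 s r = 3 L / 2]. *)
Let s := L / (2 * r).
Let s0 : 0 < s. Proof. by rewrite divr_gt0// mulr_gt0. Qed.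
Let sr : s * r = L / 2. Proof. by rewrite /s; field; rewrite gt_eqF. Qed.
Let smv : 2 * s ^+ 2 * (m * v) = L / 2.
Proof.
have -> : m * v = r ^+ 2 / L by rewrite r2; field; rewrite gt_eqF.
by rewrite /s; field; rewrite !gt_eqF.
Qed.

Lemma sqr_std_gauss_lower :
  (P [set t | (\sum_i l i * (G i t ^+ 2 - 1) < - (3 * r))%R] <= (expR (- L))%:E)%E.
Proof.
have h : (\int[P]_t (expR (- s * \sum_i l i * (G i t ^+ 2 - 1)))%:E
    <= (expR (L / 2))%:E)%E.
  apply: le_trans (mgf_sqr_std_gauss _) _.
    by move=> i; rewrite mulNr (@le_trans _ _ 0)// oppr_le0 mulr_ge0// ltW.
  rewrite lee_fin ler_expR sqrrN -smv ler_pM2l// mulr_gt0// exprn_gt0//.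
apply: (prob_subset_le _ _ _ (exp_markov L (msX (- s) l) h)).
- by apply: measurable_lt => //; exact: measurable_sqr_std_gauss.
- by apply: measurable_lt => //; exact: msX.
- move=> t /=; set X := \sum_i _ => ht; have := sr.
  have : 0 < s * (- (3 * r) - X) by rewrite mulr_gt0// subr_gt0.
  nra.
Qed.

(** The hypothesis is equivalent to [s * m <= 8^-1], the range in which the exponential moment bound
    is available. The lower tail uses [- s] and has no such constraint. *)
Lemma sqr_std_gauss_upper : 16 * (L * m) <= v ->
  (P [set t | (3 * r < \sum_i l i * (G i t ^+ 2 - 1))%R] <= (expR (- L))%:E)%E.
Proof.
move=> Lm.
have s8 : s * m <= 8^-1.
  rewrite /s mulrAC ler_pdivrMr ?mulr_gt0//.
  suff : 4 * (L * m) <= r by lra.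
  have Lm0 : 0 < L * m by rewrite mulr_gt0.
  have r0' := ltW r0.
  have Lm4 : 0 <= 4 * (L * m) by rewrite mulr_ge0// ltW.
  rewrite -ler_sqr// r2; nra.
have h : (\int[P]_t (expR (s * \sum_i l i * (G i t ^+ 2 - 1)))%:E
    <= (expR (L / 2))%:E)%E.
  apply: le_trans (mgf_sqr_std_gauss _) _.
    by move=> i; apply: le_trans s8; rewrite ler_pM2l.
  rewrite lee_fin ler_expR -smv ler_pM2l// mulr_gt0// exprn_gt0//.
apply: (prob_subset_le _ _ _ (exp_markov L (msX s l) h)).
- by apply: measurable_lt => //; exact: measurable_sqr_std_gauss.
- by apply: measurable_lt => //; exact: msX.
- move=> t /=; set X := \sum_i _ => ht; have := sr.
  have : 0 < s * (X - 3 * r) by rewrite mulr_gt0// subr_gt0.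
  nra.
Qed.

End bounded_weights.

(** A bound for arbitrary [L], with no comparison of the largest weight to the total; it serves for
    the squared weights in [quad2]. With [s = 1 / (8 v)] the threshold contributes 1/4 + L, of which
    the centering and the exponential moment take at most 1/8 each. *)
Lemma sqr_std_gauss_large (l : I -> R) (v L : R) : (forall i, 0 <= l i) ->
  \sum_i l i <= v -> 0 < v ->
  (P [set t | (v * (2 + 8 * L) < \sum_i l i * G i t ^+ 2)%R] <= (expR (- L))%:E)%E.
Proof.
move=> l0 lv v0; pose s := (8 * v)^-1.
have s0 : 0 < s by rewrite invr_gt0 mulr_gt0.
have sv : s * v = 8^-1 by rewrite /s; field; rewrite gt_eqF.
have li i : l i <= v.
  by apply: le_trans lv; rewrite (bigD1 i)//= lerDl sumr_ge0.
have sq : \sum_i l i ^+ 2 <= v ^+ 2.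
  apply: (@le_trans _ _ (v * \sum_i l i)); last by rewrite expr2 ler_pM2l.
  by rewrite mulr_sumr; apply: ler_sum => i _; rewrite expr2 ler_wpM2r.
have h : (\int[P]_t (expR (s * \sum_i l i * (G i t ^+ 2 - 1)))%:E
    <= (expR 8^-1)%:E)%E.
  apply: le_trans (mgf_sqr_std_gauss _) _.
    by move=> i; rewrite -sv ler_pM2l.
  rewrite lee_fin ler_expR.
  apply: (@le_trans _ _ (2 * s ^+ 2 * v ^+ 2)).
    by rewrite ler_wpM2l// mulr_ge0// sqr_ge0.
  rewrite -mulrA -exprMn sv; lra.
apply: (prob_subset_le _ _ _ (exp_markov L (msX s l) h)).
- apply: measurable_lt => //; apply: measurable_sum => i; apply: measurable_funM => //.
  by apply: measurable_funX; exact: (measurable_std_gauss stdG).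
- by apply: measurable_lt => //; exact: msX.
- move=> t /=; rewrite (_ : \sum_i l i * (G i t ^+ 2 - 1) =
      \sum_i l i * G i t ^+ 2 - \sum_i l i); last first.
    by rewrite -sumrB; apply: eq_bigr => i _; rewrite mulrBr mulr1.
  set X := \sum_i l i * _; set Y := \sum_i l i in lv *; move=> ht.
  have h1 : s * (v * (2 + 8 * L)) < s * X by rewrite ltr_pM2l.
  have h2 : s * Y <= s * v by rewrite ler_pM2l.
  have h3 : s * (v * (2 + 8 * L)) = (s * v) * (2 + 8 * L) by rewrite mulrA.
  rewrite mulrBr; rewrite sv in h2 h3; lra.
Qed.

(** Here [k] is a lower bound for the effective rank (sum l)^2 / (sum l^2). With [s = k / (16 v)] a
    deviation of [v / 4] contributes k/64, and the exponential moment costs at most half of it. *)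
Lemma sqr_std_gauss_small (l : I -> R) (v k : R) : (forall i, 0 <= l i) ->
  \sum_i l i = v -> 0 < v -> 0 < k -> k * \sum_i l i ^+ 2 <= v ^+ 2 ->
  (P [set t | (\sum_i l i * G i t ^+ 2 < 3 / 4 * v)%R] <= (expR (- (k / 128)))%:E)%E.
Proof.
move=> l0 lv v0 k0 kv; pose s := k / (16 * v).
have s0 : 0 < s by rewrite divr_gt0// mulr_gt0.
have sv : s * v = k / 16 by rewrite /s; field; rewrite gt_eqF.
have h : (\int[P]_t (expR (- s * \sum_i l i * (G i t ^+ 2 - 1)))%:E
    <= (expR (k / 128))%:E)%E.
  apply: le_trans (mgf_sqr_std_gauss _) _.
    by move=> i; rewrite mulNr (@le_trans _ _ 0)// oppr_le0 mulr_ge0// ltW.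
  rewrite lee_fin ler_expR sqrrN.
  have -> : 2 * s ^+ 2 * \sum_i l i ^+ 2 = (k * \sum_i l i ^+ 2) * (k / (128 * v ^+ 2)).
    by rewrite /s; field; rewrite gt_eqF.
  apply: (@le_trans _ _ (v ^+ 2 * (k / (128 * v ^+ 2)))).
    by rewrite ler_wpM2r// divr_ge0 ?mulr_ge0 ?sqr_ge0// ltW.
  by rewrite le_eqVlt; apply/orP; left; apply/eqP; field; rewrite gt_eqF.
apply: (prob_subset_le _ _ _ (exp_markov (k / 128) (msX (- s) l) h)).
- apply: measurable_lt => //; apply: measurable_sum => i; apply: measurable_funM => //.
  by apply: measurable_funX; exact: (measurable_std_gauss stdG).
- by apply: measurable_lt => //; exact: msX.
- move=> t /=; rewrite (_ : \sum_i l i * (G i t ^+ 2 - 1) =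
      \sum_i l i * G i t ^+ 2 - v); last first.
    by rewrite -lv -sumrB; apply: eq_bigr => i _; rewrite mulrBr mulr1.
  set X := \sum_i l i * _; move=> ht.
  have h1 : s * X < s * (3 / 4 * v) by rewrite ltr_pM2l.
  have h3 : s * (3 / 4 * v) = (s * v) * (3 / 4) by ring.
  rewrite mulrBr !mulNr; rewrite sv in h3 *; lra.
Qed.

End tails.

(** * Orthogonal changes of coordinates *)

Lemma sum_delta (R : pzRingType) (I : finType) (i : I) (f : I -> R) :
  \sum_j (j == i)%:R * f j = f i.
Proof.
rewrite (bigD1 i)//= eqxx mul1r big1 ?addr0// => j /negbTE ->.
by rewrite mul0r.
Qed.

Lemma sum_pair (V : nmodType) (I J : finType) (F : I * J -> V) :
  \sum_p F p = \sum_i \sum_j F (i, j).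
Proof. by rewrite pair_bigA/=; apply: eq_bigr => -[]. Qed.

Section reflection.
Context {R : realType} (n : nat).

(* The Householder reflection exchanging [x] and the first basis vector. *)
Lemma exists_orthonormal_row0 (x : 'I_n.+1 -> R) : \sum_i x i ^+ 2 = 1 ->
  exists O : 'M[R]_n.+1, O *m O^T = 1%:M /\ forall j, O 0 j = x j.
Proof.
move=> x1; pose v i : R := (i == 0)%:R - x i; pose a := x 0.
have v2 : \sum_i v i ^+ 2 = 2 * (1 - a).
  transitivity (\sum_i ((i == 0)%:R * ((i == 0)%:R - 2 * x i) + x i ^+ 2)).
    by apply: eq_bigr => i _; rewrite /v; ring.
  by rewrite big_split/= x1 sum_delta eqxx/= /a; ring.
have [a1|a1] := eqVneq (1 - a) 0.
  exists 1%:M; split; first by rewrite mul1mx trmx1.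
  move=> j; rewrite mxE [0 == j]eq_sym; apply/eqP; rewrite -subr_eq0 -sqrf_eq0.
  move: v2; rewrite a1 mulr0 => /eqP; rewrite psumr_eq0 => [/allP/(_ j)|i _]; last exact: sqr_ge0.
  by rewrite mem_index_enum => /(_ isT).
(* This is [2 / \sum_i v i ^+ 2], the normalisation of the reflection along [v]. *)
pose c := (1 - a)^-1.
exists (\matrix_(i, j) ((i == j)%:R - c * v i * v j)); split; last first.
  move=> j; rewrite mxE /c /v eqxx/= [0 == j]eq_sym -/a; field.
  by [].
apply/matrixP => i k; rewrite !mxE.
transitivity (\sum_j ((j == i)%:R * ((j == k)%:R - c * v k * v j)
    - (j == k)%:R * (c * v i * v j) + c ^+ 2 * v i * v k * v j ^+ 2)).
  by apply: eq_bigr => j _; rewrite !mxE [i == j]eq_sym [k == j]eq_sym; ring.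
rewrite big_split/= sumrB !sum_delta -mulr_sumr v2 /c; field.
by [].
Qed.

End reflection.

Section sub_families.
Context d (T : measurableType d) (R : realType) (P : probability T R).
Variables (I : finType) (G : I -> T -> R).
Hypothesis stdG : std_gauss P G.

Lemma std_gauss_sub (J : finType) (f : J -> I) : injective f ->
  std_gauss P (fun j => G (f j)).
Proof.
move=> fi; have -> : (fun j => G (f j)) =
    (fun j t => \sum_i (i == f j)%:R * G i t).
  by apply/funext => j; apply/funext => t; rewrite sum_delta.
apply: (std_gauss_rot stdG) => j k.
by rewrite sum_delta (inj_eq fi).
Qed.

End sub_families.

Section matrix_family.
Context d (T : measurableType d) (R : realType) (P : probability T R).
Variables (n k : nat) (z : 'I_n * 'I_k -> T -> R).
Hypothesis stdz : std_gauss P z.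

Lemma std_gauss_mul (m : nat) (O : 'M[R]_(m, n)) : O *m O^T = 1%:M ->
  std_gauss P (fun lj t => \sum_i O lj.1 i * z (i, lj.2) t : R).
Proof.
move=> OO.
have -> : (fun (lj : 'I_m * 'I_k) t => \sum_i O lj.1 i * z (i, lj.2) t) =
    (fun lj t => \sum_ij ((ij.2 == lj.2)%:R * O lj.1 ij.1) * z ij t).
  apply/funext => -[l j]; apply/funext => t /=.
  rewrite sum_pair/=.
  apply: eq_bigr => i _; under eq_bigr do rewrite -mulrA.
  by rewrite sum_delta.
apply: (std_gauss_rot stdz) => -[l j] [l' j'] /=.
rewrite sum_pair/=.
under eq_bigr => i _.
  under eq_bigr do rewrite -mulrA.
  rewrite sum_delta mulrCA; over.
rewrite -mulr_sumr /= (_ : \sum_i O l i * O l' i = (l == l')%:R).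
  by rewrite xpair_eqE -natrM mulnb andbC.
have := congr1 (fun A : 'M[R]_m => A l l') OO; rewrite !mxE => <-.
by apply: eq_bigr => i _; rewrite mxE.
Qed.

Lemma std_gauss_comb (c : 'I_k -> R) : \sum_j c j ^+ 2 = 1 ->
  std_gauss P (fun i t => \sum_j c j * z (i, j) t : R).
Proof.
move=> c1.
have -> : (fun (i : 'I_n) t => \sum_j c j * z (i, j) t) =
    (fun i t => \sum_ij ((ij.1 == i)%:R * c ij.2) * z ij t).
  apply/funext => i; apply/funext => t /=.
  rewrite sum_pair exchange_big/=; apply: eq_bigr => j _; under eq_bigr do rewrite -mulrA.
  by rewrite sum_delta.
apply: (std_gauss_rot stdz) => i i' /=.
rewrite sum_pair exchange_big/=; under eq_bigr => j _.
  under eq_bigr do rewrite -mulrA.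
  rewrite sum_delta mulrCA -expr2; over.
by rewrite -mulr_sumr c1 mulr1.
Qed.

End matrix_family.

(** * Concentration of the Gram matrix at a fixed vector *)

Section forms.
Context {R : realType} {n k : nat}.
Implicit Types (lam : 'I_k -> R) (x : 'I_n -> R) (z : 'I_n * 'I_k -> R).

Definition nrm2 x : R := \sum_i x i ^+ 2.
Definition proj x z (j : 'I_k) : R := \sum_i x i * z (i, j).
Definition quad lam x z : R := \sum_j lam j * proj x z j ^+ 2.
Definition quad2 lam x z : R := \sum_j lam j ^+ 2 * proj x z j ^+ 2.
Definition img2 lam x z : R := \sum_i (\sum_j lam j * proj x z j * z (i, j)) ^+ 2.

(* With [M] the Gram matrix of [z] weighted by [lam], [quad = x.Mx],
   [img2 = |Mx|^2], and [img2 * nrm2 - quad^2] measures the part of [Mx]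
   orthogonal to [x]. *)
Definition bad lam (m tau t2 L : R) x z : Prop :=
  [\/ 3 * Num.sqrt (L * m * tau) * nrm2 x < quad lam x z - tau * nrm2 x,
      quad lam x z - tau * nrm2 x < - (3 * Num.sqrt (L * m * tau)) * nrm2 x,
      t2 * (2 + 8 * L) * nrm2 x < quad2 lam x z |
      2 * n%:R * quad2 lam x z * nrm2 x < img2 lam x z * nrm2 x - quad lam x z ^+ 2].

Lemma nrm2_scale (c : R) x : nrm2 (fun i => c * x i) = c ^+ 2 * nrm2 x.
Proof. by rewrite /nrm2 mulr_sumr; apply: eq_bigr => i _; rewrite exprMn. Qed.

Lemma proj_scale (c : R) x z j : proj (fun i => c * x i) z j = c * proj x z j.
Proof. by rewrite /proj mulr_sumr; apply: eq_bigr => i _; rewrite mulrA. Qed.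

Lemma quad_scale lam (c : R) x z : quad lam (fun i => c * x i) z = c ^+ 2 * quad lam x z.
Proof.
rewrite /quad mulr_sumr; apply: eq_bigr => j _.
by rewrite proj_scale exprMn mulrCA.
Qed.

Lemma quad2_scale lam (c : R) x z : quad2 lam (fun i => c * x i) z = c ^+ 2 * quad2 lam x z.
Proof.
rewrite /quad2 mulr_sumr; apply: eq_bigr => j _.
by rewrite proj_scale exprMn mulrCA.
Qed.

Lemma img2_scale lam (c : R) x z : img2 lam (fun i => c * x i) z = c ^+ 2 * img2 lam x z.
Proof.
rewrite /img2 mulr_sumr; apply: eq_bigr => i _.
rewrite -exprMn mulr_sumr; congr (_ ^+ 2); apply: eq_bigr => j _.
by rewrite proj_scale; ring.
Qed.

(** The four inequalities are homogeneous in [x], of degree two for the first three and four for the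
    last; the factors [nrm2 x] are there for this. Estimates are thus needed only at unit
    vectors. *)
Lemma bad_scale lam m tau t2 L (c : R) x z : c != 0 ->
  bad lam m tau t2 L (fun i => c * x i) z -> bad lam m tau t2 L x z.
Proof.
move=> c0; rewrite /bad nrm2_scale quad_scale quad2_scale img2_scale.
have c2 : 0 < c ^+ 2 by rewrite exprn_even_gt0.
have c4 : 0 < c ^+ 2 * c ^+ 2 by rewrite mulr_gt0.
set r := 3 * _; set N := nrm2 x; set Q := quad lam x z; set Q2 := quad2 lam x z.
set M := img2 lam x z.
case=> h; [apply: Or41|apply: Or42|apply: Or43|apply: Or44].
- by rewrite -(ltr_pM2l c2); lra.
- by rewrite -(ltr_pM2l c2); lra.
- by rewrite -(ltr_pM2l c2); lra.
- by rewrite -(ltr_pM2l c4); lra.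
Qed.

Lemma bad0 lam m tau t2 L x z : nrm2 x = 0 -> ~ bad lam m tau t2 L x z.
Proof.
move=> x0; have xi i : x i = 0.
  apply/eqP; rewrite -sqrf_eq0; move/eqP: x0; rewrite /nrm2 psumr_eq0 => [/allP/(_ i)|j _];
    last exact: sqr_ge0.
  by rewrite mem_index_enum => /(_ isT).
have p0 j : proj x z j = 0 by rewrite /proj big1// => i _; rewrite xi mul0r.
have q0 : quad lam x z = 0 by rewrite /quad big1// => j _; rewrite p0 expr0n mulr0.
have q20 : quad2 lam x z = 0 by rewrite /quad2 big1// => j _; rewrite p0 expr0n mulr0.
by rewrite /bad x0 q0 q20 expr0n/= !mulr0 subrr; case; rewrite ltxx.
Qed.

End forms.

Section measurable_forms.
Context d (T : measurableType d) {R : realType} {n k : nat}.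
Variables (x : T -> 'I_n -> R) (z : T -> 'I_n * 'I_k -> R) (lam : 'I_k -> R).
Hypotheses (mx : forall i, measurable_fun setT (fun t => x t i))
  (mz : forall ij, measurable_fun setT (fun t => z t ij)).

Lemma measurable_nrm2 : measurable_fun setT (fun t => nrm2 (x t)).
Proof. by apply: measurable_sum => i; exact: measurable_funX. Qed.

Lemma measurable_proj j : measurable_fun setT (fun t => proj (x t) (z t) j).
Proof. by apply: measurable_sum => i; exact: measurable_funM. Qed.

Lemma measurable_quad : measurable_fun setT (fun t => quad lam (x t) (z t)).
Proof.
apply: measurable_sum => j; apply: measurable_funM => //.
by apply: measurable_funX; exact: measurable_proj.
Qed.

Lemma measurable_quad2 : measurable_fun setT (fun t => quad2 lam (x t) (z t)).
Proof.
apply: measurable_sum => j; apply: measurable_funM => //.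
by apply: measurable_funX; exact: measurable_proj.
Qed.

Lemma measurable_img2 : measurable_fun setT (fun t => img2 lam (x t) (z t)).
Proof.
apply: measurable_sum => i; apply: measurable_funX; apply: measurable_sum => j.
apply: measurable_funM => //; apply: measurable_funM => //.
exact: measurable_proj.
Qed.

Lemma measurable_bad (m tau t2 L : R) :
  measurable [set t | bad lam m tau t2 L (x t) (z t)].
Proof.
have mn := measurable_nrm2; have mq := measurable_quad.
have mq2 := measurable_quad2; have mi := measurable_img2.
rewrite (_ : [set t | _] =
  [set t | 3 * Num.sqrt (L * m * tau) * nrm2 (x t) < quad lam (x t) (z t) - tau * nrm2 (x t)] `|`
  [set t | quad lam (x t) (z t) - tau * nrm2 (x t) < - (3 * Num.sqrt (L * m * tau)) * nrm2 (x t)] `|`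
  [set t | t2 * (2 + 8 * L) * nrm2 (x t) < quad2 lam (x t) (z t)] `|`
  [set t | 2 * n%:R * quad2 lam (x t) (z t) * nrm2 (x t) <
    img2 lam (x t) (z t) * nrm2 (x t) - quad lam (x t) (z t) ^+ 2]); last first.
  apply/seteqP; split => t /=; first by case; tauto.
  by case=> [[[]|]|]; [exact: Or41|exact: Or42|exact: Or43|exact: Or44].
have mB : measurable_fun setT (fun t => quad lam (x t) (z t) - tau * nrm2 (x t)).
  by apply: measurable_funB => //; exact: measurable_funM.
apply: measurableU; [apply: measurableU; [apply: measurableU|]|]; apply: measurable_lt => //.
- exact: measurable_funM.
- exact: measurable_funM.
- exact: measurable_funM.
- by apply: measurable_funM => //; exact: measurable_funM.
- by apply: measurable_funB; [exact: measurable_funM|exact: measurable_funX].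
Qed.

End measurable_forms.

Section fixed.
Context d (T : measurableType d) (R : realType) (P : probability T R).

Lemma prob_setU_le (A B : set T) (a b : R) : measurable A -> measurable B ->
  (P A <= a%:E)%E -> (P B <= b%:E)%E -> (P (A `|` B) <= (a + b)%:E)%E.
Proof.
move=> mA mB Aa Bb; apply: le_trans (measureU2 P mA mB) _.
by rewrite EFinD leeD.
Qed.

Variables (n k : nat) (z : 'I_n.+1 * 'I_k -> T -> R).
Hypothesis stdz : std_gauss P z.
Variables (lam : 'I_k -> R) (m tau L : R).
Hypotheses (lam0 : forall j, 0 < lam j) (lamm : forall j, lam j <= m) (m0 : 0 < m)
  (tauE : \sum_j lam j = tau) (tau0 : 0 < tau) (L0 : 0 < L)
  (Lm : 16 * (L * m) <= tau) (Ln : 16 * L <= n.+1%:R).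
Let t2 := \sum_j lam j ^+ 2.

Section unit.
Variable x : 'I_n.+1 -> R.
Hypothesis x1 : \sum_i x i ^+ 2 = 1.

Let zt t (ij : 'I_n.+1 * 'I_k) := z ij t.

Lemma std_gauss_proj : std_gauss P (fun j t => proj x (zt t) j).
Proof.
have [Q [OO Ox]] := exists_orthonormal_row0 x1.
have := std_gauss_sub (std_gauss_mul stdz OO) (f := fun j : 'I_k => (0, j)).
rewrite (_ : (fun j => _) = (fun j t => proj x (zt t) j)).
  by apply => j j' [].
apply/funext => j; apply/funext => t /=; rewrite /proj.
by apply: eq_bigr => i _; rewrite Ox.
Qed.

(* Rotate [x] to the first axis.  Given row [0] of the rotated matrix [q], the
   coordinates [\sum_j lam j * q (0, j) * q (l, j)], [l != 0], of [Mx] orthogonal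
   to [x] are independent Gaussians of variance [quad2]. *)
Lemma prob_img2 :
  (P [set t | (2 * n.+1%:R * quad2 lam x (zt t) < img2 lam x (zt t) - quad lam x (zt t) ^+ 2)%R]
    <= (expR (- L))%:E)%E.
Proof.
have [Q [OO Ox]] := exists_orthonormal_row0 x1.
have stdq := std_gauss_mul stdz OO.
set q := (fun lj _ => _) in stdq.
pose A : pred ('I_n.+1 * 'I_k) := [pred lj | lj.1 == 0].
pose A' : pred ('I_n.+1 * 'I_k) := [pred lj | lj.1 != 0].
have AA' lj : A lj -> ~~ A' lj by rewrite /A /A' /= => ->.
pose TA := g_sigma_algebraType (cylinder q A).
pose TA' := g_sigma_algebraType (cylinder q A').
pose S (t : T) := \sum_j lam j ^+ 2 * q (0, j) t ^+ 2.
pose X : set (TA * TA') := [set tt' | 2 * n.+1%:R * S tt'.1 <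
  \sum_(l | l != 0) (\sum_j lam j * q (0, j) tt'.1 * q (l, j) tt'.2) ^+ 2].
have mq0 j : measurable_fun setT (fun tt' : TA * TA' => q (0, j) tt'.1).
  by apply: (measurableT_comp _ measurable_fst); exact: measurable_cylinder.
have mX : measurable X.
  apply: measurable_lt.
    apply: measurable_funM => //; apply: measurable_sum => j.
    by apply: measurable_funM => //; exact: measurable_funX.
  under eq_fun do rewrite big_mkcond.
  apply: measurable_sum => l; have [//|l0] := eqVneq l 0.
  apply: measurable_funX; apply: measurable_sum => j; apply: measurable_funM.
    exact: measurable_funM.
  by apply: (measurableT_comp _ measurable_snd); exact: measurable_cylinder.
have XL (t' : T) : (P [set t : T | X (t', t)] <= (expR (- L))%:E)%E.
  pose c j := lam j * q (0, j) t'.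
  have SE : S t' = \sum_j c j ^+ 2 by apply: eq_bigr => j _; rewrite exprMn.
  have S0 : 0 <= S t' by rewrite SE sumr_ge0// => j _; exact: sqr_ge0.
  have [S00|Sn0] := eqVneq (S t') 0.
    rewrite (_ : [set t | _] = set0) ?measure0 ?lee_fin ?expR_ge0//.
    apply/seteqP; split => // t; rewrite /X/= S00 mulr0.
    have c0 j : c j = 0.
      apply/eqP; rewrite -sqrf_eq0; move: S00; rewrite SE => /eqP.
      rewrite psumr_eq0 => [/allP/(_ j)|i _]; last exact: sqr_ge0.
      by rewrite mem_index_enum => /(_ isT).
    rewrite big1 ?ltxx// => l _; rewrite big1 ?expr0n// => j _.
    by rewrite -/(c j) c0 mul0r.
  have Sp : 0 < S t' by rewrite lt_neqAle eq_sym Sn0.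
  have sp : 0 < Num.sqrt (S t') by rewrite sqrtr_gt0.
  have c1 : \sum_j (c j / Num.sqrt (S t')) ^+ 2 = 1.
    under eq_bigr do rewrite exprMn exprVn sqr_sqrtr//.
    by rewrite -mulr_suml -SE mulfV.
  have stdu := std_gauss_comb stdq c1; set u := (fun i t => _) in stdu.
  have uE l t : \sum_j c j * q (l, j) t = Num.sqrt (S t') * u l t.
    rewrite /u mulr_sumr; apply: eq_bigr => j _.
    by field; rewrite gt_eqF.
  have n0 : (0 : R) < n.+1%:R by rewrite ltr0n.
  have L1 : 16 * (L * 1) <= n.+1%:R by rewrite mulr1.
  have wn : \sum_(l < n.+1) ((l != 0)%:R : R) <= n.+1%:R.
    rewrite -[X in X%:R]card_ord -sum1_card natr_sum; apply: ler_sum => l _.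
    by case: (l != 0).
  have wb (l : 'I_n.+1) : (0 : R) <= (l != 0)%:R by exact: ler0n.
  have w1 (l : 'I_n.+1) : ((l != 0)%:R : R) <= 1 by case: (l != 0).
  have := sqr_std_gauss_upper stdu wb w1 ltr01 wn n0 L0 L1.
  have mXt : measurable [set t : T | X (t', t)].
    apply: measurable_lt => //=; under eq_fun do rewrite big_mkcond.
    apply: measurable_sum => l; have [//|l0] := eqVneq l 0.
    apply: measurable_funX; apply: measurable_sum => j; apply: measurable_funM => //.
    exact: (measurable_std_gauss stdq).
  apply: prob_subset_le => //.
    by apply: measurable_lt => //; exact: (measurable_sqr_std_gauss stdu).
  move=> t; rewrite /X /=.
  have -> : \sum_(l | l != 0) (\sum_j lam j * q (0, j) t' * q (l, j) t) ^+ 2 =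
      S t' * \sum_l (l != 0)%:R * u l t ^+ 2.
    rewrite big_mkcond mulr_sumr; apply: eq_bigr => l _.
    rewrite uE exprMn sqr_sqrtr//.
    by case: (l != 0); rewrite ?mul1r ?mul0r ?mulr0.
  rewrite [2 * _ * S t']mulrC ltr_pM2l// => h.
  have -> : \sum_l (l != 0)%:R * (u l t ^+ 2 - 1) =
      \sum_l (l != 0)%:R * u l t ^+ 2 - \sum_(l < n.+1) (l != 0)%:R.
    by rewrite -sumrB; apply: eq_bigr => l _; rewrite mulrBr mulr1.
  (* Since [16 * L <= n.+1], the deviation is at most three quarters of the mean bound [n.+1], which
     the factor 2 in the threshold absorbs. *)
  have sq : Num.sqrt (L * 1 * n.+1%:R) <= n.+1%:R / 4.
    rewrite -[leRHS]ger0_norm ?divr_ge0// -sqrtr_sqr ler_sqrt ?sqr_ge0//.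
    by rewrite mulr1 exprMn; nra.
  lra.
have mG := measurable_std_gauss stdz.
have := prob_diag_le stdq AA' mX XL.
apply: prob_subset_le.
- apply: measurable_lt.
  + by apply: measurable_funM => //; exact: measurable_quad2.
  + by apply: measurable_funB; [exact: measurable_img2|
      apply: measurable_funX; exact: measurable_quad].
- apply: measurable_lt.
    apply: measurable_funM => //; apply: measurable_sum => j; apply: measurable_funM => //.
    by apply: measurable_funX; exact: (measurable_std_gauss stdq).
  under eq_fun do rewrite big_mkcond.
  apply: measurable_sum => l; have [//|l0] := eqVneq l 0.
  apply: measurable_funX; apply: measurable_sum => j.
  apply: measurable_funM; last exact: (measurable_std_gauss stdq).
  by apply: measurable_funM => //; exact: (measurable_std_gauss stdq).
- move=> t; rewrite /X /=.
  have pE j : proj x (zt t) j = q (0, j) t.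
    by rewrite /proj /q/=; apply: eq_bigr => i _; rewrite Ox.
  have -> : quad2 lam x (zt t) = S t by apply: eq_bigr => j _; rewrite pE.
  rewrite (_ : img2 lam x (zt t) - _ = \sum_(l | l != 0)
    (\sum_j lam j * q (0, j) t * q (l, j) t) ^+ 2)//.
  pose y i := \sum_j lam j * proj x (zt t) j * zt t (i, j).
  have OTO : Q^T *m Q = 1%:M by exact: mulmx1C.
  (* Here [y] is [M x] and [Q] is an isometry. The coordinate [l = 0] of [Q y] is [x.Mx], so
     subtracting its square leaves the part orthogonal to [x]. *)
  have yO : \sum_i y i ^+ 2 = \sum_l (\sum_i Q l i * y i) ^+ 2.
    pose Y : 'cV[R]_n.+1 := \col_i y i.
    have sqE (V : 'cV[R]_n.+1) : (V^T *m V) 0 0 = \sum_i V i 0 ^+ 2.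
      by rewrite mxE; apply: eq_bigr => i _; rewrite mxE expr2.
    transitivity ((Y^T *m Y) 0 0); first by rewrite sqE; apply: eq_bigr => i _; rewrite mxE.
    transitivity (((Q *m Y)^T *m (Q *m Y)) 0 0).
      by rewrite trmx_mul mulmxA -[Y^T *m Q^T *m Q]mulmxA OTO mulmx1.
    rewrite sqE; apply: eq_bigr => l _; rewrite mxE; congr (_ ^+ 2).
    by apply: eq_bigr => i _; rewrite mxE.
  have yE l : \sum_i Q l i * y i = \sum_j lam j * q (0, j) t * q (l, j) t.
    under eq_bigr do rewrite mulr_sumr.
    rewrite exchange_big/=; apply: eq_bigr => j _.
    rewrite -pE; set c := lam j * proj _ _ _; rewrite /q/= mulr_sumr.
    by apply: eq_bigr => i _; rewrite mulrCA.
  rewrite /img2 yO (bigD1 0)//= yE -/(quad lam x (zt t)).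
  have -> : \sum_j lam j * q (0, j) t * q (0, j) t = quad lam x (zt t).
    by apply: eq_bigr => j _; rewrite pE expr2 mulrA.
  rewrite addrC addrK; apply: eq_bigr => l _; by rewrite yE.
Qed.

Lemma prob_bad_unit : (P [set t : T | bad lam m tau t2 L x (zt t)] <= (expR (- L) *+ 4)%:E)%E.
Proof.
have n1 : nrm2 x = 1 by [].
have mz : forall ij, measurable_fun setT (fun t => zt t ij).
  by move=> ij; exact: (measurable_std_gauss stdz).
have lam0' j : 0 <= lam j by exact: ltW.
have mq : measurable_fun setT (fun t => quad lam x (zt t)) by exact: measurable_quad.
have mq2 : measurable_fun setT (fun t => quad2 lam x (zt t)) by exact: measurable_quad2.
have mi : measurable_fun setT (fun t => img2 lam x (zt t)) by exact: measurable_img2.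
have stau : \sum_j lam j <= tau by rewrite tauE.
have t2p : 0 < t2.
  have : t2 != 0.
    apply: contra_eq_neq tauE => t20; rewrite big1 ?lt_eqF// => j _.
    apply/eqP; rewrite -sqrf_eq0; move/eqP: t20; rewrite /t2 psumr_eq0 => [/allP/(_ j)|i _];
      last exact: sqr_ge0.
    by rewrite mem_index_enum => /(_ isT).
  by rewrite lt0r => ->; rewrite sumr_ge0// => j _; exact: sqr_ge0.
have h1 := sqr_std_gauss_upper std_gauss_proj lam0' lamm m0 stau tau0 L0 Lm.
have h2 := sqr_std_gauss_lower std_gauss_proj lam0' lamm m0 stau tau0 L0.
have h3 := @sqr_std_gauss_large _ _ _ _ _ _ std_gauss_proj (fun j => lam j ^+ 2) t2 L
  (fun j => sqr_ge0 _) (lexx _) t2p.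
have h4 := prob_img2.
have E t : \sum_j lam j * (proj x (zt t) j ^+ 2 - 1) = quad lam x (zt t) - tau.
  by rewrite -tauE -sumrB; apply: eq_bigr => j _; rewrite mulrBr mulr1.
rewrite !mulrSr mulr0n add0r.
have mc : measurable_fun setT (fun t => \sum_j lam j * (proj x (zt t) j ^+ 2 - 1)).
  exact: (measurable_sqr_std_gauss std_gauss_proj).
have m1 : measurable [set t : T | 3 * Num.sqrt (L * m * tau) <
    \sum_j lam j * (proj x (zt t) j ^+ 2 - 1)] by exact: measurable_lt.
have m2 : measurable [set t : T | \sum_j lam j * (proj x (zt t) j ^+ 2 - 1) <
    - (3 * Num.sqrt (L * m * tau))] by exact: measurable_lt.
have m3 : measurable [set t : T | t2 * (2 + 8 * L) < quad2 lam x (zt t)].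
  exact: measurable_lt.
have m4 : measurable [set t : T | 2 * n.+1%:R * quad2 lam x (zt t) <
    img2 lam x (zt t) - quad lam x (zt t) ^+ 2].
  by apply: measurable_lt; [exact: measurable_funM|
    apply: measurable_funB => //; exact: measurable_funX].
have m12 := measurableU _ _ m1 m2; have m123 := measurableU _ _ m12 m3.
apply: prob_subset_le (prob_setU_le m123 m4 (prob_setU_le m12 m3 (prob_setU_le m1 m2 h1 h2) h3) h4).
- exact: measurable_bad.
- exact: measurableU.
- move=> t /=; rewrite /bad n1 !mulr1 E.
  by case=> h; [left;left;left|left;left;right|left;right|right].
Qed.

End unit.

Lemma prob_bad (x : 'I_n.+1 -> R) :
  (P [set t : T | bad lam m tau t2 L x (fun ij => z ij t)] <= (expR (- L) *+ 4)%:E)%E.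
Proof.
have [x0|xn0] := eqVneq (nrm2 x) 0.
  rewrite (_ : [set t | _] = set0); first by rewrite measure0 lee_fin mulrn_wge0// expR_ge0.
  by apply/seteqP; split => // t; exact: bad0.
have xp : 0 < nrm2 x by rewrite lt0r xn0 sumr_ge0// => i _; exact: sqr_ge0.
pose s := Num.sqrt (nrm2 x); have sp : 0 < s by rewrite sqrtr_gt0.
have y1 : \sum_i (s^-1 * x i) ^+ 2 = 1.
  by rewrite -[LHS]/(nrm2 _) nrm2_scale exprVn sqr_sqrtr ?mulVf// ltW.
apply: prob_subset_le (prob_bad_unit y1).
- by apply: measurable_bad => // ij; exact: (measurable_std_gauss stdz).
- by apply: measurable_bad => // ij; exact: (measurable_std_gauss stdz).
- move=> t /= h; apply: (@bad_scale _ _ _ _ _ _ _ _ s); first by rewrite gt_eqF.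
  by congr bad : h; apply/funext => i; rewrite mulrA mulfV ?mul1r// gt_eqF.
Qed.

End fixed.

(** * The good event *)

Section lattice.
Context {R : realType}.

(** The integer points of the cube [-M, M]^n, indexed by a finite type so that a union bound is a
    finite sum. *)
Definition lattice_pt (n M : nat) (w : {ffun 'I_n -> 'I_(M + M).+1}) (i : 'I_n) : R :=
  (w i)%:R - M%:R.

Lemma expR1_ge2 : 2 <= expR 1 :> R.
Proof. by apply: le_trans (expR_ge1Dx 1). Qed.

Lemma expRN_nat_le (a : nat) : expR (- (a%:R)) <= 2^-1 ^+ a :> R.
Proof.
rewrite expRN -[a%:R]mulr1 -mulr_natl mulr1 expRM_natl exprVn.
by rewrite lef_pV2 ?posrE ?exprn_gt0 ?expR_gt0// lerXn2r ?nnegrE ?expR_ge0// expR1_ge2.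
Qed.

Let expR_sqr_le (a : nat) : expR (- (a%:R ^+ 2)) <= 2^-1 ^+ a :> R.
Proof.
apply: le_trans (expRN_nat_le a); rewrite ler_expR lerN2 -natrX ler_nat.
by case: a => // a; rewrite -mulnn leq_pmull.
Qed.

Let geom_le (m : nat) : \sum_(0 <= a < m) 2^-1 ^+ a <= 2 - 2^-1 ^+ m * 2 :> R.
Proof.
elim: m => [|m IH]; first by rewrite big_nil expr0; lra.
by rewrite big_nat_recr//= exprS; have := IH; lra.
Qed.

Let geom_rev_le (M : nat) : \sum_(0 <= a < M) 2^-1 ^+ (M - a) <= 1 :> R.
Proof.
elim: M => [|M IH]; first by rewrite big_nil.
rewrite big_nat_recr//= subSnn expr1.
rewrite (eq_big_nat _ _ (F2 := fun a => 2^-1 * 2^-1 ^+ (M - a))); last first.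
  by move=> a /andP[_ aM]; rewrite subSn ?exprS// ltnW.
by rewrite -mulr_sumr; lra.
Qed.

(** By exp(-a^2) <= 2^(-a), the negative integers contribute at most 1 and the nonnegative ones at
    most 2. *)
Lemma sum_expR_sqr_le (M : nat) :
  \sum_(a < (M + M).+1) expR (- ((a%:R - M%:R) ^+ 2)) <= 3 :> R.
Proof.
rewrite -(big_mkord xpredT (fun a => expR (- ((a%:R - M%:R : R) ^+ 2)))).
rewrite (@big_cat_nat _ _ _ M)//=; last by rewrite -addnS leq_addr.
have -> : (3 : R) = 1 + 2 by ring.
apply: lerD.
  apply: le_trans (geom_rev_le M); apply: ler_sum_nat => a /andP[_ aM].
  by rewrite -sqrrN opprB -natrB ?expR_sqr_le// ltnW.
apply: (@le_trans _ _ (\sum_(0 <= a < M.+1) 2^-1 ^+ a)); last first.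
  apply: le_trans (geom_le _) _; have : 0 <= 2^-1 ^+ M.+1 :> R by rewrite exprn_ge0.
  lra.
rewrite -[X in \sum_(X <= _ < _) _]add0n big_addn -addnS addKn.
by apply: ler_sum_nat => a _; rewrite natrD addrK expR_sqr_le.
Qed.

(** The sum factors over coordinates, and 3 <= e^2. It replaces a count: each point with
    [nrm2 <= 4 n] has weight at least e^(-4n), so there are at most e^(6n) of them. *)
Lemma sum_lattice_le (n M : nat) :
  \sum_(w : {ffun 'I_n -> 'I_(M + M).+1}) expR (- nrm2 (lattice_pt w)) <=
  expR (2 * n%:R).
Proof.
under eq_bigr do rewrite /nrm2 -sumrN expR_sum.
rewrite -(bigA_distr_bigA (fun (i : 'I_n) (a : 'I_(M + M).+1) =>
  expR (- ((a%:R - M%:R : R) ^+ 2)))).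
rewrite prodr_const card_ord [2 * _]mulrC expRM_natl.
rewrite lerXn2r ?nnegrE ?expR_ge0//; first by rewrite sumr_ge0// => i _; exact: expR_ge0.
apply: le_trans (sum_expR_sqr_le M) _; rewrite (_ : (2 : R) = 1 + 1) ?expRD; last by ring.
by have := expR1_ge2; nra.
Qed.

End lattice.

Section good_event.
Context d (T : measurableType d) (R : realType) (P : probability T R).

Lemma prob_bigsetU_le (I : finType) (A : I -> set T) (a : I -> R) :
  (forall i, measurable (A i)) -> (forall i, (P (A i) <= (a i)%:E)%E) ->
  (P (\big[setU/set0]_i A i) <= (\sum_i a i)%:E)%E.
Proof.
move=> mA Aa.
suff : measurable (\big[setU/set0]_i A i) /\
  (P (\big[setU/set0]_i A i) <= (\sum_i a i)%:E)%E by case.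
elim/big_rec2 : _ => [|i r B _ [mB Br]]; first by rewrite measure0.
by split; [exact: measurableU|exact: prob_setU_le].
Qed.

Variables (n k : nat) (G : ('I_n.+1 * 'I_k) + 'I_n.+1 -> T -> R).
Hypothesis stdG : std_gauss P G.
Variables (lam : 'I_k -> R) (m tau L K : R).
Hypotheses (lam0 : forall j, 0 < lam j) (lamm : forall j, lam j <= m) (m0 : 0 < m)
  (tauE : \sum_j lam j = tau) (tau0 : 0 < tau) (L0 : 0 < L)
  (Lm : 16 * (L * m) <= tau) (Ln : 16 * L <= n.+1%:R).
Let t2 := \sum_j lam j ^+ 2.
Hypotheses (Kt2 : K * t2 <= tau ^+ 2) (Kn : 128 * (6 * n.+1%:R + L) <= K).

Let z ij := G (inl ij).
Let eta i := G (inr i).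

Let stdz : std_gauss P z. Proof. by apply: (std_gauss_sub stdG) => ? ? []. Qed.
Let stde : std_gauss P eta. Proof. by apply: (std_gauss_sub stdG) => ? ? []. Qed.

Let zt t ij := z ij t.
Let et t i := eta i t.

Let mz ij : measurable_fun setT (fun t => zt t ij).
Proof. exact: (measurable_std_gauss stdz). Qed.

(** The noise coordinates are frozen, and the estimate for a fixed vector applies to each of their
    values. *)
Lemma prob_bad_random :
  (P [set t : T | bad lam m tau t2 L (et t) (zt t)] <= (expR (- L) *+ 4)%:E)%E.
Proof.
pose A : pred (('I_n.+1 * 'I_k) + 'I_n.+1) := fun i => if i is inr _ then true else false.
pose A' : pred (('I_n.+1 * 'I_k) + 'I_n.+1) := fun i => if i is inl _ then true else false.
have AA' i : A i -> ~~ A' i by case: i.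
apply: (@prob_diag_le _ _ _ _ _ _ stdG A A' AA'
  [set xt | bad lam m tau t2 L (fun i => G (inr i) xt.1) (fun ij => G (inl ij) xt.2)]).
  apply: measurable_bad => [i|ij].
    by apply: (measurableT_comp _ measurable_fst); exact: measurable_cylinder.
  by apply: (measurableT_comp _ measurable_snd); exact: measurable_cylinder.
by move=> x; exact: (prob_bad stdz lam0 lamm m0 tauE tau0 L0 Lm Ln (fun i => G (inr i) x)).
Qed.

Lemma prob_trace_large :
  (P [set t | (2 * n.+1%:R * tau < \sum_ij lam ij.2 * z ij t ^+ 2)%R] <= (expR (- L))%:E)%E.
Proof.
have n0 : (0 : R) < n.+1%:R by rewrite ltr0n.
have n1 : (1 : R) <= n.+1%:R by rewrite ler1n.
have sE : \sum_(ij : 'I_n.+1 * 'I_k) lam ij.2 = n.+1%:R * tau.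
  by rewrite sum_pair /= sumr_const card_ord tauE mulr_natl.
have v0 : 0 < n.+1%:R * tau by rewrite mulr_gt0.
have Lmn : 16 * (L * m) <= n.+1%:R * tau by rewrite (le_trans Lm)// ler_peMl// ltW.
have := sqr_std_gauss_upper stdz (fun ij => ltW (lam0 ij.2)) (fun ij => lamm ij.2) m0
  (_ : _ <= n.+1%:R * tau) v0 L0 Lmn.
rewrite sE => /(_ (lexx _)); apply: prob_subset_le.
- apply: measurable_lt => //; apply: measurable_sum => ij; apply: measurable_funM => //.
  by apply: measurable_funX; exact: mz.
- by apply: measurable_lt => //; exact: (measurable_sqr_std_gauss stdz).
- move=> t /= h.
  have -> : \sum_ij lam ij.2 * (z ij t ^+ 2 - 1) =
      \sum_ij lam ij.2 * z ij t ^+ 2 - n.+1%:R * tau.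
    by rewrite -sE -sumrB; apply: eq_bigr => ij _; rewrite mulrBr mulr1.
  have sq : Num.sqrt (L * m * (n.+1%:R * tau)) <= n.+1%:R * tau / 4.
    rewrite -[leRHS]ger0_norm ?divr_ge0 ?(ltW v0)// -sqrtr_sqr ler_sqrt ?sqr_ge0//.
    by rewrite exprMn; nra.
  lra.
Qed.

Lemma prob_noise_large :
  (P [set t | (n.+1%:R + 3 * Num.sqrt (L * n.+1%:R) < nrm2 (et t))%R] <= (expR (- L))%:E)%E.
Proof.
have n0 : (0 : R) < n.+1%:R by rewrite ltr0n.
have s1 : \sum_(i < n.+1) (1 : R) = n.+1%:R by rewrite sumr_const card_ord.
have L1 : 16 * (L * 1) <= n.+1%:R by rewrite mulr1.
have := sqr_std_gauss_upper stde (fun=> ler01) (fun=> lexx 1) ltr01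
  (_ : _ <= n.+1%:R) n0 L0 L1.
rewrite s1 mulr1 => /(_ (lexx _)); apply: prob_subset_le.
- apply: measurable_lt => //; apply: measurable_nrm2 => i.
  exact: (measurable_std_gauss stde).
- by apply: measurable_lt => //; exact: (measurable_sqr_std_gauss stde).
- move=> t /= h.
  have -> : \sum_(i < n.+1) 1 * (eta i t ^+ 2 - 1) = nrm2 (et t) - n.+1%:R.
    by rewrite -s1 -sumrB; apply: eq_bigr => i _; rewrite mul1r.
  lra.
Qed.

Lemma prob_quad_small (x : 'I_n.+1 -> R) :
  (P [set t | (quad lam x (zt t) < 3 / 4 * tau * nrm2 x)%R] <= (expR (- (K / 128)))%:E)%E.
Proof.
have K0 : 0 < K.
  by apply: lt_le_trans Kn; rewrite mulr_gt0// addr_gt0// mulr_gt0// ltr0n.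
have [x0|xn0] := eqVneq (nrm2 x) 0.
  rewrite (_ : [set t | _] = set0); first by rewrite measure0 lee_fin expR_ge0.
  apply/seteqP; split => // t /=; rewrite x0 mulr0 ltNge => /negP; apply.
  by apply: sumr_ge0 => j _; rewrite mulr_ge0 ?sqr_ge0// ltW.
have xp : 0 < nrm2 x by rewrite lt0r xn0 sumr_ge0// => i _; exact: sqr_ge0.
pose s := Num.sqrt (nrm2 x); have sp : 0 < s by rewrite sqrtr_gt0.
have y1 : \sum_i (s^-1 * x i) ^+ 2 = 1.
  by rewrite -[LHS]/(nrm2 _) nrm2_scale exprVn sqr_sqrtr ?mulVf// ltW.
apply: prob_subset_le (sqr_std_gauss_small (std_gauss_proj stdz y1)
  (fun j => ltW (lam0 j)) tauE tau0 K0 Kt2).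
- by apply: measurable_lt => //; exact: measurable_quad.
- apply: measurable_lt => //; apply: measurable_sum => j; apply: measurable_funM => //.
  by apply: measurable_funX; exact: (measurable_std_gauss (std_gauss_proj stdz y1)).
- move=> t /= h; rewrite -/(quad lam (fun i => s^-1 * x i) (zt t)).
  by rewrite quad_scale exprVn sqr_sqrtr ?(ltW xp)// [_^-1 * _]mulrC ltr_pdivrMr.
Qed.

(** A point with [nrm2 <= 4 * n.+1] has coordinates of size at most 2 sqrt(n+1) <= [M], so the cube
    misses none of them. *)
Let M := (2 * n.+1)%N.

Let pt (w : {ffun 'I_n.+1 -> 'I_(M + M).+1}) : 'I_n.+1 -> R := lattice_pt w.

Let lat t := forall w : {ffun 'I_n.+1 -> 'I_(M + M).+1},
  nrm2 (pt w) <= 4 * n.+1%:R ->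
  3 / 4 * tau * nrm2 (pt w) <= quad lam (pt w) (zt t).

Let latbad w : set T := [set t | nrm2 (pt w) <= 4 * n.+1%:R /\
  quad lam (pt w) (zt t) < 3 / 4 * tau * nrm2 (pt w)].

Let mlatbad w : measurable (@latbad w).
Proof.
rewrite /latbad; have [h|h] := boolP (nrm2 (pt w) <= 4 * n.+1%:R).
  rewrite (_ : [set t | _] = [set t | quad lam (pt w) (zt t) < 3 / 4 * tau * nrm2 (pt w)]).
    by apply: measurable_lt => //; exact: measurable_quad.
  by apply/seteqP; split => t //= [].
by rewrite (_ : [set t | _] = set0)//; apply/seteqP; split => t //= [].
Qed.

(** Points outside the ball of squared radius [4 * n.+1] have an empty event. Inside it, exp(4(n+1)
    - nrm2) >= 1 inserts the summable weight. The exponents 4 and 2 make up the 6 of [Kn]. *)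
Lemma prob_lattice :
  (P (\big[setU/set0]_(w : {ffun 'I_n.+1 -> 'I_(M + M).+1}) latbad w) <= (expR (- L))%:E)%E.
Proof.
apply: le_trans (prob_bigsetU_le (a := fun w => expR (4 * n.+1%:R - K / 128) *
  expR (- nrm2 (pt w))) _ _) _.
- by move=> w; exact: mlatbad.
- move=> w.
  have [h|h] := boolP (nrm2 (pt w) <= 4 * n.+1%:R); last first.
    rewrite (_ : latbad w = set0) ?measure0 ?lee_fin ?mulr_ge0 ?expR_ge0//.
    by apply/seteqP; split => t //= [] h'; rewrite h' in h.
  apply: (@le_trans _ _ (expR (- (K / 128)))%:E).
    apply: prob_subset_le (prob_quad_small (pt w)) => //.
      by apply: measurable_lt => //; exact: measurable_quad.
    by move=> t [].
  rewrite lee_fin -expRD ler_expR; lra.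
- rewrite lee_fin -mulr_sumr.
  apply: (@le_trans _ _ (expR (4 * n.+1%:R - K / 128) * expR (2 * n.+1%:R))).
    by rewrite ler_pM2l ?expR_gt0//; exact: sum_lattice_le.
  rewrite -expRD ler_expR; move: Kn; set N : R := n.+1%:R; lra.
Qed.

(** The count 7 is one tail for the trace, one for the noise norm, four for [bad] and one for the
    lattice. *)
Lemma exists_good_event : exists A : set T, [/\ measurable A,
  ((1 - expR (- L) *+ 7)%:E <= P A)%E & forall t, A t ->
  [/\ \sum_ij lam ij.2 * z ij t ^+ 2 <= 2 * n.+1%:R * tau,
      nrm2 (et t) <= n.+1%:R + 3 * Num.sqrt (L * n.+1%:R),
      ~ bad lam m tau t2 L (et t) (zt t) & lat t]].
Proof.
pose B1 := [set t | 2 * n.+1%:R * tau < \sum_ij lam ij.2 * z ij t ^+ 2].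
pose B2 := [set t | n.+1%:R + 3 * Num.sqrt (L * n.+1%:R) < nrm2 (et t)].
pose B3 := [set t : T | bad lam m tau t2 L (et t) (zt t)].
pose B4 := \big[setU/set0]_(w : {ffun 'I_n.+1 -> 'I_(M + M).+1}) latbad w.
have me i : measurable_fun setT (fun t => et t i) by exact: (measurable_std_gauss stde).
have m1 : measurable B1.
  apply: measurable_lt => //; apply: measurable_sum => ij; apply: measurable_funM => //.
  by apply: measurable_funX; exact: mz.
have m2 : measurable B2 by apply: measurable_lt => //; exact: measurable_nrm2.
have m3 : measurable B3 by exact: measurable_bad.
have m4 : measurable B4 by apply: bigsetU_measurable => w _; exact: mlatbad.
have m12 := measurableU _ _ m1 m2; have m123 := measurableU _ _ m12 m3.
have m1234 := measurableU _ _ m123 m4.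
have h := prob_setU_le m123 m4 (prob_setU_le m12 m3
  (prob_setU_le m1 m2 prob_trace_large prob_noise_large) prob_bad_random) prob_lattice.
exists (~` (B1 `|` B2 `|` B3 `|` B4)); split.
- exact: measurableC.
- rewrite probability_setC// EFinB leeB//; apply: le_trans h _.
  by rewrite lee_fin; set e := expR _; rewrite (_ : e + e + e *+ 4 + e = e *+ 7)//; ring.
- move=> t /not_orP[/not_orP[/not_orP[h1 h2] h3] h4]; split => //.
  + by rewrite leNgt; apply/negP.
  + by rewrite leNgt; apply/negP.
  + move=> w hw; rewrite leNgt; apply/negP => hq; apply: h4.
    by rewrite /B4 -bigcup_seq; exists w => //=; rewrite mem_index_enum.
Qed.

End good_event.

(** * Rounding to the integer lattice *)

Section rounding.
Context {R : realType} {n k : nat}.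
Variables (lam : 'I_k -> R) (z : 'I_n * 'I_k -> R) (kappa : R).
Hypotheses (lam0 : forall j, 0 <= lam j) (kappa0 : 0 <= kappa).

Let q (v : 'I_n -> R) : R := quad lam v z - kappa * nrm2 v.
Let tr (i : 'I_n) : R := \sum_j lam j * z (i, j) ^+ 2.
Let shift (v : 'I_n -> R) (i0 : 'I_n) (e : R) (i : 'I_n) : R := v i + e * (i == i0)%:R.

Let q_shift v i0 : exists b, forall e, q (shift v i0 e) =
  q v + e * b + e ^+ 2 * (tr i0 - kappa).
Proof.
exists (2 * \sum_j lam j * proj v z j * z (i0, j) - kappa * (2 * v i0)) => e.
have pE j : proj (shift v i0 e) z j = proj v z j + e * z (i0, j).
  rewrite /proj /shift; under eq_bigr do rewrite mulrDl -mulrA.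
  by rewrite big_split/= -mulr_sumr sum_delta.
have qE : quad lam (shift v i0 e) z = quad lam v z +
    e * (2 * \sum_j lam j * proj v z j * z (i0, j)) + e ^+ 2 * tr i0.
  rewrite /quad /tr !mulr_sumr -!big_split/=; apply: eq_bigr => j _.
  by rewrite pE; ring.
have nE : nrm2 (shift v i0 e) = nrm2 v + e * (2 * v i0) + e ^+ 2.
  rewrite /nrm2; transitivity (\sum_i (v i ^+ 2 +
      (i == i0)%:R * (2 * e * v i + e ^+ 2 * (i == i0)%:R))).
    by apply: eq_bigr => i _; rewrite /shift; ring.
  by rewrite big_split/= sum_delta eqxx/=; ring.
by rewrite /q qE nE; ring.
Qed.

(** The rounded form is that of [M - kappa], not of [M]: its nonnegativity at integer points then
    transfers to [v] without comparing [nrm2 w] to [nrm2 v]. Along coordinate [i] its leading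
    coefficient is [tr i - kappa <= tr i], with [tr i] the diagonal entry of [M], so the losses add
    up to a quarter of the trace. *)
Lemma round_coords (s : seq 'I_n) (v : 'I_n -> R) : uniq s -> exists w : 'I_n -> R,
  [/\ forall i, i \in s -> exists a : int, w i = a%:~R,
      forall i, i \notin s -> w i = v i,
      forall i, `|w i - v i| <= 1 &
      q w <= q v + 4^-1 * \sum_(i <- s) tr i].
Proof.
elim: s => [_|i0 s IH /= /andP[i0s us]].
  exists v; split => // [i|]; first by rewrite subrr normr0.
  by rewrite big_nil mulr0 addr0.
have [w [wint wv wv1 qw]] := IH us.
have wi0 : w i0 = v i0 by exact: wv.
pose f : int := Num.floor (v i0).
have [fl fu] : f%:~R <= v i0 /\ v i0 < f%:~R + 1.
  have := real_floor_itv (num_real (v i0)); rewrite intrD => /andP[]; by split.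
pose th := v i0 - f%:~R.
have th0 : 0 <= th by rewrite subr_ge0.
have th1 : th < 1 by rewrite /th; lra.
have tr0 : 0 <= tr i0 by rewrite sumr_ge0// => j _; rewrite mulr_ge0// sqr_ge0.
have [b qb] := q_shift w i0.
(* On a segment between two consecutive integers, one endpoint of the parabola
   exceeds its value by at most a quarter of the leading coefficient. *)
have [e [ee qe]] : exists e, (e = - th \/ e = 1 - th) /\
    q (shift w i0 e) <= q w + 4^-1 * tr i0.
  have [h|h] := leP (q (shift w i0 (- th))) (q w + 4^-1 * tr i0).
    by exists (- th); split; [left|].
  exists (1 - th); split; first by right.
  rewrite leNgt; apply/negP => h'; move: h h'; rewrite !qb => h h'.
  (* Averaging the two endpoints with weights [1 - th] and [th] cancels the linear term and leaves
     [th * (1 - th)] times the leading coefficient. *)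
  have t4 : th * (1 - th) <= 4^-1 by have := sqr_ge0 (th - 2^-1); lra.
  have t0 : 0 <= th * (1 - th) by rewrite mulr_ge0// subr_ge0 ltW.
  have h1 : (1 - th) * (4^-1 * tr i0) <= (1 - th) * (- th * b + (- th) ^+ 2 * (tr i0 - kappa)).
    by rewrite ler_wpM2l ?subr_ge0 ?(ltW th1)//; lra.
  have h2 : th * (4^-1 * tr i0) <= th * ((1 - th) * b + (1 - th) ^+ 2 * (tr i0 - kappa)).
    by rewrite ler_wpM2l//; lra.
  have h3 : 0 < (1 - th) * ((- th * b + (- th) ^+ 2 * (tr i0 - kappa)) - 4^-1 * tr i0).
    by rewrite mulr_gt0 ?subr_gt0//; lra.
  have h4 : th * (1 - th) * tr i0 <= 4^-1 * tr i0 by rewrite ler_wpM2r.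
  have h5 : 0 <= th * (1 - th) * kappa by rewrite mulr_ge0.
  nra.
exists (shift w i0 e); split.
- move=> i; rewrite inE /shift => /orP[/eqP ->|si].
    rewrite eqxx mulr1 wi0; case: ee => ->; [exists f|exists (f + 1)].
      by rewrite /th; ring.
    by rewrite intrD /th; ring.
  have [a wa] := wint i si; exists a.
  by rewrite (_ : (i == i0) = false) ?mulr0 ?addr0//; apply: contraNF i0s => /eqP <-.
- move=> i; rewrite inE negb_or => /andP[/negbTE ii0 si].
  by rewrite /shift ii0 mulr0 addr0 wv.
- move=> i; rewrite /shift; have [->|_] := eqVneq i i0; last by rewrite mulr0 addr0.
  rewrite mulr1 wi0 addrC addKr; case: ee => ->; rewrite ?normrN ger0_norm//; lra.
- by rewrite big_cons mulrDr; lra.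
Qed.

End rounding.

Section lower_bound.
Context {R : realType} {n k : nat}.
Variables (lam : 'I_k -> R) (z : 'I_n.+1 * 'I_k -> R) (tau : R).
Hypotheses (lam0 : forall j, 0 <= lam j) (tau0 : 0 < tau).
Hypothesis trace_le : \sum_ij lam ij.2 * z ij ^+ 2 <= 2 * n.+1%:R * tau.
Let M := (2 * n.+1)%N.
Hypothesis lattice_ge : forall w : {ffun 'I_n.+1 -> 'I_(M + M).+1},
  nrm2 (lattice_pt w : 'I_n.+1 -> R) <= 4 * n.+1%:R ->
  3 / 4 * tau * nrm2 (lattice_pt w : 'I_n.+1 -> R) <= quad lam (lattice_pt w) z.

(** The sphere is scaled so that rounding errors of size one per coordinate are comparable to [v]:
    they give nrm2 w <= 2 nrm2 v + 2(n+1) = 4(n+1). The loss tr M / 4 <= (n+1) tau / 2 reduces the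
    coefficient 3/4 to 1/4. *)
Let quad_ge_sphere (v : 'I_n.+1 -> R) : nrm2 v = n.+1%:R ->
  4^-1 * tau * n.+1%:R <= quad lam v z.
Proof.
move=> vn; have N0 : (0 : R) < n.+1%:R by rewrite ltr0n.
have kappa0 : 0 <= 3 / 4 * tau by rewrite mulr_ge0// ltW.
have [w [wint _ wv qw]] := @round_coords _ _ _ lam z (3 / 4 * tau) lam0 kappa0
  (index_enum 'I_n.+1) v (index_enum_uniq _).
have w2 : nrm2 w <= 4 * n.+1%:R.
  have s1 : \sum_(i < n.+1) (2 : R) = 2 * n.+1%:R by rewrite sumr_const card_ord mulr_natr.
  apply: (@le_trans _ _ (\sum_i (2 * v i ^+ 2 + 2))); last first.
    by rewrite big_split/= s1 -mulr_sumr -/(nrm2 v) vn; lra.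
  apply: ler_sum => i _; have := wv i; rewrite ler_norml => /andP[? ?].
  by have := sqr_ge0 (v i - (w i - v i)); nra.
have [f fE] : exists f : {ffun 'I_n.+1 -> 'I_(M + M).+1}, w = lattice_pt f.
  have wi i : exists c : 'I_(M + M).+1, w i = c%:R - M%:R.
    have [a wa] := wint i (mem_index_enum i).
    have wM : `|w i| <= M%:R.
      rewrite -(@ler_sqr _ _ (M%:R))// ?nnegrE// real_normK ?num_real//.
      apply: (@le_trans _ _ (nrm2 w)).
        by rewrite /nrm2 (bigD1 i)//= lerDl sumr_ge0// => ? _; exact: sqr_ge0.
      apply: le_trans w2 _; rewrite /M natrM exprMn.
      have : (1 : R) <= n.+1%:R by rewrite ler1n.
      nra.
    move: wM; rewrite wa -intr_norm -[M%:R]/(M%:~R) ler_int => aM.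
    have a0 : 0 <= a + M by lia.
    have cM : (`|(a + M)%R|%N < (M + M).+1)%N by lia.
    exists (Ordinal cM) => /=.
    rewrite natr_absz ger0_norm// intrD; by rewrite addrK.
  have [g gE] := choice wi.
  by exists (finfun g); apply/funext => i; rewrite /lattice_pt ffunE.
have := lattice_ge (w := f); rewrite -fE => /(_ w2) ql.
move: qw; rewrite vn.
have -> : \sum_(i <- index_enum 'I_n.+1) \sum_j lam j * z (i, j) ^+ 2 =
    \sum_ij lam ij.2 * z ij ^+ 2 by rewrite sum_pair.
move: trace_le ql; set N : R := n.+1%:R; lra.
Qed.

Lemma quad_ge (v : 'I_n.+1 -> R) : 4^-1 * tau * nrm2 v <= quad lam v z.
Proof.
have [v0|vn0] := eqVneq (nrm2 v) 0.
  by rewrite v0 mulr0; apply: sumr_ge0 => j _; rewrite mulr_ge0 ?sqr_ge0.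
have vp : 0 < nrm2 v by rewrite lt0r vn0 sumr_ge0// => i _; exact: sqr_ge0.
have N0 : (0 : R) < n.+1%:R by rewrite ltr0n.
pose c := Num.sqrt (n.+1%:R / nrm2 v).
have c2 : c ^+ 2 = n.+1%:R / nrm2 v by rewrite sqr_sqrtr// divr_ge0// ltW.
have := @quad_ge_sphere (fun i => c * v i).
rewrite nrm2_scale quad_scale c2 divfK// => /(_ erefl).
have cp : 0 < n.+1%:R / nrm2 v by rewrite divr_gt0.
move=> h; rewrite -(ler_pM2l cp); apply: le_trans h.
by rewrite le_eqVlt; apply/orP; left; apply/eqP; field.
Qed.

End lower_bound.

(** * Minimal norm interpolation *)

Section dot.
Context {R : realType}.

Definition dot {n : nat} (u v : 'cV[R]_n) : R := (u^T *m v) 0 0.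

Lemma dotE n (u v : 'cV[R]_n) : dot u v = \sum_i u i 0 * v i 0.
Proof. by rewrite /dot mxE; apply: eq_bigr => i _; rewrite mxE. Qed.

Lemma dotC n (u v : 'cV[R]_n) : dot u v = dot v u.
Proof. by rewrite !dotE; apply: eq_bigr => i _; rewrite mulrC. Qed.

Lemma dotDl n (u v w : 'cV[R]_n) : dot (u + v) w = dot u w + dot v w.
Proof. by rewrite /dot linearD/= mulmxDl mxE. Qed.

Lemma dotDr n (u v w : 'cV[R]_n) : dot w (u + v) = dot w u + dot w v.
Proof. by rewrite dotC dotDl !(dotC w). Qed.

Lemma dotZl n (a : R) (u v : 'cV[R]_n) : dot (a *: u) v = a * dot u v.
Proof. by rewrite /dot linearZ/= -scalemxAl mxE. Qed.

Lemma dotZr n (a : R) (u v : 'cV[R]_n) : dot u (a *: v) = a * dot u v.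
Proof. by rewrite dotC dotZl dotC. Qed.

Lemma dotNl n (u v : 'cV[R]_n) : dot (- u) v = - dot u v.
Proof. by rewrite -scaleN1r dotZl mulN1r. Qed.

Lemma dotNr n (u v : 'cV[R]_n) : dot u (- v) = - dot u v.
Proof. by rewrite dotC dotNl dotC. Qed.

Lemma dotMl m n (A : 'M[R]_(m, n)) (u : 'cV[R]_n) (v : 'cV[R]_m) :
  dot (A *m u) v = dot u (A^T *m v).
Proof. by rewrite /dot trmx_mul mulmxA. Qed.

Lemma dotMr m n (A : 'M[R]_(m, n)) (u : 'cV[R]_m) (v : 'cV[R]_n) :
  dot u (A *m v) = dot (A^T *m u) v.
Proof. by rewrite dotMl trmxK. Qed.

Lemma dot_nrm2 n (u : 'cV[R]_n) : dot u u = nrm2 (fun i => u i 0).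
Proof. by rewrite dotE; apply: eq_bigr => i _; rewrite expr2. Qed.

Lemma dot_ge0 n (u : 'cV[R]_n) : 0 <= dot u u.
Proof. by rewrite dot_nrm2 sumr_ge0// => i _; exact: sqr_ge0. Qed.

Lemma dot_eq0 n (u : 'cV[R]_n) : (dot u u == 0) = (u == 0).
Proof.
apply/eqP/eqP => [|->]; last by rewrite /dot mulmx0 mxE.
rewrite dot_nrm2 => /eqP; rewrite psumr_eq0 => [/allP h|j _]; last exact: sqr_ge0.
apply/matrixP => i j; rewrite ord1 mxE; apply/eqP; rewrite -sqrf_eq0.
by apply: h; exact: mem_index_enum.
Qed.

Lemma norm2E n (u : 'cV[R]_n) : norm2 u = Num.sqrt (dot u u).
Proof. by rewrite dot_nrm2. Qed.

Lemma norm2_ge0 n (u : 'cV[R]_n) : 0 <= norm2 u.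
Proof. exact: sqrtr_ge0. Qed.

Lemma norm2_sqr n (u : 'cV[R]_n) : norm2 u ^+ 2 = dot u u.
Proof. by rewrite norm2E sqr_sqrtr// dot_ge0. Qed.

Lemma norm2_le_sqr n (u : 'cV[R]_n) (a : R) : 0 <= a ->
  (norm2 u <= a) = (dot u u <= a ^+ 2).
Proof. by move=> a0; rewrite -norm2_sqr ler_sqr// nnegrE norm2_ge0. Qed.

Lemma dot_CauchySchwarz n (u v : 'cV[R]_n) : dot u v ^+ 2 <= dot u u * dot v v.
Proof.
have := dot_ge0 (dot v v *: u - dot u v *: v).
rewrite !(dotDl, dotDr, dotNl, dotNr, dotZl, dotZr) (dotC v u).
have [v0|vn0] := eqVneq (dot v v) 0.
  have -> : v = 0 by apply/eqP; rewrite -dot_eq0 v0.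
  by move=> _; rewrite /dot !mulmx0 !mxE expr0n/= mulr0.
have vp : 0 < dot v v by rewrite lt0r vn0 dot_ge0.
by move=> h; rewrite -(ler_pM2l vp); nra.
Qed.

Lemma dot_le_norm2 n (u v : 'cV[R]_n) : dot u v <= norm2 u * norm2 v.
Proof.
have h := dot_CauchySchwarz u v.
apply: le_trans (ler_norm _) _; rewrite -sqrtr_sqr !norm2E -sqrtrM ?dot_ge0//.
by rewrite ler_sqrt// mulr_ge0// dot_ge0.
Qed.

Lemma norm2D n (u v : 'cV[R]_n) : norm2 (u + v) <= norm2 u + norm2 v.
Proof.
rewrite norm2_le_sqr ?addr_ge0 ?norm2_ge0// !(dotDl, dotDr) (dotC v u).
by have := dot_le_norm2 u v; rewrite -!norm2_sqr; nra.
Qed.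

(** As [X] may be rank deficient, it is replaced by a basis [B] of its row space, for which [B B^T]
    is invertible. The minimiser is the orthogonal projection of [w0] onto that space. *)
Lemma min_norm_exists n d (X : 'M[R]_(n, d)) (w0 : 'cV[R]_d) :
  exists w, min_norm_interp X (X *m w0) w.
Proof.
have [r [B [Bf [C XC] [D BD]]]] : exists r (B : 'M[R]_(r, d)),
    [/\ row_free B, exists C, X = C *m B & exists D, B = D *m X].
  exists (\rank X), (row_base X); split; first exact: row_base_free.
  - by apply/submxP; rewrite eq_row_base submx_refl.
  - by apply/submxP; rewrite eq_row_base submx_refl.
have BB : B *m B^T \in unitmx.
  rewrite -row_free_unit; apply: inj_row_free => u uBB.
  have BBT : (B *m B^T)^T = B *m B^T by rewrite trmx_mul trmxK.
  have BBu : B *m B^T *m u^T = 0 by rewrite -BBT -trmx_mul uBB trmx0.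
  have : dot (B^T *m u^T) (B^T *m u^T) == 0.
    by rewrite dotMl trmxK mulmxA BBu /dot mulmx0 mxE.
  rewrite dot_eq0 -trmx_mul trmx_eq0 => /eqP uB.
  by apply: (row_free_inj Bf); rewrite uB mul0mx.
pose g := invmx (B *m B^T) *m (B *m w0).
exists (B^T *m g); split.
  by rewrite XC -!mulmxA; congr (C *m _); rewrite mulmxA mulKVmx.
move=> v Xv; have Bv : B *m v = B *m w0 by rewrite BD -!mulmxA Xv.
rewrite norm2_le_sqr ?norm2_ge0// norm2_sqr.
set w := B^T *m g.
have Bw : B *m w = B *m w0 by rewrite /w /g mulmxA mulKVmx.
have [e vE] : exists e, v = w + e by exists (v - w); rewrite addrC subrK.
have we : dot w e = 0.
  rewrite /w dotMl trmxK (_ : B *m e = 0) ?/dot ?mulmx0 ?mxE//.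
  by apply: (addrI (B *m w)); rewrite addr0 -mulmxDr -vE Bv Bw.
by rewrite vE !(dotDl, dotDr) (dotC e w) we; have := dot_ge0 e; lra.
Qed.

(* [M^-1 x = x / tau + M^-1 r], and [r.M^-1 r <= (4 / tau) |r|^2] by
   Cauchy-Schwarz applied to [r] and [M^-1 r]. *)
Lemma inv_quad_le n (M : 'M[R]_n) (tau : R) (x : 'cV[R]_n) :
  M^T = M -> 0 < tau -> (forall v, 4^-1 * tau * dot v v <= dot v (M *m v)) ->
  M \in unitmx /\
  let r := x - tau^-1 *: (M *m x) in
  tau * dot x (invmx M *m x) <= dot x x + dot r x + 4 * dot r r.
Proof.
move=> MT tau0 Mge.
have Mu : M \in unitmx.
  rewrite -row_free_unit; apply: inj_row_free => u uM.
  have Mu0 : M *m u^T = 0 by rewrite -{1}MT -trmx_mul uM trmx0.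
  have := Mge u^T; rewrite Mu0 {2}/dot mulmx0 mxE => h.
  have u0 : dot u^T u^T == 0.
    by rewrite eq_le dot_ge0 andbT; have := dot_ge0 u^T; nra.
  by move: u0; rewrite dot_eq0 trmx_eq0 => /eqP.
split=> // r; pose y := invmx M *m r.
have MiT : (invmx M)^T = invmx M by rewrite trmx_inv MT.
have My : M *m y = r by rewrite /y mulKVmx.
have xE : invmx M *m x = tau^-1 *: x + y.
  by rewrite /y /r mulmxBr -scalemxAr mulKmx// addrC subrK.
have ry : dot r y <= 4 / tau * dot r r.
  have h := Mge y; rewrite My dotC in h.
  have cs := dot_CauchySchwarz r y.
  have ry0 : 0 <= dot r y.
    by apply: le_trans h; rewrite mulr_ge0 ?dot_ge0// mulr_ge0// ltW.
  have [->|ryn] := eqVneq (dot r y) 0.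
    by rewrite mulr_ge0 ?dot_ge0// divr_ge0// ltW.
  have ryp : 0 < dot r y by rewrite lt0r ryn.
  rewrite mulrAC ler_pdivlMr// -(ler_pM2r ryp).
  by have := dot_ge0 r; nra.
have xy : dot x y = tau^-1 * dot r x + dot r y.
  by rewrite {1}/y dotMr MiT xE dotDl dotZl (dotC x r) (dotC y r).
rewrite xE dotDr dotZr xy !mulrDr !mulrA mulfV ?gt_eqF// !mul1r.
rewrite -addrA lerD2l lerD2l.
have := ler_pM2l tau0 (dot r y) (4 / tau * dot r r).
by rewrite ry mulrA mulrCA mulfV ?gt_eqF// mulr1.
Qed.

End dot.

(** * Spectral decomposition of the covariance *)

Section spectral.
Context {R : realType}.

Lemma psd_dot n (A : 'M[R]_n) (v : 'cV[R]_n) : psd A -> 0 <= dot v (A *m v).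
Proof. by move=> [_ /(_ v)]; rewrite /dot mulmxA. Qed.

(** Otherwise the form would be negative at [v - t A v] for small [t > 0]: its value there is - 2 t
    s + t^2 c, and the chosen [t] satisfies t c < s. *)
Lemma psd_ker n (A : 'M[R]_n) (v : 'cV[R]_n) :
  psd A -> dot v (A *m v) = 0 -> A *m v = 0.
Proof.
move=> pA v0; have [AT _] := pA; set s := dot (A *m v) (A *m v).
have s0 : 0 <= s by exact: dot_ge0.
pose c := dot (A *m v) (A *m (A *m v)).
have c0 : 0 <= c by exact: psd_dot.
apply/eqP; rewrite -dot_eq0 -/s; apply: contraT => sn0.
have sp : 0 < s by rewrite lt0r sn0.
pose t := s / (c + 1).
have cp : 0 < c + 1 by rewrite ltr_wpDl.
have tp : 0 < t by rewrite divr_gt0.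
have tc : t * c < s.
  by rewrite /t mulrAC ltr_pdivrMr// ltr_pM2l//; lra.
have e : dot v (A *m (A *m v)) = s by rewrite dotMr AT.
have e' : dot (A *m v) (A *m v) = s by [].
have := psd_dot (v - t *: (A *m v)) pA.
rewrite mulmxBr -scalemxAr !(dotDl, dotDr, dotNl, dotNr, dotZl, dotZr) v0 e e' -/c.
nra.
Qed.

Lemma continuous_quadratic n (A : 'M[R]_n.+1) :
  continuous (fun u : 'rV[R]_n.+1 => dot u^T (A *m u^T)).
Proof.
have -> : (fun u : 'rV[R]_n.+1 => dot u^T (A *m u^T)) =
    (fun u : 'rV[R]_n.+1 => \sum_i \sum_j A i j * (u 0 i * u 0 j)).
  apply/funext => u; rewrite dotE; apply: eq_bigr => i _.
  by rewrite !mxE mulr_sumr; apply: eq_bigr => j _; rewrite !mxE; ring.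
apply: continuous_big => [|i _]; first exact: add_continuous.
apply: continuous_big => [|j _]; first exact: add_continuous.
move=> u; apply: (@cvgM _ _ (nbhs u) _ (fun=> A i j)); first exact: cvg_cst.
by apply: (@cvgM _ _ (nbhs u) _ (fun u : 'rV[R]_n.+1 => u 0 i)
  (fun u : 'rV[R]_n.+1 => u 0 j)); exact: coord_continuous.
Qed.

(* A maximiser [v] of the quadratic form on the unit ball, with value [l], is in
   the kernel of the semidefinite matrix [l - A]. *)
Lemma psd_eigenvector n (A : 'M[R]_n) : psd A -> A != 0 ->
  exists v l, [/\ dot v v = 1, 0 < l & A *m v = l *: v].
Proof.
case: n A => [A _ /eqP[]|n A pA An0]; first by apply/matrixP => -[].
pose f (u : 'rV[R]_n.+1) := dot u^T (A *m u^T).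
pose ball : set 'rV[R]_n.+1 := [set u | dot u^T u^T <= 1].
have cball : compact ball.
  apply: (@subclosed_compact _ _ [set u : 'rV[R]_n.+1 | forall i, `[-1, 1]%classic (u ord0 i)]).
  - rewrite (_ : ball = (fun u : 'rV[R]_n.+1 => dot u^T (1%:M *m u^T)) @^-1` `]-oo, 1]).
      apply: preimage_closed; last exact: lray_closed.
      by move=> u _; exact: continuous_quadratic.
    by apply/seteqP; split => u; rewrite /ball /= in_itv/= mul1mx.
  - apply: (@rV_compact R n.+1 (fun=> `[-1, 1]%classic)) => _; exact: segment_compact.
  - move=> u; rewrite /ball/= dot_nrm2 => u1 i /=; rewrite in_itv/= -ler_norml.
    rewrite -(@ler_sqr _ _ 1)// ?nnegrE// real_normK ?num_real// expr1n.
    apply: le_trans u1; rewrite /nrm2 (bigD1 i)//= mxE lerDl sumr_ge0// => j _.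
    exact: sqr_ge0.
have [u0 bu0 fmax] : exists2 u, ball u & forall w, ball w -> f w <= f u.
  have ne : ball !=set0 by exists 0; rewrite /ball/= trmx0 /dot mulmx0 mxE.
  have cf : {within ball, continuous f}.
    by apply: continuous_subspaceT; exact: continuous_quadratic.
  have [u] := compact_EVT_max ne cball cf.
  by rewrite inE => bu h; exists u => // w bw; apply: h; rewrite inE.
pose v := u0^T; pose l := dot v (A *m v).
have vmax (w : 'cV[R]_n.+1) : dot w (A *m w) <= l * dot w w.
  have [w0|wn0] := eqVneq (dot w w) 0.
    have -> : w = 0 by apply/eqP; rewrite -dot_eq0 w0.
    by rewrite /dot !mulmx0 mxE mulr0.
  have wp : 0 < dot w w by rewrite lt0r wn0 dot_ge0.
  have sp : 0 < Num.sqrt (dot w w) by rewrite sqrtr_gt0.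
  have s2 : (Num.sqrt (dot w w))^-1 * (Num.sqrt (dot w w))^-1 = (dot w w)^-1.
    by rewrite -expr2 exprVn sqr_sqrtr// ltW.
  have := fmax ((Num.sqrt (dot w w))^-1 *: w^T).
  rewrite /f /ball/= !linearZ/= trmxK !(dotZl, dotZr) !mulrA s2 mulVf//.
  by move=> /(_ (lexx _)); rewrite -/v -/l mulrC ler_pdivrMr.
have lp : 0 < l.
  rewrite lt0r psd_dot// andbT; apply: contra_neq An0 => l0.
  apply/matrixP => i j.
  have h (w : 'cV_n.+1) : A *m w = 0.
    apply: psd_ker => //; apply/eqP; rewrite eq_le psd_dot// andbT.
    by have := vmax w; rewrite l0 mul0r.
  have := congr1 (fun B : 'cV[R]_n.+1 => B i 0) (h (delta_mx j 0)).
  by rewrite -colE !mxE.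
have v1 : dot v v <= 1 by exact: bu0.
pose B := l%:M - A.
have BT : B^T = B by rewrite /B linearB/= tr_scalar_mx; case: pA => ->.
have Bw w : dot w (B *m w) = l * dot w w - dot w (A *m w).
  by rewrite mulmxBl mul_scalar_mx dotDr dotNr dotZr.
have pB : psd B.
  by split=> // w; have := Bw w; rewrite /dot mulmxA => ->; rewrite subr_ge0; exact: vmax.
have vB : dot v (B *m v) = 0.
  apply/eqP; rewrite eq_le psd_dot// andbT Bw -/l.
  by nra.
have Av : A *m v = l *: v.
  have := psd_ker pB vB; rewrite mulmxBl mul_scalar_mx => /eqP.
  by rewrite subr_eq0 => /eqP.
exists v, l; split => //.
have : l * dot v v = l by rewrite -[RHS]/(dot v (A *m v)) Av dotZr.
by move=> /eqP; rewrite -subr_eq0 -[X in _ - X]mulr1 -mulrBr mulf_eq0 (gt_eqF lp)/= subr_eq0 => /eqP.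
Qed.

(** Induction on the rank by deflation. The form of [A'] at [w] equals that of [A] at [w] minus its
    component along [v], so [A'] stays semidefinite; its kernel gains [v], so the rank drops. Only
    positive eigenvalues are kept, because later each column of [X V] is divided by the root of its
    eigenvalue. *)
Lemma psd_spectral n (A : 'M[R]_n) : psd A ->
  exists k (V : 'M[R]_(n, k)) (l : 'I_k -> R),
  [/\ V^T *m V = 1%:M, forall j, 0 < l j &
      A = V *m diag_mx (\row_j l j) *m V^T].
Proof.
have [m] := ubnP (\rank A); elim: m A => // m IH A rA pA.
have [A0|An0] := eqVneq A 0.
  exists 0, 0, (fun=> 1); split=> //; first by apply/matrixP => -[].
  by rewrite A0 !mul0mx.
have [v [l [v1 l0 Av]]] := psd_eigenvector pA An0.
have [AT Ap] := pA.
pose A' := A - l *: (v *m v^T).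
have A'T : A'^T = A' by rewrite /A' linearB/= linearZ/= trmx_mul trmxK AT.
have vTv : v^T *m v = 1%:M.
  by apply/matrixP => i j; rewrite !ord1 -[LHS]/(dot v v) v1 mxE.
have A'v : A' *m v = 0.
  by rewrite mulmxBl Av -scalemxAl -mulmxA vTv mulmx1 subrr.
have pA' : psd A'.
  split=> // w; rewrite -mulmxA -[leRHS]/(dot w (A' *m w)).
  have := psd_dot (w - dot v w *: v) pA.
  have -> : dot w (A' *m w) = dot w (A *m w) - l * dot v w ^+ 2.
    rewrite mulmxBl -scalemxAl -mulmxA dotDr dotNr dotZr; congr (_ - l * _).
    by rewrite dotMr dotE big_ord1 expr2.
  rewrite mulmxBr -scalemxAr Av !(dotDl, dotDr, dotNl, dotNr, dotZl, dotZr) v1.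
  have -> : dot v (A *m w) = l * dot v w by rewrite dotMr AT Av dotZl.
  by rewrite (dotC w v); lra.
have rA' : (\rank A' < \rank A)%N.
  have : (kermx A < kermx A')%MS.
    rewrite ltmxE; apply/andP; split.
      apply/sub_kermxP; rewrite mulmxBr mulmx_ker sub0r.
      have Kv : kermx A *m v = 0.
        apply: (scalerI (lt0r_neq0 l0)).
        by rewrite scaler0 scalemxAr -Av mulmxA mulmx_ker mul0mx.
      by rewrite -scalemxAr mulmxA Kv mul0mx scaler0 oppr0.
    apply/negP => /(submx_trans _) h.
    have /h /sub_kermxP vA : (v^T <= kermx A')%MS.
      by apply/sub_kermxP; rewrite -A'T -trmx_mul A'v trmx0.
    have : l *: v = 0 by rewrite -Av -AT -[v]trmxK -trmx_mul vA trmx0.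
    move=> /eqP; rewrite scaler_eq0 (gt_eqF l0)/= -dot_eq0 v1.
    by rewrite oner_eq0.
  move=> /rank_ltmx; rewrite !mxrank_ker => lt; rewrite ltnNge; apply: contraL lt => h.
  by rewrite -leqNgt leq_sub2l.
have [k [V [d [VV d0 A'E]]]] := IH A' (leq_trans rA' rA) pA'.
have vV : v^T *m V = 0.
  have h : v^T *m V *m diag_mx (\row_j d j) = 0.
    have -> : v^T *m V *m diag_mx (\row_j d j) = v^T *m A' *m V.
      by rewrite A'E -!mulmxA VV mulmx1 !mulmxA.
    by rewrite -A'T -trmx_mul A'v trmx0 mul0mx.
  apply/matrixP => i j; have := congr1 (fun B : 'M[R]__ => B i j) h.
  rewrite mul_mx_diag [LHS]mxE [(\row_j d j) _ _]mxE [RHS]mxE => /eqP.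
  by rewrite mulf_eq0 (gt_eqF (d0 j)) orbF => /eqP ->; rewrite mxE.
have Vv : V^T *m v = 0 by rewrite -[v]trmxK -trmx_mul vV trmx0.
exists (1 + k)%N, (row_mx v V), (row_mx l%:M (\row_j d j) 0); split.
- by rewrite tr_row_mx mul_col_row vTv VV vV Vv -scalar_mx_block.
- move=> j; case: (split_ordP j) => i ->.
    by rewrite row_mxEl ord1 !mxE eqxx.
  by rewrite row_mxEr mxE.
- rewrite (_ : \row_j _ = row_mx l%:M (\row_j d j)); last first.
    by apply/rowP => j; rewrite mxE.
  rewrite diag_mx_row mul_row_block !mulmx0 addr0 add0r tr_row_mx mul_row_col -A'E.
  rewrite (_ : diag_mx l%:M = l%:M); last first.
    by apply/matrixP => i j; rewrite !ord1 !mxE.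
  by rewrite mul_mx_scalar -scalemxAl addrC subrK.
Qed.

End spectral.

Section operator_norm.
Context {R : realType}.

(** For the supremum to be an upper bound the set must be bounded; Cauchy-Schwarz on each row bounds
    it by the Frobenius norm. *)
Lemma norm2_mul_le_opnorm n (A : 'M[R]_n) (v : 'cV[R]_n) :
  norm2 v <= 1 -> norm2 (A *m v) <= opnorm A.
Proof.
move=> v1; apply: ub_le_sup; last by exists v.
exists (Num.sqrt (\sum_i dot (row i A)^T (row i A)^T)) => _ [w w1 <-].
rewrite norm2E ler_sqrt ?sumr_ge0// => [|i _]; last exact: dot_ge0.
rewrite dotE; apply: ler_sum => i _; rewrite -expr2.
have -> : (A *m w) i 0 = dot (row i A)^T w.
  by rewrite dotE mxE; apply: eq_bigr => j _; rewrite !mxE.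
apply: le_trans (dot_CauchySchwarz _ _) _.
rewrite -[leRHS]mulr1 ler_wpM2l ?dot_ge0//.
by move: w1; rewrite /= norm2_le_sqr// expr1n.
Qed.

End operator_norm.

Section spectral_data.
Context {R : realType} {d k : nat}.
Variables (A : 'M[R]_d) (V : 'M[R]_(d, k)) (lam : 'I_k -> R).
Hypothesis VV : V^T *m V = 1%:M.
Hypothesis lam0 : forall j, 0 < lam j.
Hypothesis AE : A = V *m diag_mx (\row_j lam j) *m V^T.

Lemma spectral_mul : A *m V = V *m diag_mx (\row_j lam j).
Proof. by rewrite AE -!mulmxA VV mulmx1. Qed.

Lemma spectral_trace : \tr A = \sum_j lam j.
Proof.
rewrite AE mxtrace_mulC mulmxA VV mul1mx mxtrace_diag.
by apply: eq_bigr => j _; rewrite mxE.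
Qed.

Lemma spectral_trace_sqr : \tr (A *m A) = \sum_j lam j ^+ 2.
Proof.
rewrite {2}AE !mulmxA spectral_mul mxtrace_mulC !mulmxA VV mul1mx mulmx_diag.
by rewrite mxtrace_diag; apply: eq_bigr => j _; rewrite !mxE expr2.
Qed.

Lemma spectral_le_opnorm j : lam j <= opnorm A.
Proof.
have v1 : dot (col j V) (col j V) = 1.
  have h := congr1 (fun B : 'M[R]_k => B j j) VV; rewrite [RHS]mxE eqxx in h.
  by rewrite -[RHS]h mxE dotE; apply: eq_bigr => i _; rewrite !mxE.
have Av : A *m col j V = lam j *: col j V.
  apply/matrixP => i l; rewrite [in LHS]colE mulmxA spectral_mul -colE mxE mul_mx_diag.
  by rewrite !mxE mulrC.
have := @norm2_mul_le_opnorm _ _ A (col j V).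
rewrite !norm2E Av dotZl dotZr v1 sqrtr1 lexx => /(_ isT).
by rewrite mulr1 -expr2 sqrtr_sqr ger0_norm// ltW.
Qed.

Lemma spectral_orthogonal_split (S S1 : 'M[R]_d) :
  S = S1 + A -> S1^T = S1 -> S1^T *m A = 0 ->
  V^T *m S *m V = diag_mx (\row_j lam j).
Proof.
move=> SE S1T S1A; rewrite SE mulmxDr mulmxDl -(mulmxA V^T A) spectral_mul.
rewrite mulmxA VV mul1mx (_ : V^T *m S1 *m V = 0) ?add0r//.
suff S1V : S1 *m V = 0 by rewrite -mulmxA S1V mulmx0.
have h : S1 *m V *m diag_mx (\row_j lam j) = 0.
  by rewrite -mulmxA -spectral_mul mulmxA -{1}S1T S1A mul0mx.
apply/matrixP => i j; have := congr1 (fun B : 'M[R]__ => B i j) h.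
rewrite mul_mx_diag [LHS]mxE [(\row_j lam j) _ _]mxE [RHS]mxE => /eqP.
by rewrite mulf_eq0 (gt_eqF (lam0 j)) orbF => /eqP ->; rewrite mxE.
Qed.

End spectral_data.

Section noise_interpolation.
Context {R : realType} {n k d : nat}.
Variables (X : 'M[R]_(n, d)) (V : 'M[R]_(d, k)) (lam : 'I_k -> R) (z : 'I_n * 'I_k -> R).
Hypothesis VV : V^T *m V = 1%:M.
Hypothesis lam0 : forall j, 0 <= lam j.
Hypothesis zE : forall i j, Num.sqrt (lam j) * z (i, j) = (X *m V) i j.

Let B := X *m V.
Let M := B *m B^T.

Let gram_mulE (v : 'cV[R]_n) i :
  (M *m v) i 0 = \sum_j lam j * proj (fun i => v i 0) z j * z (i, j).
Proof.
rewrite /M -mulmxA mxE; apply: eq_bigr => j _.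
rewrite -[B i j]zE [X in _ * X]mxE /proj mulr_sumr mulr_sumr mulr_suml.
apply: eq_bigr => i' _.
by rewrite [X in _ * (X * _)]mxE -[B i' j]zE -[in RHS](sqr_sqrtr (lam0 j)); ring.
Qed.

Let gram_quad (v : 'cV[R]_n) : dot v (M *m v) = quad lam (fun i => v i 0) z.
Proof.
rewrite dotE /quad; under eq_bigr do rewrite gram_mulE mulr_sumr.
rewrite exchange_big/=; apply: eq_bigr => j _.
rewrite /quad expr2 mulrA [X in _ = _ * X]/proj mulr_sumr; apply: eq_bigr => i _.
by ring.
Qed.

Let gram_img2 (v : 'cV[R]_n) : dot (M *m v) (M *m v) = img2 lam (fun i => v i 0) z.
Proof. by rewrite dot_nrm2; apply: eq_bigr => i _; rewrite gram_mulE. Qed.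

(** With N = |x|^2 and q = x.Mx, the identity N |r|^2 = (r.x)^2 + (N |Mx|^2 - q^2) / tau^2 splits
    [r] along and across [x]. Outside [bad], |r.x| <= a N, and the last term is at most 2 n t2 (2 +
    8 L) N^2 / tau^2. The factor 4 on [dot r r] in [inv_quad_le] then gives the stated
    coefficients. *)
Lemma exists_noise_interpolator (x : 'cV[R]_n) (m tau t2 L : R) : 0 < tau ->
  (forall v, 4^-1 * tau * nrm2 v <= quad lam v z) ->
  ~ bad lam m tau t2 L (fun i => x i 0) z ->
  let a := 3 * Num.sqrt (L * m * tau) / tau in
  exists u, X *m u = x /\
    tau * dot u u <=
      dot x x * (1 + a + 4 * a ^+ 2 + 8 * n%:R * (t2 * (2 + 8 * L)) / tau ^+ 2).
Proof.
move=> tau0 qge nbad a.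
have MT : M^T = M by rewrite /M trmx_mul trmxK.
have [|Mu Mle] := @inv_quad_le _ _ M tau x MT tau0.
  by move=> v; rewrite gram_quad dot_nrm2; exact: qge.
exists (V *m (B^T *m (invmx M *m x))); split.
  by rewrite mulmxA -/B mulmxA -/M mulKVmx.
have -> : dot (V *m (B^T *m (invmx M *m x))) (V *m (B^T *m (invmx M *m x))) =
    dot x (invmx M *m x).
  rewrite dotMl mulmxA VV mul1mx dotMl trmxK mulmxA -/M mulKVmx//.
  by rewrite dotC.
apply: le_trans Mle _; set r := x - _.
set N := dot x x; have N0 : 0 <= N by exact: dot_ge0.
have NE : N = nrm2 (fun i => x i 0) by rewrite /N dot_nrm2.
set q := dot x (M *m x).
have qE : q = quad lam (fun i => x i 0) z by exact: gram_quad.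
have rx : dot r x = N - tau^-1 * q by rewrite dotDl dotNl dotZl (dotC _ x).
have rr : dot r r = N - 2 * (tau^-1 * q) + tau^-1 ^+ 2 * img2 lam (fun i => x i 0) z.
  rewrite -gram_img2 !(dotDl, dotDr, dotNl, dotNr, dotZl, dotZr) (dotC _ x) -/q -/N.
  by ring.
have h1 : q - tau * N <= 3 * Num.sqrt (L * m * tau) * N.
  by rewrite leNgt; apply/negP; rewrite qE NE => h; apply: nbad; apply: Or41.
have h2 : - (3 * Num.sqrt (L * m * tau)) * N <= q - tau * N.
  by rewrite leNgt; apply/negP; rewrite qE NE => h; apply: nbad; apply: Or42.
have h3 : quad2 lam (fun i => x i 0) z <= t2 * (2 + 8 * L) * N.
  by rewrite leNgt; apply/negP; rewrite NE => h; apply: nbad; apply: Or43.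
have h4 : img2 lam (fun i => x i 0) z * N - q ^+ 2 <=
    2 * n%:R * quad2 lam (fun i => x i 0) z * N.
  by rewrite leNgt; apply/negP; rewrite NE qE => h; apply: nbad; apply: Or44.
rewrite -exprVn; move: (quad2 lam _ z) h3 h4 rr => q2 h3 h4 rr.
have [p p0 pt] : exists2 p, 0 < p & p * tau = 1.
  by exists tau^-1; [rewrite invr_gt0|rewrite mulVf// gt_eqF].
have pE : tau^-1 = p by rewrite -[LHS]mul1r -pt mulfK// gt_eqF.
rewrite pE in rx rr *; have aE : a = p * (3 * Num.sqrt (L * m * tau)) by rewrite mulrC -pE.
move: (3 * Num.sqrt _) h1 h2 aE => s h1 h2 aE.
have rxp : dot r x = p * (tau * N - q) by rewrite rx mulrBr mulrA pt mul1r.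
have k1 : dot r x <= a * N by rewrite rxp aE -mulrA ler_pM2l//; lra.
have k2 : - (a * N) <= dot r x by rewrite rxp aE -mulrA -mulrN ler_pM2l//; lra.
have [N00|Nn0] := eqVneq N 0.
  have x0 : x = 0 by apply/eqP; rewrite -dot_eq0 -/N N00.
  by rewrite /r x0 mulmx0 scaler0 subrr N00 /dot !mulmx0 mxE !mul0r; lra.
have Np : 0 < N by rewrite lt0r Nn0.
set U := t2 * (2 + 8 * L).
have k3 : dot r r <= (a ^+ 2 + 2 * n%:R * U * p ^+ 2) * N.
  rewrite -(ler_pM2r Np) rr.
  have k4 : 2 * n%:R * q2 * N <= 2 * n%:R * (U * N) * N.
    by rewrite ler_pM2r// ler_wpM2l.
  have k5 : dot r x ^+ 2 <= (a * N) ^+ 2.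
    have : 0 <= (a * N - dot r x) * (a * N + dot r x) by apply: mulr_ge0; lra.
    by lra.
  have k6 := ler_wpM2l (sqr_ge0 p) (le_trans h4 k4).
  by move: k5; rewrite rx; move: k6; lra.
by lra.
Qed.

End noise_interpolation.

(** * The data model *)

Section data_model_transfer.
Context {R : realType} (d0 : measure_display) (T : measurableType d0) (P : probability T R).
Context {n d k : nat}.
Variables (S : 'M[R]_d) (sigma : R) (X : T -> 'M[R]_(n, d)) (xi : T -> 'cV[R]_n).
Hypothesis dm : data_model P S sigma X xi.

(** A unit combination of the new variables is the model's combination with coefficients [C V^T] and
    [c / sigma], whose variance is the squared norm of [c] by the hypothesis on [V^T S V]. Putting
    both groups in one family retains the independence of [X V] and [xi]. *)
Lemma data_model_std_gauss (V : 'M[R]_(d, k)) (lam : 'I_k -> R) :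
  0 < sigma -> (forall j, 0 < lam j) -> V^T *m S *m V = diag_mx (\row_j lam j) ->
  std_gauss P (fun (x : 'I_n * 'I_k + 'I_n) t => match x with
    | inl ij => (X t *m V) ij.1 ij.2 / Num.sqrt (lam ij.2)
    | inr i => xi t i 0 / sigma end).
Proof.
move=> sigma0 lam0 VSV c; rewrite big_sumType/= => c1.
have sl j : 0 < Num.sqrt (lam j) by rewrite sqrtr_gt0.
pose C := \matrix_(i < n, j < k) (c (inl (i, j)) / Num.sqrt (lam j)).
have [] := dm (C *m V^T) (\col_i (c (inr i) / sigma)).
have -> : (fun w => \sum_(i < n) \sum_(j < d) (C *m V^T) i j * X w i j +
      \sum_(i < n) (\col_i0 (c (inr i0) / sigma)) i 0 * xi w i 0) =
    (fun t => \sum_x c x * match x with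
      | inl ij => (X t *m V) ij.1 ij.2 / Num.sqrt (lam ij.2)
      | inr i => xi t i 0 / sigma end).
  apply/funext => w; rewrite big_sumType/=; congr (_ + _); last first.
    by apply: eq_bigr => i _; rewrite !mxE mulrAC mulrA.
  rewrite sum_pair/=; apply: eq_bigr => i _.
  under eq_bigr do rewrite mxE mulr_suml.
  rewrite exchange_big/=; apply: eq_bigr => j _.
  rewrite [X in _ = _ * (X / _)]mxE mulr_suml mulr_sumr; apply: eq_bigr => l _.
  by rewrite !mxE; ring.
have -> : \sum_(i < n) (row i (C *m V^T) *m S *m (row i (C *m V^T))^T) 0 0 +
    sigma ^+ 2 * \sum_(i < n) (\col_i0 (c (inr i0) / sigma)) i 0 ^+ 2 = 1.
  rewrite -c1; congr (_ + _); last first.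
    rewrite mulr_sumr; apply: eq_bigr => i _; rewrite mxE exprMn exprVn mulrCA mulfV ?mulr1//.
    by rewrite expf_neq0// gt_eqF.
  rewrite sum_pair; apply: eq_bigr => i _.
  rewrite row_mul trmx_mul trmxK -!mulmxA (mulmxA S) (mulmxA V^T) (mulmxA V^T) VSV.
  rewrite mulmxA mul_mx_diag mxE; apply: eq_bigr => j _.
  rewrite !mxE mulrAC -expr2 exprMn exprVn sqr_sqrtr ?ltW// mulfVK//.
  by rewrite gt_eqF.
move=> mf law; split => // B mB; rewrite law// /gauss_law oner_eq0.
by rewrite sqrtr1.
Qed.

Lemma data_model_noise0 : sigma = 0 -> exists A, [/\ measurable A, P A = 1%E &
  forall t, A t -> xi t = 0].
Proof.
move=> sigma0.
have h i : measurable_fun setT (fun t => xi t i 0) /\ P [set t | xi t i 0 = 0] = 1%E.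
  have [] := dm 0 (delta_mx i 0).
  have -> : (fun w => \sum_(i0 < n) \sum_(j < d) (0 : 'M[R]_(n, d)) i0 j * X w i0 j +
      \sum_(i0 < n) (delta_mx i 0 : 'cV[R]_n) i0 0 * xi w i0 0) = (fun t => xi t i 0).
    apply/funext => w; rewrite big1 ?add0r => [|i' _]; last first.
      by rewrite big1// => j _; rewrite mxE mul0r.
    rewrite (bigD1 i)//= big1 => [|j ji]; first by rewrite mxE !eqxx mul1r addr0.
    by rewrite mxE (negPf ji) mul0r.
  move=> mx /(_ [set 0] (measurable_set1 _)) law; split => //.
  rewrite law sigma0 expr0n/= mul0r addr0 big1 => [|i' _]; last first.
    by rewrite row0 !mul0mx mxE.
  by rewrite /gauss_law eqxx indicE mem_set.
have mn i : measurable [set t | xi t i 0 = 0].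
  by have := (h i).1 measurableT _ (measurable_set1 0); rewrite setTI.
exists (~` \big[setU/set0]_(i < n) ~` [set t | xi t i 0 = 0]).
have mU : measurable (\big[setU/set0]_(i < n) ~` [set t | xi t i 0 = 0]).
  by apply: bigsetU_measurable => i _; exact: measurableC.
split.
- exact: measurableC.
- rewrite probability_setC// (_ : P _ = 0%E) ?sube0//.
  apply/eqP; rewrite eq_le measure_ge0 andbT.
  apply: le_trans (prob_bigsetU_le (a := fun=> 0) _ _) _ => [i|i|].
  + exact: measurableC.
  + by rewrite probability_setC// (h i).2 subee.
  + by rewrite big1.
- move=> t h'; apply/matrixP => i j; rewrite ord1 mxE; apply: contrapT => hi; apply: h'.
  by rewrite -bigcup_seq; exists i => //=; rewrite mem_index_enum.
Qed.

End data_model_transfer.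

(** * Constants *)

Section constants.
Context {R : realType}.

(** The 8 makes seven tails of size exp(-L) sum to 7 delta / 8. It costs only a constant factor,
    because [delta <= 1 / 4] gives 8 / delta <= (1 / delta)^3. *)
Lemma ln_inv_bounds (delta : R) : 0 < delta -> delta <= 1 / 4 ->
  2^-1 <= ln (1 / delta) /\
  [/\ ln (1 / delta) <= ln (8 / delta), ln (8 / delta) <= 3 * ln (1 / delta) &
      1 - delta <= 1 - expR (- ln (8 / delta)) *+ 7].
Proof.
move=> d0 d4; have i4 : 4 <= 1 / delta by rewrite ler_pdivlMr//; lra.
have ip : 0 < 1 / delta by lra.
have i8 : 8 / delta = 8 * (1 / delta) by rewrite mul1r.
have i8p : 0 < 8 / delta by rewrite i8; lra.
split.
  have -> : 2^-1 = ln (expR 2^-1) :> R by rewrite expRK.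
  rewrite ler_ln ?posrE ?expR_gt0//; apply: le_trans i4.
  have := expR_ge1Dx (- 2^-1 : R); have := expRxMexpNx_1 (2^-1 : R).
  by have := expR_gt0 (2^-1 : R); nra.
split.
- by rewrite ler_ln ?posrE// i8; lra.
- rewrite [leRHS]mulr_natl -lnXn// ler_ln ?posrE ?exprn_gt0// i8.
  by rewrite !exprS expr0 mulr1; nra.
- rewrite expRN lnK ?posrE// invf_div lerD2l lerN2.
  by rewrite -mulr_natl; lra.
Qed.

(** From L <= 3 [L0] and sqrt 3 <= 2 come a <= 6 e1 and the noise factor 1 + 6 e2. Smallness of e1
    gives 4 a^2 <= e1, and 2 + 8 L <= 28 [L0] gives 224 e3. Expanding (1 + 6 e2)(1 + 7 e1 + 224 e3),
    the cross terms are at most e2, well within 2000. *)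
Lemma error_terms_le (N tau m t2 L0 L e1 e2 e3 : R) :
  0 < N -> 0 < tau -> 0 <= m -> 0 <= t2 -> 2^-1 <= L0 -> L0 <= L -> L <= 3 * L0 ->
  0 <= e1 -> 0 <= e2 -> 0 <= e3 ->
  L0 * m = e1 ^+ 2 * tau -> L0 = e2 ^+ 2 * N -> N * L0 * t2 = e3 * tau ^+ 2 ->
  2000 * (e1 + e2 + e3) <= 1 ->
  forall a, a = 3 * Num.sqrt (L * m * tau) / tau ->
  (N + 3 * Num.sqrt (L * N)) *
    (1 + a + 4 * a ^+ 2 + 8 * N * (t2 * (2 + 8 * L)) / tau ^+ 2) <=
  N * (1 + 2000 * (e1 + e2 + e3)).
Proof.
move=> N0 tau0 m0 t20 L00 L0L L3 e10 e20 e30 E1 E2 E3 small a aE.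
have a_ge0 : 0 <= a by rewrite aE divr_ge0// ?ltW// mulr_ge0// sqrtr_ge0.
have sqrt_le x y : 0 <= y -> x <= y ^+ 2 -> Num.sqrt x <= y.
  by move=> y0 xy; rewrite -[leRHS]ger0_norm// -sqrtr_sqr ler_sqrt// sqr_ge0.
have ae : a <= 6 * e1.
  rewrite aE ler_pdivrMr// (_ : 6 * e1 * tau = 3 * (2 * e1 * tau)); last by ring.
  rewrite ler_pM2l//; apply: sqrt_le; first by rewrite !mulr_ge0// ltW.
  have : L * m <= 3 * (e1 ^+ 2 * tau) by rewrite -E1 mulrA ler_wpM2r.
  move=> /(ler_wpM2r (ltW tau0)) h.
  by apply: le_trans h _; have := sqr_ge0 (e1 * tau); rewrite exprMn; lra.
have be : Num.sqrt (L * N) <= 2 * e2 * N.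
  apply: sqrt_le; first by rewrite !mulr_ge0// ltW.
  have h : L * N <= 3 * (e2 ^+ 2 * N) * N by rewrite -E2 ler_wpM2r// ltW.
  by apply: le_trans h _; have := sqr_ge0 (e2 * N); rewrite exprMn; lra.
have ce : 8 * N * (t2 * (2 + 8 * L)) / tau ^+ 2 <= 224 * e3.
  rewrite ler_pdivrMr ?exprn_gt0//.
  have Nt : 0 <= N * t2 by rewrite mulr_ge0// ltW.
  have : N * t2 * (2 + 8 * L) <= N * t2 * (28 * L0) by apply: ler_wpM2l => //; lra.
  lra.
have a2 : 4 * a ^+ 2 <= e1.
  have : a * a <= (6 * e1) * (6 * e1) by apply: ler_pM.
  have : e1 * (144 * e1) <= e1 * 1 by apply: ler_wpM2l => //; lra.
  rewrite expr2; lra.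
apply: (@le_trans _ _ (N * (1 + 6 * e2) * (1 + 7 * e1 + 224 * e3))).
  apply: ler_pM; first by apply: addr_ge0; [exact: ltW|rewrite mulr_ge0// sqrtr_ge0].
  - have : 0 <= 8 * N * (t2 * (2 + 8 * L)) / tau ^+ 2.
      apply: divr_ge0; last by rewrite exprn_ge0// ltW.
      by apply: mulr_ge0; [rewrite mulr_ge0// ltW|apply: mulr_ge0 => //; lra].
    have := sqr_ge0 a; lra.
  - lra.
  - lra.
rewrite -mulrA ler_pM2l//.
clear -e10 e20 e30 small.
have : e2 * (42 * e1 + 1344 * e3) <= e2 * 1 by apply: ler_wpM2l; [exact: e20|lra].
lra.
Qed.

(** The condition [epsilon <= 1] supplies the side conditions of the good event. Each e is below
    1/100, so 48 e^2 <= 1, where 48 = 16 * 3. For the last one, K >= 2000 N [L0] >= 1000 N, while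
    128 (6 N + L) <= 776 N. *)
Lemma error_terms_small (N tau m K L0 L e1 e2 e3 : R) :
  0 < N -> 0 < tau -> 0 <= m -> 0 < K -> 2^-1 <= L0 -> L <= 3 * L0 ->
  0 <= e1 -> 0 <= e2 -> 0 <= e3 ->
  L0 * m = e1 ^+ 2 * tau -> L0 = e2 ^+ 2 * N -> N * L0 = e3 * K ->
  2000 * (e1 + e2 + e3) <= 1 ->
  [/\ 16 * (L * m) <= tau, 16 * L <= N & 128 * (6 * N + L) <= K].
Proof.
move=> N0 tau0 m0 K0 L0_ge L3 e10 e20 e30 E1 E2 E3 small.
have sqr_le (e : R) : 0 <= e -> e <= e1 + e2 + e3 -> 48 * e ^+ 2 <= 1.
  move=> e0 e_le; have s100 : e <= 100^-1 by lra.
  have : e * e <= 100^-1 * 100^-1 by exact: ler_pM.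
  by clear; rewrite expr2; lra.
have Ln : 16 * L <= N.
  have : 48 * e2 ^+ 2 * N <= 1 * N by apply: ler_wpM2r; [exact: ltW|apply: sqr_le; lra].
  by clear -L3 E2; lra.
split=> //.
- have : L * m <= 3 * (e1 ^+ 2 * tau) by rewrite -E1 mulrA ler_wpM2r.
  have : 48 * e1 ^+ 2 * tau <= 1 * tau by apply: ler_wpM2r; [exact: ltW|apply: sqr_le; lra].
  by clear; lra.
- have : 2000 * e3 * K <= 1 * K by apply: ler_wpM2r; [exact: ltW|lra].
  have : N * 2^-1 <= N * L0 by rewrite ler_pM2l.
  by clear -Ln E3 N0; lra.
Qed.

End constants.

(** * Assembly of the interpolation bound *)

Lemma min_norm_le (R : realType) n d (X : 'M[R]_(n, d)) (w u : 'cV[R]_d) (xi : 'cV[R]_n) b :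
  X *m u = xi -> norm2 u <= b ->
  exists what, min_norm_interp X (X *m w + xi) what /\ norm2 what <= norm2 w + b.
Proof.
move=> Xu ub; have [what [Xw wmin]] := min_norm_exists X (w + u).
rewrite mulmxDr Xu in Xw wmin; exists what; split => //.
apply: le_trans (wmin (w + u) _) _; first by rewrite mulmxDr Xu.
by apply: le_trans (norm2D _ _) _; rewrite lerD2l.
Qed.

Lemma min_norm_interp_good_event (R : realType) d0 (T : measurableType d0)
    (P : probability T R) n d k (S S1 A : 'M[R]_d) (V : 'M[R]_(d, k)) (lam : 'I_k -> R)
    (sigma eps L : R) (X : T -> 'M[R]_(n.+1, d)) (xi : T -> 'cV[R]_n.+1) (wstar : 'cV[R]_d) :
  data_model P S sigma X xi -> 0 < sigma ->
  S = S1 + A -> S1^T = S1 -> S1^T *m A = 0 ->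
  V^T *m V = 1%:M -> (forall j, 0 < lam j) -> A = V *m diag_mx (\row_j lam j) *m V^T ->
  0 < \tr A -> 0 < \tr (A *m A) -> 0 < opnorm A -> 0 < L -> 16 * (L * opnorm A) <= \tr A -> 16 * L <= n.+1%:R ->
  128 * (6 * n.+1%:R + L) <= eff_R A ->
  (forall a, a = 3 * Num.sqrt (L * opnorm A * \tr A) / \tr A ->
    (n.+1%:R + 3 * Num.sqrt (L * n.+1%:R)) *
    (1 + a + 4 * a ^+ 2 + 8 * n.+1%:R * (\tr (A *m A) * (2 + 8 * L)) / \tr A ^+ 2) <=
    n.+1%:R * (1 + eps)) ->
  exists E, [/\ measurable E, ((1 - expR (- L) *+ 7)%:E <= P E)%E & forall t, E t ->
    exists what, min_norm_interp (X t) (X t *m wstar + xi t) what /\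
      norm2 what <= norm2 wstar +
        Num.sqrt (1 + eps) * sigma * Num.sqrt (n.+1%:R / \tr A)].
Proof.
move=> dm sigma0 SE S1T S1A VV lam0 AE tau0 t20 m0 L0 Lm Ln Kn err.
have VSV := spectral_orthogonal_split VV lam0 AE SE S1T S1A.
have stdG := data_model_std_gauss dm sigma0 lam0 VSV.
have tauE := spectral_trace VV AE; have t2E := spectral_trace_sqr VV AE.
have lamm := spectral_le_opnorm VV lam0 AE.
have Kt2 : eff_R A * \sum_j lam j ^+ 2 <= \tr A ^+ 2.
  by rewrite -t2E /eff_R divfK// gt_eqF.
have [E [mE PE good]] := exists_good_event stdG lam0 lamm m0 (esym tauE) tau0 L0 Lm Ln Kt2 Kn.
exists E; split=> // t /good[tr_le noise_le nbad lat_ge].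
pose z (ij : 'I_n.+1 * 'I_k) := (X t *m V) ij.1 ij.2 / Num.sqrt (lam ij.2).
pose x := sigma^-1 *: xi t.
have xE : (fun i => xi t i 0 / sigma) = (fun i => x i 0).
  by apply/funext => i; rewrite mxE mulrC.
rewrite xE in noise_le nbad; rewrite -t2E in nbad.
have zX i j : Num.sqrt (lam j) * z (i, j) = (X t *m V) i j.
  by rewrite /z mulrC divfK// gt_eqF// sqrtr_gt0.
have lam_ge0 j : 0 <= lam j by exact: ltW.
have qge := @quad_ge _ _ _ lam z _ lam_ge0 tau0 tr_le lat_ge.
have [u [Xu uu]] := exists_noise_interpolator VV lam_ge0 zX tau0 qge nbad.
have N0 : (0 : R) < n.+1%:R by rewrite ltr0n.
have {}uu : \tr A * dot u u <= n.+1%:R * (1 + eps).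
  apply: le_trans (err _ erefl); apply: le_trans uu _.
  apply: ler_wpM2r; last by rewrite dot_nrm2.
  set a := 3 * _ / _; have a0 : 0 <= a by rewrite divr_ge0 ?mulr_ge0 ?sqrtr_ge0// ltW.
  apply: addr_ge0; first by have := sqr_ge0 a; lra.
  apply: divr_ge0; last exact: sqr_ge0.
  apply: mulr_ge0; first by rewrite mulr_ge0.
  by apply: mulr_ge0; [exact: ltW|lra].
apply: (@min_norm_le _ _ _ _ _ (sigma *: u)).
  by rewrite -scalemxAr Xu scalerA mulfV ?scale1r// gt_eqF.
(* The sign of [1 + eps] is read off from the bound [uu] itself, whose left side is nonnegative. *)
have eps1 : 0 <= 1 + eps.
  by rewrite -(pmulr_rge0 _ N0); apply: le_trans uu; rewrite mulr_ge0 ?dot_ge0// ltW.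
have t1 : 0 <= n.+1%:R / \tr A by rewrite divr_ge0// ltW.
rewrite norm2_le_sqr; last by rewrite !mulr_ge0 ?sqrtr_ge0// ltW.
have : dot u u <= (1 + eps) * (n.+1%:R / \tr A).
  by rewrite mulrA ler_pdivlMr// mulrC [leRHS]mulrC.
move=> /(ler_wpM2l (sqr_ge0 sigma)).
by rewrite !exprMn !sqr_sqrtr// dotZl dotZr; lra.
Qed.

Lemma min_norm_interp_noiseless (R : realType) d0 (T : measurableType d0)
    (P : probability T R) n d (S : 'M[R]_d) (X : T -> 'M[R]_(n, d))
    (xi : T -> 'cV[R]_n) (wstar : 'cV[R]_d) (delta b : R) :
  data_model P S 0 X xi -> 0 <= delta -> 0 <= b ->
  exists E, [/\ measurable E, ((1 - delta)%:E <= P E)%E & forall t, E t ->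
    exists what, min_norm_interp (X t) (X t *m wstar + xi t) what /\
      norm2 what <= norm2 wstar + b].
Proof.
move=> dm d0' b0; have [E [mE PE E0]] := data_model_noise0 dm erefl.
exists E; split=> // [|t /E0 xi0].
  by rewrite PE lee_fin gerBl.
apply: (@min_norm_le _ _ _ _ _ 0); first by rewrite mulmx0 xi0.
by rewrite norm2E /dot mulmx0 mxE sqrtr0.
Qed.

Theorem theorem2 (R : realType) :
  exists c C : R, 0 < c /\ 0 < C /\
  forall (delta : R) (n d : nat) (Sigma : 'M[R]_d) (wstar : 'cV[R]_d) (sigma : R),
    0 < delta -> delta <= 1 / 4 ->
    (0 < n)%N -> (n <= d)%N ->
    psd Sigma -> 0 <= sigma ->
  forall Sigma1 Sigma2 : 'M[R]_d,
    cov_split Sigma Sigma1 Sigma2 -> Sigma2 != 0 ->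
  exists eps : R,
    eps <= C * (Num.sqrt (ln (1 / delta) / eff_r Sigma2)
                + Num.sqrt (ln (1 / delta) / n%:R)
                + n%:R * ln (1 / delta) / eff_R Sigma2) /\
    (eps <= 1 -> eff_R Sigma2 >= c * ln (1 / delta) ^+ 2 ->
     forall (d0 : measure_display) (T : measurableType d0) (P : probability T R)
            (X : T -> 'M[R]_(n, d)) (xi : T -> 'cV[R]_n),
       data_model P Sigma sigma X xi ->
       exists A : set T, measurable A /\ ((1 - delta)%:E <= P A)%E /\
         forall t, A t ->
           exists what : 'cV[R]_d,
             min_norm_interp (X t) (X t *m wstar + xi t) what /\
             norm2 what <= norm2 wstar
               + Num.sqrt (1 + eps) * sigma * Num.sqrt (n%:R / \tr Sigma2)).
Proof.
exists 1, 2000; split; first by []; split; first by rewrite ltr0n.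
move=> delta [//|n] d S wstar sigma delta0 delta4 _ _ _ sigma0 S1 A [SE [[S1T _] [pA S1A]]] An0.
have [L0_ge [L0_le L_le prob_le]] := ln_inv_bounds delta0 delta4.
have [k [V [lam [VV lam0 AE]]]] := psd_spectral pA.
have tauE := spectral_trace VV AE; have t2E := spectral_trace_sqr VV AE.
have lamm := spectral_le_opnorm VV lam0 AE.
have kp : (0 < k)%N.
  rewrite ltnNge; apply: contra_neqN An0 => k0; rewrite AE; apply/matrixP => i j.
  by rewrite !mxE big1// => l; have := leq_trans (ltn_ord l) k0.
have tau0 : 0 < \tr A.
  rewrite tauE (bigD1 (Ordinal kp))//= ltr_pwDl//.
  by apply: sumr_ge0 => j _; exact: ltW.
have t20 : 0 < \tr (A *m A).
  rewrite t2E (bigD1 (Ordinal kp))//= ltr_pwDl ?exprn_gt0//.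
  by apply: sumr_ge0 => j _; exact: sqr_ge0.
have m0 : 0 < opnorm A by apply: lt_le_trans (lamm (Ordinal kp)).
set L0 := ln (1 / delta) in L0_ge L0_le L_le *; set L := ln (8 / delta) in L0_le L_le prob_le.
set e1 := Num.sqrt (L0 / eff_r A); set e2 := Num.sqrt (L0 / n.+1%:R).
set e3 := n.+1%:R * L0 / eff_R A.
(* With [eps] equal to the full bound, [eps <= 1] becomes a smallness condition on each of the three
   terms. *)
exists (2000 * (e1 + e2 + e3)); split => // small _ d0 T P X xi dm.
have N0 : (0 : R) < n.+1%:R by rewrite ltr0n.
have L0p : 0 < L0 by apply: lt_le_trans L0_ge; rewrite invr_gt0 ltr0n.
have e10 : 0 <= e1 by exact: sqrtr_ge0.
have e20 : 0 <= e2 by exact: sqrtr_ge0.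
have R0 : 0 < eff_R A by rewrite divr_gt0// exprn_gt0.
have e30 : 0 <= e3 by apply: divr_ge0; [rewrite mulr_ge0// ltW|exact: ltW].
have E1 : L0 * opnorm A = e1 ^+ 2 * \tr A.
  rewrite sqr_sqrtr; first by rewrite /eff_r invf_div -mulrA divfK// gt_eqF.
  by rewrite !divr_ge0// ltW.
have E2 : L0 = e2 ^+ 2 * n.+1%:R.
  by rewrite sqr_sqrtr ?divfK// ?gt_eqF// divr_ge0// ltW.
have E3 : n.+1%:R * L0 * \tr (A *m A) = e3 * \tr A ^+ 2.
  by rewrite /e3 /eff_R invf_div -[RHS]mulrA divfK// expf_neq0// gt_eqF.
have [sigma00|sigman0] := eqVneq sigma 0.
  rewrite sigma00 in dm *; have [||E [mE PE good]] :=
    @min_norm_interp_noiseless _ _ _ _ _ _ _ _ _ wstar delta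
      (Num.sqrt (1 + 2000 * (e1 + e2 + e3)) * 0 * Num.sqrt (n.+1%:R / \tr A)) dm.
  - exact: ltW.
  - by rewrite mulr0 mul0r.
  - by exists E.
have sigmap : 0 < sigma by rewrite lt0r sigman0.
have E4 : n.+1%:R * L0 = e3 * eff_R A by rewrite divfK// gt_eqF.
have [Lm Ln Kn] := error_terms_small N0 tau0 (ltW m0) R0 L0_ge L_le e10 e20 e30 E1 E2 E4 small.
have [||E [mE PE good]] := @min_norm_interp_good_event _ _ _ _ _ _ _ _ _ _ _ _ _
  (2000 * (e1 + e2 + e3)) L _ _ wstar dm sigmap SE S1T S1A VV lam0 AE tau0 t20 m0 _ Lm Ln Kn.
- by apply: lt_le_trans L0_le.
- move=> a aE.
  exact: (error_terms_le N0 tau0 (ltW m0) (ltW t20) L0_ge L0_le L_le e10 e20 e30 E1 E2 E3 small aE).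
exists E; split=> //; split; last exact: good.
by apply: le_trans PE; rewrite lee_fin.
Qed.
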